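(* Let $\ell\geq1$ be an integer and, for $j=1,2$, let $a^j\in C^{3+\ell}(\mathbb{R}\times\mathbb{R}^n;\mathbb{R}^{n\times n})$ be symmetric, elliptic (with a common ellipticity function $\kappa$; see the context) and of the form $$a^j(\mu,\eta)=\gamma^j(\mu,\eta)\,\mathrm{Id}_{\mathbb{R}^{n\times n}},\quad(\mu,\eta)\in\mathbb{R}\times\mathbb{R}^n,\qquad\gamma^j\in C^{3+\ell}(\mathbb{R}\times\mathbb{R}^n;(0,+\infty)).$$ Assume that there is an increasing function $\psi\in C(\mathbb{R}_+;\mathbb{R}_+)$ such that, for $j=1,2$, $$|\partial_\mu^k\partial_\eta^\beta a^j(\mu,0)|_{\mathbb{R}^{n\times n}}\leq\psi(|\mu|),\qquad\mu\in\mathbb{R},\ k\in\mathbb{N},\ \beta\in\mathbb{N}^n,\ k+|\beta|\leq3+\ell ,$$ and that there exist an orthonormal basis $\{e_1',\ldots,e_n'\}$ of $\mathbb{R}^n$ and points $x_1,\ldots,x_n\in\partial\Omega$ such that $|\nu(x_i)-e_i'|<\frac1{\sqrt n}$ for $i=1,\ldots,n$. For $\lambda\in\mathbb{R}$, $\omega\in\mathbb{S}^{n-1}$, $\tau\in(-\epsilon_\lambda,\epsilon_\lambda)$ let $u^j_{\lambda,\omega,\tau}\in C^{2+\alpha}(\overline\Omega)$ be the unique solution of $$-\sum_{i,k=1}^n\partial_{x_i}\big(a^j_{i,k}(u,\nabla u)\,\partial_{x_k}u\big)=0\ \text{ in }\Omega,\qquad u(x)=\lambda+\tau\,x\cdot\omega\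 \text{ for }x\in\partial\Omega .$$ Let $x_0\in\partial\Omega$ and $R>0$ be arbitrary and, for $k=1,\ldots,\ell$, set $$\delta_k=\sup_{\omega\in\mathbb{S}^{n-1}}\ \sup_{\lambda\in[-R,R]}\Big|\partial_\tau^k\big(\partial_{\nu_{a^1}}u^1_{\lambda,\omega,\tau}(x_0)-\partial_{\nu_{a^2}}u^2_{\lambda,\omega,\tau}(x_0)\big)\big|_{\tau=0}\Big| .$$ Then there exists a constant $C_1>0$ depending only on $n$ such that $$\sup_{\lambda\in[-R,R]}|\gamma^1(\lambda,0)-\gamma^2(\lambda,0)|\leq C_1\,\delta_1 .$$ In addition, there exists $C_2>0$ depending on $x_0,\kappa,\psi,R,n$ and $\Omega$ such that, for all $N=1,\ldots,\ell-1$, $$\sup_{\lambda\in[-R,R]}\big\|D_\eta^N\gamma^1(\lambda,0)-D_\eta^N\gamma^2(\lambda,0)\big\|_{T_N}\leq C_2\sum_{k=1}^{N+1}\delta_k^{\,3^k/3^{N+1}} .$$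
   Context: Let $n\geq2$, $\alpha\in(0,1)$, and let $\Omega\subset\mathbb{R}^n$ be a bounded domain with $C^{2+\alpha}$ boundary; $\nu$ is the outward unit normal to $\partial\Omega$ and $\mathbb{S}^{n-1}=\{x\in\mathbb{R}^n:|x|=1\}$. Here $\mathbb{N}$ includes $0$ in the bound involving $\psi$, and $\mathbb{R}_+=[0,+\infty)$. Variables of a coefficient $a$ are written $(\mu,\eta)\in\mathbb{R}\times\mathbb{R}^n$. The integer $\ell$ is fixed, so constants may depend on it. A coefficient $a=(a_{i,k})$ is symmetric if $a_{i,k}(\mu,\eta)=a_{k,i}(\mu,\eta)$ for all $(\mu,\eta)$ and $i,k$; it is elliptic with ellipticity function $\kappa\in C(\mathbb{R}\times\mathbb{R}^n;(0,+\infty))$ if $\sum_{i,k=1}^n a_{i,k}(\mu,\eta)\xi_i\xi_k\geq\kappa(\mu,\eta)|\xi|^2$ for all $\mu\in\mathbb{R}$, $\eta,\xi\in\mathbb{R}^n$. For each $\lambda\in\mathbb{R}$, $\epsilon_\lambda>0$ denotes a number, depending only on $a^1,a^2,\lambda,\Omega$, such that for $j=1,2$, all $\omega\in\mathbb{S}^{n-1}$ and all $\tau\in(-\epsilon_\lambda,\epsilon_\lambda)$ the boundary value problem in the claim has a unique solution $u^j_{\lambda,\omega,\tau}\in C^{2+\alpha}(\overline\Omega)$, and such that $\tau\mapsto u^j_{\lambda,\omega,\tau}$ belongs to $C^\ell((-\epsilon_\lambda,\epsilon_\lambda);C^{2+\alpha}(\overline\Omega))$. The flux is $\partial_{\nu_{a^j}}u(x)=\sum_{i,k=1}^n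 a^j_{i,k}(u(x),\nabla u(x))\,\partial_{x_k}u(x)\,\nu_i(x)$, $x\in\partial\Omega$. $D_\eta^N\gamma(\lambda,0)$ denotes the $N$-th order derivative of $\gamma$ with respect to $\eta$ at $(\lambda,0)$, viewed as an element of the space $T_N$ of tensors of rank $N$ of $\mathbb{R}^n$, and $\|\cdot\|_{T_N}$, $|\cdot|_{\mathbb{R}^{n\times n}}$ are fixed norms on these spaces. *)

(* Defs.v *)
From HB Require Import structures.
From mathcomp Require Import all_boot all_order all_algebra.
From mathcomp Require Import all_classical all_reals all_analysis.
Set Implicit Arguments.
Unset Strict Implicit.
Unset Printing Implicit Defensive.
Import Order.TTheory GRing.Theory Num.Theory.
Import numFieldNormedType.Exports.
Local Open Scope classical_set_scope.
Local Open Scope ring_scope.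

(* The library norm on ['rV[R]_n] is the sup norm: it is used for the topology
   and for directional derivatives only. Lengths are measured by [enorm]. *)
Definition dot (R : realType) (n : nat) (x y : 'rV[R]_n) : R :=
  \sum_(i < n) x 0 i * y 0 i.

Definition enorm (R : realType) (n : nat) (x : 'rV[R]_n) : R :=
  Num.sqrt (dot x x).

Definition unit_sphere (R : realType) (n : nat) : set 'rV[R]_n :=
  [set w | enorm w = 1].

Definition evec (R : realType) (n : nat) (i : 'I_n) : 'rV[R]_n := delta_mx 0 i.

Definition boundary (T : topologicalType) (A : set T) : set T :=
  closure A `\` interior A.

Definition partial (R : realType) (n : nat) (i : 'I_n) (f : 'rV[R]_n -> R)
  : 'rV[R]_n -> R := fun x => 'D_(evec R i) f x.

Definition grad (R : realType) (n : nat) (f : 'rV[R]_n -> R) (x : 'rV[R]_n)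
  : 'rV[R]_n := \row_(i < n) partial i f x.

(* C^m on an open set [U] of a finite-dimensional space [V]. *)
Fixpoint Ck (R : realType) (V W : normedModType R) (m : nat) (U : set V)
    (f : V -> W) {struct m} : Prop :=
  (forall x, U x -> {for x, continuous f}) /\
  if m is m'.+1 then
    forall v : V, (forall x, U x -> derivable f x v) /\
                  Ck m' U (fun x => 'D_v f x)
  else True.

Definition is_norm (R : realType) (V : lmodType R) (p : V -> R) : Prop :=
  [/\ forall x y, p (x + y) <= p x + p y,
      forall c x, p (c *: x) = `|c| * p x
    & forall x, p x = 0 -> x = 0].

Definition sup_norm (R : realType) (n : nat) (Om : set 'rV[R]_n)
    (f : 'rV[R]_n -> R) : \bar R :=
  ereal_sup [set `|f x|%:E | x in Om].

Definition holder_seminorm (R : realType) (n : nat) (alpha : R)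
    (Om : set 'rV[R]_n) (f : 'rV[R]_n -> R) : \bar R :=
  ereal_sup [set (`|f p.1 - f p.2| / (enorm (p.1 - p.2) `^ alpha))%:E |
             p in [set p | [/\ Om p.1, Om p.2 & p.1 != p.2]]].

Definition holder2_norm (R : realType) (n : nat) (alpha : R)
    (Om : set 'rV[R]_n) (f : 'rV[R]_n -> R) : \bar R :=
  (sup_norm Om f + \sum_(i < n) sup_norm Om (partial i f)
   + \sum_(i < n) \sum_(j < n)
       (sup_norm Om (partial i (partial j f))
        + holder_seminorm alpha Om (partial i (partial j f))))%E.

(* C^{2+alpha}(closure Om): the derivatives of order at most 2, taken in the
   open set [Om], extend continuously to the closure, and the norm is finite.
   Values outside [closure Om] are irrelevant. *)
Definition holder2 (R : realType) (n : nat) (alpha : R) (Om : set 'rV[R]_n)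
    (f : 'rV[R]_n -> R) : Prop :=
  [/\ Ck 2 Om f,
      {within closure Om, continuous f},
      (forall x, closure Om x -> forall i : 'I_n,
         cvg (partial i f y @[y --> within Om (nbhs x)])),
      (forall x, closure Om x -> forall i j : 'I_n,
         cvg (partial i (partial j f) y @[y --> within Om (nbhs x)]))
    & (holder2_norm alpha Om f < +oo)%E].

(* t |-> w t is of class C^m from ]-eps, eps[ to C^{2+alpha}(closure Om);
   w' is the derivative of w for the norm of that space. *)
Fixpoint Ck_curve (R : realType) (n : nat) (alpha : R) (Om : set 'rV[R]_n)
    (eps : R) (m : nat) (w : R -> 'rV[R]_n -> R) {struct m} : Prop :=
  [/\ forall t, `|t| < eps -> holder2 alpha Om (w t),
      forall t, `|t| < eps ->
        holder2_norm alpha Om (w s \- w t) @[s --> t] --> 0%E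
    & if m is m'.+1 then
        exists w' : R -> 'rV[R]_n -> R,
          (forall t, `|t| < eps ->
             holder2_norm alpha Om
               (fun x => h^-1 * (w (t + h) x - w t x) - w' t x)
             @[h --> 0^'] --> 0%E)
          /\ Ck_curve alpha Om eps m' w'
      else True].

(* In the open ball of centre [x0] and radius [r], [Om] is the strict subgraph
   of [phi] in the direction [e]; [phi] is only evaluated on the hyperplane
   orthogonal to [e]. *)
Definition local_subgraph (R : realType) (n : nat) (Om : set 'rV[R]_n)
    (x0 : 'rV[R]_n) (r : R) (e : 'rV[R]_n) (phi : 'rV[R]_n -> R) : Prop :=
  [/\ 0 < r, enorm e = 1
    & forall y, enorm (y - x0) < r ->
        (Om y <-> dot y e < phi (y - dot y e *: e))].

Definition holder2_boundary (R : realType) (n : nat) (alpha : R)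
    (Om : set 'rV[R]_n) : Prop :=
  forall x0, boundary Om x0 ->
    exists r e phi, local_subgraph Om x0 r e phi /\ holder2 alpha setT phi.

Definition holder2_domain (R : realType) (n : nat) (alpha : R)
    (Om : set 'rV[R]_n) : Prop :=
  [/\ open Om, connected Om, Om !=set0, bounded_set Om
    & holder2_boundary alpha Om].

(* With rho y = y.e - phi(y - (y.e)e), the set is {rho < 0} near x and the
   outward unit normal is grad rho / |grad rho|. *)
Definition outward_unit_normal (R : realType) (n : nat) (Om : set 'rV[R]_n)
    (x nu : 'rV[R]_n) : Prop :=
  exists r e phi,
    [/\ local_subgraph Om x r e phi, Ck 1 setT phi
      & let g := grad (fun y => dot y e - phi (y - dot y e *: e)) x in
        nu = (enorm g)^-1 *: g].

(* A coefficient is a function of (mu, eta). *)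
Definition coef (R : realType) (n : nat) : Type :=
  (R * 'rV[R]_n)%type -> 'M[R]_n.

Definition coef_symmetric (R : realType) (n : nat) (a : coef R n) : Prop :=
  forall p i k, a p i k = a p k i.

Definition coef_elliptic (R : realType) (n : nat)
    (kappa : (R * 'rV[R]_n)%type -> R) (a : coef R n) : Prop :=
  forall p (xi : 'rV[R]_n),
    kappa p * enorm xi ^+ 2 <= \sum_i \sum_k a p i k * xi 0 i * xi 0 k.

Definition d_mu (R : realType) (n : nat) (W : normedModType R)
    (f : (R * 'rV[R]_n)%type -> W) : (R * 'rV[R]_n)%type -> W :=
  fun p => 'D_((1 : R), (0 : 'rV[R]_n)) f p.

Definition d_eta (R : realType) (n : nat) (W : normedModType R) (i : 'I_n)
    (f : (R * 'rV[R]_n)%type -> W) : (R * 'rV[R]_n)%type -> W :=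
  fun p => 'D_((0 : R), evec R i) f p.

Definition d_mu_eta (R : realType) (n : nat) (W : normedModType R) (k : nat)
    (beta : 'I_n -> nat) (f : (R * 'rV[R]_n)%type -> W)
  : (R * 'rV[R]_n)%type -> W :=
  iter k (@d_mu R n W)
    (foldr (fun i g => iter (beta i) (@d_eta R n W i) g) f (enum 'I_n)).

(* The space T_N, a tensor being given by its components. *)
Definition tensor (R : realType) (n N : nat) : lmodType R :=
  {ffun N.-tuple 'I_n -> R^o}.

Definition D_eta (R : realType) (n N : nat)
    (g : (R * 'rV[R]_n)%type -> R) (p : R * 'rV[R]_n) : tensor R n N :=
  [ffun t : N.-tuple 'I_n => foldr (fun i h => d_eta i h) g t p].

Definition solves_bvp (R : realType) (n : nat) (alpha : R)
    (Om : set 'rV[R]_n) (a : coef R n) (f u : 'rV[R]_n -> R) : Prop :=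
  [/\ holder2 alpha Om u,
      forall x, Om x ->
        - \sum_(i < n) partial i
            (fun y => \sum_(k < n) a (u y, grad u y) i k * partial k u y) x = 0
    & forall x, boundary Om x -> u x = f x].

Definition unique_solution (R : realType) (n : nat) (alpha : R)
    (Om : set 'rV[R]_n) (a : coef R n) (f u : 'rV[R]_n -> R) : Prop :=
  solves_bvp alpha Om a f u /\
  forall v, solves_bvp alpha Om a f v ->
    forall x, closure Om x -> v x = u x.

(* [eps la] and [u la om tau] are the number epsilon_lambda and the solution
   u_{lambda,omega,tau} associated with the coefficient [a]. *)
Definition solution_family (R : realType) (n : nat) (alpha : R)
    (Om : set 'rV[R]_n) (ell : nat) (eps : R -> R) (a : coef R n)
    (u : R -> 'rV[R]_n -> R -> 'rV[R]_n -> R) : Prop :=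
  forall la om, unit_sphere om ->
    (forall tau, `|tau| < eps la ->
       unique_solution alpha Om a (fun x => la + tau * dot x om) (u la om tau))
    /\ Ck_curve alpha Om (eps la) ell (u la om).

(* Gradient at a point of [closure Om], by continuous extension from [Om]. *)
Definition trace_grad (R : realType) (n : nat) (Om : set 'rV[R]_n)
    (u : 'rV[R]_n -> R) (x : 'rV[R]_n) : 'rV[R]_n :=
  \row_(i < n) lim (partial i u y @[y --> within Om (nbhs x)]).

Definition flux (R : realType) (n : nat) (Om : set 'rV[R]_n)
    (nu : 'rV[R]_n -> 'rV[R]_n) (a : coef R n) (u : 'rV[R]_n -> R)
    (x : 'rV[R]_n) : R :=
  let Du := trace_grad Om u x in
  \sum_(i < n) \sum_(k < n) a (u x, Du) i k * Du 0 k * nu x 0 i.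

Definition delta (R : realType) (n : nat) (Om : set 'rV[R]_n)
    (nu : 'rV[R]_n -> 'rV[R]_n) (x0 : 'rV[R]_n) (r : R) (a1 a2 : coef R n)
    (u1 u2 : R -> 'rV[R]_n -> R -> 'rV[R]_n -> R) (k : nat) : \bar R :=
  ereal_sup [set ereal_sup
    [set `|derive1n k (fun tau : R => flux Om nu a1 (u1 la om tau) x0
                                      - flux Om nu a2 (u2 la om tau) x0) 0|%:E
    | la in `[- r, r]%classic] | om in @unit_sphere R n].

(* Main.v *)
(* The solution at tau = 0 is the constant lambda, and its derivatives
   w_k = d^k u / d tau^k at tau = 0 solve
     gamma(lambda,0) Laplace w_k = - q_k,   w_1 = x.omega,  w_k = 0 on the boundary (k >= 2),
   where q_k is polynomial in lower derivatives w_j and in the jet of gamma at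
   (lambda,0).  By induction w_k is a combination of finitely many functions that
   depend on the domain only: the right-hand sides live in a fixed finite
   dimensional space, the Dirichlet problem is uniquely solvable on a subspace of
   it, and a linear map on a finite dimensional space is bounded.  This replaces
   Schauder estimates and gives coefficients that are Lipschitz in the jet.

   The flux of order N+1 at x_0 is (N+1) D_eta^N gamma(lambda,0)[omega^N] omega.nu
   plus terms in derivatives of gamma of order < N, or of order N involving mu at
   least once.  The latter are controlled by interpolation in lambda; polarization
   around omega = nu(x_0) recovers the tensor from its values at omega^N. *)

Require Import Defs.
From HB Require Import structures.
From mathcomp Require Import all_boot all_order all_algebra.
From mathcomp Require Import all_classical all_reals all_analysis.
From mathcomp Require Import perm.
From mathcomp Require Import ring lra zify.
Import Order.TTheory GRing.Theory Num.Theory.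
Import numFieldNormedType.Exports.
Local Open Scope classical_set_scope.
Local Open Scope ring_scope.

Set Implicit Arguments.
Unset Strict Implicit.
Unset Printing Implicit Defensive.

(** The constant C2 is fixed before the coefficients and their families of solutions, so every
    estimate must be uniform over a class of them. Hence all unknowns are written over a type of
    parameters, as sums of fixed functions with coefficients [lip] in the parameter, and two
    parameters are compared only through the jets listed by [good].

    A count of orders makes this work. At tau = 0 the gradient vanishes and, w_1 being affine, the
    Hessian vanishes to order 2. So w_k never involves a pure eta derivative of gamma of order k - 1
    or more, and D_eta^N gamma enters the flux of order N+1 through its leading term only.

    The exponents 3^k / 3^(N+1) come from interpolation: if a jet is O(s^3) on [-r, r] and its
    second lambda-derivative is bounded, a difference quotient of step r s shows the first one to be
    O(s). Each order costs one cube root. Polarization is centred at nu(x0), not at 0, because the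
    tensor is only reached after division by omega.nu. *)

Local Notation "f ^[ i ]" := (derive1n i f) (at level 2, format "f ^[ i ]").

(** * Mean value, chain rule and symmetry of second derivatives *)

Section OneVariable.
Context {R : realType}.

Lemma is_derive_line (V W : normedModType R) (f : V -> W) (p v : V) (s : R)
    (df : W) :
  is_derive (p + s *: v) v f df -> is_derive s (1 : R) (fun t : R => f (p + t *: v)) df.
Proof.
have E : (fun h : R => h^-1 *: (((fun t : R => f (p + t *: v)) \o shift s) (h *: 1)
              - f (p + s *: v))) =
         (fun h : R => h^-1 *: ((f \o shift (p + s *: v)) (h *: v) - f (p + s *: v))).
  apply/funext => h /=; congr (_ *: (f _ - _)).
  by rewrite [h *: 1]mulr1 scalerDl addrA addrAC addrC addrA.
by case=> d1 d2; apply: DeriveDef; rewrite /derivable /derive E.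
Qed.

(** Both signs of [b] are allowed, and of the position of [c] only |c| <= |b| is kept: this is what
    makes [c] tend to 0 with [b] in the limits below. *)
Lemma mean_value (g dg : R -> R) (b : R) :
  (forall t, is_derive t (1 : R) g (dg t)) ->
  exists2 c, `|c| <= `|b| & g b - g 0 = dg c * b.
Proof.
move=> gd.
have gc : continuous g.
  by move=> t; apply: differentiable_continuous; apply/derivable1_diffP; case: (gd t).
case: (leP 0 b) => b0.
  have [c] := MVT_segment b0 (fun x _ => gd x) (continuous_subspaceT gc).
  rewrite in_itv /= => /andP[c0 cb] ->; exists c; last by rewrite subr0.
  by rewrite !ger0_norm // (le_trans c0).
have [c] := MVT_segment (ltW b0) (fun x _ => gd x) (continuous_subspaceT gc).
rewrite in_itv /= => /andP[c0 cb] e; exists c.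
  by rewrite !ler0_norm ?lerN2 // (le_trans c0).
by rewrite -opprB e sub0r mulrN opprK.
Qed.

(** The base point [P h] moves with [h], so this limit is not the definition of a derivative. The
    mean value theorem expresses the increment by the derivative at an intermediate point, and
    continuity at [q] gives the limit. *)
Lemma quotient_line (V : normedModType R) (f : V -> R) (v q : V) (P : R -> V)
    (b : R -> R) (b' : R) :
  (forall x, derivable f x v) -> {for q, continuous ('D_v f)} ->
  P h @[h --> 0^'] --> q -> h^-1 * b h @[h --> 0^'] --> b' ->
  h^-1 * (f (P h + b h *: v) - f (P h)) @[h --> 0^'] --> 'D_v f q * b'.
Proof.
move=> fd fc Pq bb.
have /choice[c hc] : forall h, exists d, `|d| <= `|b h| /\
    f (P h + b h *: v) - f (P h) = 'D_v f (P h + d *: v) * b h.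
  move=> h.
  have [|d d1 d2] := @mean_value (fun t => f (P h + t *: v)) (fun t => 'D_v f (P h + t *: v)) (b h).
    by move=> t; exact: (is_derive_line (derivableP (fd _))).
  by exists d; split=> //; rewrite -d2 scale0r addr0.
have b0 : b h @[h --> 0^'] --> (0 : R).
  have : h * (h^-1 * b h) @[h --> 0^'] --> (0 * b' : R).
    by apply: cvgM bb; apply: cvg_within_filter; exact: cvg_id.
  rewrite mul0r; apply: cvg_trans; apply: near_eq_cvg; near=> h.
  by rewrite mulVKf //; near: h; exact: nbhs_dnbhs_neq.
have c0 : c h @[h --> 0^'] --> (0 : R).
  apply/norm_cvg0P; apply: (@squeeze_cvgr _ _ _ _ (fun=> 0) (fun h => `|b h|)).
  - by near=> h; rewrite normr_ge0 (hc h).1.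
  - exact: cvg_cst.
  - exact/norm_cvg0P.
have -> : (fun h => h^-1 * (f (P h + b h *: v) - f (P h))) =
    (fun h => 'D_v f (P h + c h *: v) * (h^-1 * b h)).
  by apply/funext => h; rewrite (hc h).2 mulrCA.
apply: cvgM bb.
have H : P h + c h *: v @[h --> 0^'] --> q.
  rewrite -[X in _ --> X]addr0 -(scale0r v); apply: cvgD => //.
  exact: cvgZr_tmp c0.
exact: (cvg_comp _ _ H fc).
Unshelve. all: by end_near. Qed.

(** The data are continuous derivatives along the directions [v j], not a Fréchet differential; the
    increment is therefore split into one direction at a time, each handled by [quotient_line]. *)
Lemma chain_rule (V : normedModType R) (f : V -> R) (p : V) (J : Type)
    (r : seq J) (v : J -> V) (a : J -> R -> R) (a' : J -> R) (t : R) :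
  (forall j x, derivable f x (v j)) -> (forall j, continuous ('D_(v j) f)) ->
  (forall j, is_derive t (1 : R) (a j) (a' j)) ->
  is_derive t (1 : R) (fun s => f (p + \sum_(j <- r) a j s *: v j))
    (\sum_(j <- r) 'D_(v j) f (p + \sum_(i <- r) a i t *: v i) * a' j).
Proof.
move=> fd fc ad; set q := p + _.
pose b j h := a j (h + t) - a j t.
have bq j : h^-1 * b j h @[h --> 0^'] --> a' j.
  case: (ad j) => d1 <-; move: d1; rewrite /derivable /derive.
  have -> : (fun h => h^-1 * b j h) = (fun h => h^-1 *: ((a j \o shift t) (h *: 1) - a j t)).
    by apply/funext => h; rewrite /b /= [h *: 1]mulr1.
  by [].
(* Convergence of the base point is carried along, since each direction starts from a point already
   moved along the others. *)
have key (s : seq J) : 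
    h^-1 * (f (q + \sum_(j <- s) b j h *: v j) - f q) @[h --> 0^'] -->
      \sum_(j <- s) 'D_(v j) f q * a' j /\
    q + \sum_(j <- s) b j h *: v j @[h --> 0^'] --> q.
  elim: s => [|j s [IH1 IH2]].
    under eq_fun do rewrite big_nil addr0 subrr mulr0.
    under [in X in _ /\ X]eq_fun do rewrite big_nil addr0.
    by rewrite big_nil; split; exact: cvg_cst.
  have bj0 : b j h @[h --> 0^'] --> (0 : R).
    have : h * (h^-1 * b j h) @[h --> 0^'] --> (0 * a' j : R).
      by apply: cvgM (bq j); apply: cvg_within_filter; exact: cvg_id.
    rewrite mul0r; apply: cvg_trans; apply: near_eq_cvg; near=> h.
    by rewrite mulVKf //; near: h; exact: nbhs_dnbhs_neq.
  split; last first.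
    have -> : (fun h => q + \sum_(j <- j :: s) b j h *: v j) =
      (fun h => b j h *: v j + (q + \sum_(j <- s) b j h *: v j)).
      by apply/funext => h; rewrite big_cons addrCA.
    have -> : q = 0 *: v j + q by rewrite scale0r add0r.
    apply: cvgD; first exact: cvgZr_tmp bj0.
    by rewrite scale0r add0r.
  rewrite big_cons.
  have -> : (fun h => h^-1 * (f (q + \sum_(j0 <- (j :: s)) b j0 h *: v j0) - f q)) =
    (fun h => h^-1 * (f ((q + \sum_(j <- s) b j h *: v j) + b j h *: v j) - f (q + \sum_(j <- s) b j h *: v j))
      + h^-1 * (f (q + \sum_(j <- s) b j h *: v j) - f q)).
    apply/funext => h; rewrite -mulrDr; congr (_ * _).
    by rewrite big_cons [in RHS]addrA subrK addrA addrAC.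
  apply: cvgD IH1; apply: quotient_line => //.
  exact: fc.
have [H _] := key r.
have E : (fun h => h^-1 * (f (q + \sum_(j <- r) b j h *: v j) - f q)) =
    (fun h => h^-1 *: (((fun s => f (p + \sum_(j <- r) a j s *: v j)) \o shift t) (h *: (1:R)) - f q)).
  apply/funext => h; rewrite /= [h *: 1]mulr1; congr (_ * (f _ - _)).
  rewrite /q -addrA -big_split /=; congr (_ + _).
  by apply: eq_bigr => j _; rewrite -scalerDl /b addrCA subrr addr0.
rewrite E in H.
apply: DeriveDef; first by apply/cvg_ex; eexists; exact: H.
exact: cvg_lim H.
Unshelve. all: by end_near. Qed.

Lemma second_difference (V : normedModType R) (f : V -> R) (p v w : V) (s : R) :
  (forall x, derivable f x v) -> (forall x, derivable ('D_v f) x w) ->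
  exists c d, [/\ `|c| <= `|s|, `|d| <= `|s| &
    f (p + s *: v + s *: w) - f (p + s *: v) - (f (p + s *: w) - f p)
    = 'D_w ('D_v f) (p + c *: v + d *: w) * s ^+ 2].
Proof.
move=> fv fvw.
have [|c c1 c2] := @mean_value (fun t => f (p + s *: w + t *: v) - f (p + t *: v))
   (fun t => 'D_v f (p + s *: w + t *: v) - 'D_v f (p + t *: v)) s.
  move=> t; have A := is_derive_line (derivableP (fv (p + s *: w + t *: v))).
  have B := is_derive_line (derivableP (fv (p + t *: v))).
  exact: (is_deriveB A B).
have [|d d1 d2] := @mean_value (fun t => 'D_v f (p + c *: v + t *: w))
   (fun t => 'D_w ('D_v f) (p + c *: v + t *: w)) s.
  by move=> t; exact: (is_derive_line (derivableP (fvw _))).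
exists c, d; split=> //; move: c2 d2.
rewrite !scale0r !addr0 [p + s *: w + c *: v]addrAC [p + s *: w + s *: v]addrAC => -> ->.
by rewrite expr2 mulrA.
Qed.

(** The second difference of [f] along [v] and [w] is symmetric in the two directions, and
    [second_difference] equates it with s^2 times either mixed derivative at a point near [p].
    Divide by s^2 and let s tend to 0. *)
Lemma derive_swap (V : normedModType R) (f : V -> R) (v w : V) :
  (forall x, derivable f x v) -> (forall x, derivable f x w) ->
  (forall x, derivable ('D_v f) x w) -> (forall x, derivable ('D_w f) x v) ->
  continuous ('D_w ('D_v f)) -> continuous ('D_v ('D_w f)) ->
  'D_w ('D_v f) = 'D_v ('D_w f).
Proof.
move=> fv fw fvw fwv cvw cwv; apply/funext => p.
have /choice[c hc] : forall s : R, exists c : R * R, [/\ `|c.1| <= `|s|, `|c.2| <= `|s| &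
    f (p + s *: v + s *: w) - f (p + s *: v) - (f (p + s *: w) - f p)
    = 'D_w ('D_v f) (p + c.1 *: v + c.2 *: w) * s ^+ 2].
  by move=> s; have [c [d H]] := second_difference p s fv fvw; exists (c, d).
have /choice[d hd] : forall s : R, exists c : R * R, [/\ `|c.1| <= `|s|, `|c.2| <= `|s| &
    f (p + s *: w + s *: v) - f (p + s *: w) - (f (p + s *: v) - f p)
    = 'D_v ('D_w f) (p + c.1 *: w + c.2 *: v) * s ^+ 2].
  by move=> s; have [c' [d H]] := second_difference p s fw fwv; exists (c', d).
have lim0 (g : R -> R) : (forall s, `|g s| <= `|s|) -> g s @[s --> 0^'] --> (0 : R).
  move=> gs; apply/norm_cvg0P; apply: (@squeeze_cvgr _ _ _ _ (fun=> 0) (fun h => `|h|)).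
  - by near=> h; rewrite normr_ge0 gs.
  - exact: cvg_cst.
  - by apply/norm_cvg0P; apply: cvg_within_filter; exact: cvg_id.
have lim1 (g1 g2 : R -> R) (x y : V) : (forall s, `|g1 s| <= `|s|) -> (forall s, `|g2 s| <= `|s|) ->
    p + g1 s *: x + g2 s *: y @[s --> 0^'] --> p.
  move=> h1 h2; rewrite -[X in _ --> X]addr0 -[X in X + 0]addr0 -{1}(scale0r x) -(scale0r y).
  apply: cvgD; last exact: cvgZr_tmp (lim0 _ h2).
  by apply: cvgD; [exact: cvg_cst | exact: cvgZr_tmp (lim0 _ h1)].
have L1 : 'D_w ('D_v f) (p + (c s).1 *: v + (c s).2 *: w) @[s --> 0^'] --> 'D_w ('D_v f) p.
  apply: (cvg_comp _ _ (lim1 _ _ _ _ _ _) (cvw p)) => s; by have [] := hc s.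
have L2 : 'D_v ('D_w f) (p + (d s).1 *: w + (d s).2 *: v) @[s --> 0^'] --> 'D_v ('D_w f) p.
  apply: (cvg_comp _ _ (lim1 _ _ _ _ _ _) (cwv p)) => s; by have [] := hd s.
apply: (cvg_unique _ L1); first exact: Rhausdorff.
apply: cvg_trans L2; apply: near_eq_cvg; near=> s.
have s0 : s != 0 by near: s; exact: nbhs_dnbhs_neq.
have [_ _ e1] := hc s; have [_ _ e2] := hd s.
apply: (mulIf (expf_neq0 2 s0)); refine (etrans (esym e2) (etrans _ e1)).
rewrite [p + s *: w + s *: v]addrAC; ring.
Unshelve. all: by end_near. Qed.

End OneVariable.

(** * Iterated derivatives on an interval *)

Section Smooth.
Context {R : realType}.
Implicit Types (f g : R -> R) (e t : R).

(** A chain of successive derivatives on ]-e, e[. Exhibiting one both proves differentiability and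
    computes the iterated [derive1n], a total function whose value alone does not show that the
    derivative exists. *)
Definition tower e (k : nat) (F : nat -> R -> R) : Prop :=
  forall i t, (i < k)%N -> `|t| < e -> is_derive t (1 : R) (F i) (F i.+1 t).

Definition smooth e (k : nat) f : Prop :=
  forall i t, (i < k)%N -> `|t| < e -> derivable (f^[i]) t 1.

Lemma near_norm_lt e t : `|t| < e -> \forall s \near t, `|s| < e.
Proof.
move=> te; have /cvgr_lt : (`|s| : R) @[s --> t] --> `|t| by apply: cvg_norm; exact: cvg_id.
exact.
Qed.

Lemma tower_derive1n e k F f :
  tower e k F -> (forall t, `|t| < e -> f t = F 0 t) ->
  forall i t, (i <= k)%N -> `|t| < e -> f^[i] t = F i t.
Proof.
move=> FT f0; elim => [|i IH] t ik te; first exact: f0.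
rewrite derive1nS derive1E.
rewrite (@near_eq_derive _ _ _ _ (F i)); last first.
  by near=> s; apply: IH; [exact: ltnW | near: s; exact: near_norm_lt].
by case: (FT i t ik te).
Unshelve. all: by end_near. Qed.

Lemma tower_smooth e k F f :
  tower e k F -> (forall t, `|t| < e -> f t = F 0 t) -> smooth e k f.
Proof.
move=> FT f0 i t ik te.
apply: (@near_eq_derivable _ _ _ (F i)); last by case: (FT i t ik te).
near=> s; apply/esym; apply: (tower_derive1n FT f0); first exact: ltnW.
by near: s; exact: near_norm_lt.
Unshelve. all: by end_near. Qed.

Lemma smooth_tower e k f : smooth e k f -> tower e k (fun i => f^[i]).
Proof.
by move=> fs i t ik te; rewrite derive1nS derive1E; apply: derivableP; exact: fs.
Qed.

Lemma smooth_le e k m f : (m <= k)%N -> smooth e k f -> smooth e m f.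
Proof. by move=> mk fs i t im te; apply: fs => //; exact: leq_trans mk. Qed.

Lemma eq_derive1n e f g :
  (forall t, `|t| < e -> f t = g t) -> forall i t, `|t| < e -> f^[i] t = g^[i] t.
Proof.
move=> fg; elim=> [|i IH] t te; first exact: fg.
rewrite !derive1nS !derive1E; apply: near_eq_derive.
by near=> s; apply: IH; near: s; exact: near_norm_lt.
Unshelve. all: by end_near. Qed.

Section Antiderivative.
Variables (e : R) (k : nat) (f f' : R -> R).
Hypothesis ff' : forall t, `|t| < e -> is_derive t (1 : R) f (f' t).

Let T (i : nat) := if i is j.+1 then f'^[j] else f.

Let towerT : smooth e k f' -> tower e k.+1 T.
Proof.
move=> fs [|i] t ik te /=; first exact: ff'.
exact: (smooth_tower fs).
Qed.

Lemma smoothS : smooth e k f' -> smooth e k.+1 f.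
Proof. by move=> /towerT/tower_smooth; apply. Qed.

Lemma derive1nS_eq t : `|t| < e -> f^[k.+1] t = f'^[k] t.
Proof.
move=> te; rewrite derive1Sn; apply: eq_derive1n te => s se.
by rewrite derive1E; case: (ff' se).
Qed.

End Antiderivative.

Lemma derive1n_cst (c : R) k t : (fun=> c : R)^[k.+1] t = 0 :> R.
Proof.
apply: (@tower_derive1n (`|t| + 1) k.+1 (fun i _ => if i is 0%N then c else 0)) => //.
  by case=> [|i] s _ _; exact: is_derive_cst.
by rewrite ltrDl.
Qed.

Section Sum.
Variables (e : R) (k : nat) (J : Type) (r : seq J) (F : J -> R -> R).
Hypothesis Fs : forall j : J, smooth e k (F j).

Let T (i : nat) t := \sum_(j <- r) (F j)^[i] t.

Let towerT : tower e k T.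
Proof.
move=> i t ik te; rewrite /T.
elim: r => [|j s IH].
  rewrite big_nil; under eq_fun do rewrite big_nil; exact: is_derive_cst.
rewrite big_cons; under eq_fun do rewrite big_cons.
have H := smooth_tower (@Fs j) ik te.
exact: (is_deriveD H IH).
Qed.

Lemma smooth_sum : smooth e k (fun t => \sum_(j <- r) F j t).
Proof. exact: (tower_smooth towerT). Qed.

Lemma derive1n_sum i t : (i <= k)%N -> `|t| < e ->
  (fun t => \sum_(j <- r) F j t)^[i] t = \sum_(j <- r) (F j)^[i] t.
Proof. by move=> ik te; exact: (tower_derive1n towerT). Qed.

End Sum.

Lemma smoothZ e k c f : smooth e k f -> smooth e k (fun t => c * f t).
Proof.
move=> fs; apply: (@tower_smooth _ _ (fun i t => c * f^[i] t)) => // i t ik te.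
exact: (is_deriveZ c (smooth_tower fs ik te)).
Qed.

Lemma derive1nZ e k c f i t : smooth e k f -> (i <= k)%N -> `|t| < e ->
  (fun t => c * f t)^[i] t = c * f^[i] t.
Proof.
move=> fs; apply: (@tower_derive1n _ _ (fun i t => c * f^[i] t)) => // {}i {}t ik te.
exact: (is_deriveZ c (smooth_tower fs ik te)).
Qed.

Lemma smoothD e k f g : smooth e k f -> smooth e k g ->
  smooth e k (fun t => f t + g t).
Proof.
move=> fs gs; apply: (@tower_smooth _ _ (fun i t => f^[i] t + g^[i] t)) => // i t ik te.
exact: (is_deriveD (smooth_tower fs ik te) (smooth_tower gs ik te)).
Qed.

Lemma derive1nD e k f g i t : smooth e k f -> smooth e k g ->
  (i <= k)%N -> `|t| < e ->
  (fun t => f t + g t)^[i] t = f^[i] t + g^[i] t.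
Proof.
move=> fs gs.
apply: (@tower_derive1n _ _ (fun i t => f^[i] t + g^[i] t)) => // {}i {}t ik te.
exact: (is_deriveD (smooth_tower fs ik te) (smooth_tower gs ik te)).
Qed.

(** With [a i j] standing for f^(i) g^(j), the left side is the derivative of the Leibniz sum of
    order m, and the right side the Leibniz sum of order m+1. *)
Lemma pascal_sum (a : nat -> nat -> R) (m : nat) :
  \sum_(i < m.+1) 'C(m, i)%:R * (a i.+1 (m - i)%N + a i (m - i).+1) =
  \sum_(i < m.+2) 'C(m.+1, i)%:R * a i (m.+1 - i)%N.
Proof.
rewrite [RHS]big_ord_recl /= bin0 mul1r subn0.
under [X in _ = _ + X]eq_bigr do rewrite /bump /= add1n subSS binS natrD mulrDl.
rewrite big_split /= addrA.
have -> : a 0 m.+1 + \sum_(i < m.+1) 'C(m, i.+1)%:R * a i.+1 (m - i)%N =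
    \sum_(i < m.+2) 'C(m, i)%:R * a i (m.+1 - i)%N.
  by rewrite [RHS]big_ord_recl /= bin0 mul1r subn0.
rewrite [X in _ = X + _]big_ord_recr /= bin_small // mul0r addr0 -big_split /=.
by apply: eq_bigr => i _; rewrite mulrDr addrC subSn // -ltnS.
Qed.

Section Leibniz.
Variables (e : R) (k : nat) (f g : R -> R).
Hypotheses (fs : smooth e k f) (gs : smooth e k g).

Let T (m : nat) t := \sum_(i < m.+1) 'C(m, i)%:R * (f^[i] t * g^[m - i] t).

Let towerT : tower e k T.
Proof.
move=> m t mk te; rewrite /T.
have := pascal_sum (fun i j => f^[i] t * g^[j] t) m => /= <-.
have -> : (fun t => \sum_(i < m.+1) 'C(m, i)%:R * (f^[i] t * g^[m - i] t)) =
    \sum_(i < m.+1) (fun t => 'C(m, i)%:R * (f^[i] t * g^[m - i] t)).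
  by apply/funext => s; rewrite fct_sumE.
apply: is_derive_sum => i.
have im : (i <= m)%N by rewrite -ltnS.
have A := smooth_tower fs (leq_ltn_trans im mk) te.
have B := smooth_tower gs (leq_ltn_trans (leq_subr i m) mk) te.
apply: is_derive_eq (is_deriveZ _ (is_deriveM A B)) _.
by rewrite /GRing.scale /=; congr (_ * _); rewrite addrC; congr (_ + _); rewrite mulrC.
Qed.

Lemma smoothM : smooth e k (fun t => f t * g t).
Proof.
by apply: (tower_smooth towerT) => t _; rewrite /T big_ord1 /= bin0 mul1r.
Qed.

Lemma derive1nM m t : (m <= k)%N -> `|t| < e ->
  (fun t => f t * g t)^[m] t =
    \sum_(i < m.+1) 'C(m, i)%:R * (f^[i] t * g^[m - i] t).
Proof.
move=> mk te; apply: (tower_derive1n towerT) => // s _.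
by rewrite /T big_ord1 /= bin0 mul1r.
Qed.

End Leibniz.

End Smooth.

(** * Iterated partial derivatives *)

Lemma big_option (R : nmodType) (T : finType) (F : option T -> R) :
  \sum_d F d = F None + \sum_i F (Some i).
Proof.
rewrite (bigD1 None) //=; congr (_ + _).
rewrite (reindex_omap Some id) /=; last by case.
by apply: eq_bigl => i; rewrite eqxx.
Qed.

Section Words.
Context {R : realType} {n : nat}.
Local Notation V := (R * 'rV[R]_n)%type.
Implicit Types (h : V -> R) (d : option 'I_n) (w : seq (option 'I_n)).

(* The directions of the variables (mu, eta): [None] is mu, [Some i] is eta_i. *)
Definition dvec d : V :=
  if d is Some i then ((0 : R), evec R i) else ((1 : R), (0 : 'rV[R]_n)).

Definition dword (W : normedModType R) w (h : V -> W) : V -> W :=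
  foldr (fun d g => 'D_(dvec d) g) h w.

(** Points (mu, eta) become sums along the directions [dvec d], the form in which [chain_rule] takes
    them. *)
Lemma dvec_sum (U : option 'I_n -> R) :
  \sum_d U d *: dvec d = (U None, \row_i U (Some i)).
Proof.
rewrite big_option /=.
have -> : \sum_i U (Some i) *: ((0 : R), evec R i) = (0, \row_i U (Some i)).
  have -> : \row_i U (Some i) = \sum_i U (Some i) *: evec R i.
    by rewrite [LHS]row_sum_delta; apply: eq_bigr => i _; rewrite mxE.
  elim/big_ind2 : _ => // [x1 x2 y1 y2 -> ->|i _].
    by congr pair; rewrite addr0.
  by congr pair; rewrite /= scaler0.
congr pair => /=; first by rewrite [_ *: 1]mulr1 addr0.
by rewrite scaler0 add0r.
Qed.

Lemma Ck_prev (V1 W : normedModType R) m (U : set V1) (f : V1 -> W) :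
  Ck m.+1 U f -> Ck m U f.
Proof.
elim: m f => [|m IH] f [fc fd]; first by split.
split=> // v; have [d1 d2] := fd v; split=> //; exact: IH.
Qed.

Lemma Ck_le (V1 W : normedModType R) m k (U : set V1) (f : V1 -> W) :
  (m <= k)%N -> Ck k U f -> Ck m U f.
Proof.
move=> mk; rewrite -(subnK mk); elim: (k - m)%N => // i IH.
by rewrite addSn => /Ck_prev.
Qed.

Lemma Ck_continuous (V1 W : normedModType R) m (f : V1 -> W) :
  Ck m setT f -> continuous f.
Proof. by case: m => [|m] [fc _] x; exact: fc. Qed.

Lemma Ck_dword (W : normedModType R) m w (h : V -> W) :
  Ck (size w + m) setT h -> Ck m setT (dword w h).
Proof.
elim: w m => // d w IH m; rewrite [size (d :: w)]/= addSn -addnS => H.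
by have [_ /(_ (dvec d))[_ ?]] := IH m.+1 H.
Qed.

Lemma dword_swap d d' w h : Ck (size w).+2 setT h ->
  dword (d :: d' :: w) h = dword (d' :: d :: w) h.
Proof.
rewrite -addn2 => /Ck_dword; set g := dword w h => gC.
have [_ gd] := gC.
apply: derive_swap.
- by move=> x; exact: (gd _).1.
- by move=> x; exact: (gd _).1.
- by move=> x; exact: ((gd (dvec d')).2.2 _).1.
- by move=> x; exact: ((gd (dvec d)).2.2 _).1.
- by apply: (@Ck_continuous _ _ 0); exact: ((gd (dvec d')).2.2 _).2.
- by apply: (@Ck_continuous _ _ 0); exact: ((gd (dvec d)).2.2 _).2.
Qed.

Lemma dword_front d w1 w2 h : Ck (size (w1 ++ d :: w2)) setT h ->
  dword (w1 ++ d :: w2) h = dword (d :: w1 ++ w2) h.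
Proof.
elim: w1 => [//|d1 w1 IH] H.
transitivity (dword (d1 :: d :: w1 ++ w2) h).
  by rewrite [LHS]/= IH //; exact: (Ck_prev H).
apply: dword_swap; apply: Ck_le H.
by rewrite /= !size_cat /= addnS.
Qed.

(** The first letter of [w] is located in [w'] and brought to its front by adjacent exchanges; the
    induction goes on with the remaining letters. *)
Lemma dword_perm w w' h : Ck (size w) setT h -> perm_eq w w' ->
  dword w h = dword w' h.
Proof.
elim: w w' => [|d w IH] w' H.
  by move=> /perm_size/esym/size0nil ->.
move=> pw; have sw := perm_size pw; move: pw.
have := mem_head d w => /[swap] pw; rewrite (perm_mem pw).
move=> /splitPr dw'; case: dw' pw sw => w1 w2 pw sw.
rewrite dword_front; last by rewrite -sw.
have E : dword w h = dword (w1 ++ w2) h.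
  apply: IH; first exact: (Ck_prev H).
  by move: pw; rewrite perm_sym -cat1s perm_catCA perm_cons perm_sym.
by rewrite [LHS]/= E.
Qed.

Section Composition.
Variables (e : R) (h : V -> R) (U : option 'I_n -> R -> R).

Let P t : V := \sum_d U d t *: dvec d.

Lemma smooth_derive1 k (f : R -> R) : smooth e k.+1 f -> smooth e k f^[1].
Proof.
move=> fs i t ik te; have := fs i.+1 t ik te.
by rewrite derive1Sn derive1n1.
Qed.

Lemma is_derive_comp w t :
  Ck (size w).+1 setT h -> (forall d, derivable (U d) t 1) ->
  is_derive t (1 : R) (fun s => dword w h (P s))
    (\sum_d dword (d :: w) h (P t) * (U d)^[1] t).
Proof.
rewrite -[(size w).+1]addn1 => /Ck_dword [_ gd] Ud.
have := @chain_rule R V (dword w h) 0 _ (index_enum (option 'I_n)) dvec U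
  (fun d => (U d)^[1] t) t.
under eq_fun do rewrite add0r.
rewrite add0r; apply.
- by move=> d x; exact: (gd (dvec d)).1.
- by move=> d; exact: (@Ck_continuous _ _ 0 _ (gd (dvec d)).2).
- by move=> d; rewrite derive1n1 derive1E; exact: derivableP.
Qed.

Lemma smooth_dword k w : Ck (size w + k) setT h ->
  (forall d, smooth e k (U d)) -> smooth e k (fun t => dword w h (P t)).
Proof.
elim: k w => // k IH w H Us.
apply: (@smoothS _ _ _ _ (fun t => \sum_d dword (d :: w) h (P t) * (U d)^[1] t)).
  move=> t te; apply: is_derive_comp; first by apply: Ck_le H; rewrite addnS ltnS leq_addr.
  by move=> d; exact: (Us d 0).
apply: smooth_sum => d; apply: smoothM; last exact: smooth_derive1.
apply: IH; first by rewrite [size (d :: w)]/= addSn -addnS.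
by move=> d'; apply: smooth_le (Us d').
Qed.

(** One application of the chain rule, then Leibniz. This recursion in [m], which lengthens the word
    by one letter, takes the place of the Faà di Bruno formula. *)
Lemma derive1nS_dword k m w t : Ck (size w + k) setT h ->
  (forall d, smooth e k (U d)) -> (m < k)%N -> `|t| < e ->
  (fun t => dword w h (P t))^[m.+1] t =
  \sum_d \sum_(i < m.+1) 'C(m, i)%:R *
    ((fun t => dword (d :: w) h (P t))^[i] t * (U d)^[(m - i).+1] t).
Proof.
case: k => // k H Us mk te.
have Hd d : smooth e k (fun t => dword (d :: w) h (P t)).
  apply: smooth_dword; first by rewrite [size (d :: w)]/= addSn -addnS.
  by move=> d'; apply: smooth_le (Us d').
have Ud d := smooth_derive1 (Us d).
have D s : `|s| < e -> is_derive s (1 : R) (fun t => dword w h (P t))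
    (\sum_d dword (d :: w) h (P s) * (U d)^[1] s).
  move=> se; apply: is_derive_comp; first by apply: Ck_le H; rewrite addnS ltnS leq_addr.
  by move=> d; exact: (Us d 0).
rewrite (derive1nS_eq m D te).
refine (etrans (derive1n_sum (k := k) _ (fun d => smoothM (Hd d) (Ud d)) mk te) _).
apply: eq_bigr => d _.
rewrite (derive1nM (Hd d) (Ud d)) //; apply: eq_bigr => i _.
by congr (_ * (_ * _)); exact: (congr1 (fun f => f t) (esym (derive1Sn (U d) (m - i)%N))).
Qed.

End Composition.
End Words.

(** * Families with bounded Lipschitz coefficients *)

Section Lip.
Context {R : realType} {T : Type}.
Variables (valid : T -> Prop) (close : R -> T -> T -> Prop).
Implicit Types (c d : T -> R).

(** One constant, uniform over all valid parameters, serves for the bound and for the Lipschitz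
    estimate: here lies the uniformity of C2. Keeping the bound in the notion makes it stable under
    products. *)
Definition lip d : Prop := exists2 C, 0 <= C &
  (forall th, valid th -> `|d th| <= C) /\
  (forall rho th1 th2, 0 <= rho -> valid th1 -> valid th2 -> close rho th1 th2 ->
     `|d th1 - d th2| <= C * rho).

Lemma eq_lip c d : (forall th, valid th -> c th = d th) -> lip d -> lip c.
Proof.
move=> cd [C C0 [B L]]; exists C => //; split=> [th vt|rho th1 th2 r0 v1 v2 cl].
  by rewrite cd // B.
by rewrite !cd //; exact: L.
Qed.

Lemma lip_cst (a : R) : lip (fun=> a).
Proof.
exists `|a| => //; split=> // rho th1 th2 r0 _ _ _.
by rewrite subrr normr0 mulr_ge0.
Qed.

Lemma lipD c d : lip c -> lip d -> lip (fun th => c th + d th).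
Proof.
move=> [C C0 [B L]] [C' C0' [B' L']]; exists (C + C'); first exact: addr_ge0.
split=> [th vt|rho th1 th2 r0 v1 v2 cl].
  by rewrite (le_trans (ler_normD _ _)) // lerD ?B ?B'.
rewrite opprD addrACA (le_trans (ler_normD _ _)) // mulrDl.
by rewrite lerD ?L ?L'.
Qed.

Lemma lipM c d : lip c -> lip d -> lip (fun th => c th * d th).
Proof.
move=> [C C0 [B L]] [C' C0' [B' L']]; exists (C * C' + C * C').
  by rewrite addr_ge0 // mulr_ge0.
split=> [th vt|rho th1 th2 r0 v1 v2 cl].
  rewrite normrM -[X in X <= _]addr0 lerD ?mulr_ge0 //.
  by rewrite ler_pM // ?B ?B'.
have -> : c th1 * d th1 - c th2 * d th2 =
  (c th1 - c th2) * d th1 + c th2 * (d th1 - d th2) by ring.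
rewrite (le_trans (ler_normD _ _)) // !normrM mulrDl lerD //.
  by rewrite mulrAC ler_pM ?L ?B'.
by rewrite -mulrA ler_pM ?L' ?B.
Qed.

Lemma lip_sum (J : Type) (r : seq J) (F : J -> T -> R) :
  (forall j, lip (F j)) -> lip (fun th => \sum_(j <- r) F j th).
Proof.
move=> LF; elim: r => [|j r IH].
  by apply: (eq_lip _ (lip_cst 0)) => th _; rewrite big_nil.
by apply: (eq_lip _ (lipD (LF j) IH)) => th _; rewrite big_cons.
Qed.

Lemma lipV c (k : R) : 0 < k -> (forall th, valid th -> k <= c th) -> lip c ->
  lip (fun th => (c th)^-1).
Proof.
move=> k0 ck [C C0 [B L]]; exists (k^-1 + k^-1 * k^-1 * C).
  by rewrite addr_ge0 ?mulr_ge0 ?invr_ge0 // ltW.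
have kp th : valid th -> 0 < c th by move=> /ck; exact: lt_le_trans.
have ci th : valid th -> `|(c th)^-1| <= k^-1.
  move=> vt; rewrite ger0_norm ?invr_ge0 ?(ltW (kp _ vt)) //.
  by rewrite lef_pV2 ?posrE ?kp ?ck.
split=> [th vt|rho th1 th2 r0 v1 v2 cl].
  by rewrite (le_trans (ci _ vt)) // lerDl !mulr_ge0 ?invr_ge0 // ltW.
have -> : (c th1)^-1 - (c th2)^-1 = (c th1)^-1 * (c th2)^-1 * (c th2 - c th1).
  by field; rewrite !gt_eqF ?kp.
rewrite mulrDl !normrM -[X in X <= _]add0r lerD ?mulr_ge0 ?invr_ge0 ?(ltW k0) //.
rewrite -[X in _ <= X]mulrA; apply: ler_pM; rewrite ?mulr_ge0 //.
  by apply: ler_pM; rewrite ?ci.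
by rewrite distrC; exact: L.
Qed.

(** * Parameter-dependent functions with separated variables *)

Section Tame.
Context {X : Type}.
Implicit Types (D : set X) (p q : T -> X -> R).

(** The functions [f i] are the same for all parameters; only the coefficients vary. Such functions
    stay in a finite dimensional space fixed in advance, as [dirichlet_basis] requires of its
    right-hand sides. *)
Definition tame D q : Prop := exists (I : finType) (f : I -> X -> R) (d : I -> T -> R),
  (forall i, lip (d i)) /\
  (forall th x, valid th -> D x -> q th x = \sum_i d i th * f i x).

Lemma eq_tame D p q : (forall th x, valid th -> D x -> p th x = q th x) ->
  tame D q -> tame D p.
Proof.
move=> pq [I [f [d [L E]]]]; exists I, f, d; split=> // th x vt Dx.
by rewrite pq // E.
Qed.

Lemma tame_sub D D' q : D' `<=` D -> tame D q -> tame D' q.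
Proof.
by move=> DD [I [f [d [L E]]]]; exists I, f, d; split=> // th x vt /DD; exact: E.
Qed.

Lemma tame_lip D d (f : X -> R) : lip d -> tame D (fun th x => d th * f x).
Proof.
move=> L; exists unit, (fun=> f), (fun=> d); split=> // th x _ _.
by rewrite big_const card_unit /= addr0.
Qed.

Lemma tame_cst D d : lip d -> tame D (fun th _ => d th).
Proof.
by move=> /(tame_lip D (fun=> 1)); apply: eq_tame => th x _ _; rewrite mulr1.
Qed.

Lemma tame0 D : tame D (fun _ _ => 0).
Proof. exact: tame_cst (lip_cst 0). Qed.

Lemma tameD D p q : tame D p -> tame D q -> tame D (fun th x => p th x + q th x).
Proof.
move=> [I [f [d [L E]]]] [I' [f' [d' [L' E']]]].
exists (I + I')%type, (fun s => match s with inl i => f i | inr i => f' i end),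
  (fun s => match s with inl i => d i | inr i => d' i end).
split; first by case.
by move=> th x vt Dx; rewrite E // E' // big_sumType.
Qed.

Lemma tameM D p q : tame D p -> tame D q -> tame D (fun th x => p th x * q th x).
Proof.
move=> [I [f [d [L E]]]] [I' [f' [d' [L' E']]]].
exists (I * I')%type, (fun s x => f s.1 x * f' s.2 x), (fun s th => d s.1 th * d' s.2 th).
split=> [[i j]|th x vt Dx]; first exact: lipM.
rewrite E // E' // big_distrlr pair_big /=.
by apply: eq_bigr => -[i j] _ /=; rewrite mulrACA.
Qed.

Lemma tameZ D c q : lip c -> tame D q -> tame D (fun th x => c th * q th x).
Proof. by move=> L; apply: tameM; exact: tame_cst. Qed.

Lemma tame_sum D (J : eqType) (r : seq J) (F : J -> T -> X -> R) :
  (forall j, j \in r -> tame D (F j)) -> tame D (fun th x => \sum_(j <- r) F j th x).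
Proof.
elim: r => [|j r IH] tF.
  by apply: (eq_tame _ (tame0 D)) => th x _ _; rewrite big_nil.
have tr : tame D (fun th x => \sum_(j <- r) F j th x).
  by apply: IH => i ir; apply: tF; rewrite inE ir orbT.
apply: (eq_tame _ (tameD (tF j (mem_head _ _)) tr)) => th x _ _.
by rewrite big_cons.
Qed.

Lemma lip_tame D q x : D x -> tame D q -> lip (fun th => q th x).
Proof.
move=> Dx [I [f [d [L E]]]].
have H : lip (fun th => \sum_i d i th * f i x).
  by apply: lip_sum => i; exact: lipM (lip_cst _).
by apply: eq_lip H => th vt; exact: E.
Qed.

End Tame.
End Lip.

Lemma sub_lip {R : realType} {T : Type} (valid : T -> Prop)
    (close close' : R -> T -> T -> Prop) d :
  (forall rho th1 th2, close' rho th1 th2 -> close rho th1 th2) ->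
  lip valid close d -> lip valid close' d.
Proof.
move=> cc [C C0 [B L]]; exists C => //; split=> // rho th1 th2 r0 v1 v2 /cc.
exact: L.
Qed.

(** * Functions regular up to the boundary *)

Section Regular.
Context {R : realType} {n : nat}.
Variable Om : set 'rV[R]_n.
Hypothesis Oo : open Om.
Implicit Types (f g : 'rV[R]_n -> R) (x : 'rV[R]_n) (i j : 'I_n).

Local Notation cOm := (closure Om).

(* A linear class containing [holder2], on which traces and the maximum principle
   make sense; derivatives are only required along the coordinate axes. *)
Definition regular f : Prop :=
  [/\ forall x, Om x -> forall i, derivable f x (evec R i),
      forall x, Om x -> forall i j, derivable (partial j f) x (evec R i),
      {within cOm, continuous f},
      forall x, cOm x -> forall i, cvg (partial i f y @[y --> within Om (nbhs x)])
    & forall x, Om x -> forall i, {for x, continuous (partial i f)}].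

Definition trace i f x : R := lim (partial i f y @[y --> within Om (nbhs x)]).

Definition laplace f x : R := \sum_i partial i (partial i f) x.

Lemma holder2_regular alpha f : holder2 alpha Om f -> regular f.
Proof.
case=> -[fc fd] cf cv _ _; split=> //.
- by move=> x Ox i; exact: (fd _).1.
- by move=> x Ox i j; exact: ((fd _).2.2 _).1.
- by move=> x Ox i; exact: (fd _).2.1.
Qed.

Lemma near_open x : Om x -> \forall y \near x, Om y.
Proof. by move=> Ox; apply: open_nbhs_nbhs; split. Qed.

Lemma partial_lin f g a x i : Om x ->
  derivable f x (evec R i) -> derivable g x (evec R i) ->
  partial i (fun y => f y + a * g y) x = partial i f x + a * partial i g x.
Proof.
move=> Ox df dg; rewrite /partial.
have H := is_deriveD (derivableP df) (is_deriveZ a (derivableP dg)).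
by rewrite (@derive_val _ _ _ _ _ _ _ H).
Qed.

Lemma near_partial_lin f g a x i : regular f -> regular g -> Om x ->
  \forall y \near x, partial i f y + a * partial i g y =
    partial i (fun y => f y + a * g y) y.
Proof.
move=> [df _ _ _ _] [dg _ _ _ _] /near_open; apply: filterS => y Oy.
by rewrite partial_lin //; [exact: df | exact: dg].
Qed.

Lemma cvg_trace f x i : regular f -> cOm x ->
  partial i f y @[y --> within Om (nbhs x)] --> trace i f x.
Proof. by case=> _ _ _ cv _ cx; exact: cv. Qed.

Lemma cvg_trace_lin f g a x i : regular f -> regular g -> cOm x ->
  partial i (fun y => f y + a * g y) y @[y --> within Om (nbhs x)] -->
    trace i f x + a * trace i g x.
Proof.
move=> rf rg cx.
have H : (fun y => partial i f y + a * partial i g y) y @[y --> within Om (nbhs x)] -->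
    trace i f x + a * trace i g x.
  apply: cvgD; first exact: cvg_trace.
  by apply: cvgM; [exact: cvg_cst | exact: cvg_trace].
apply: cvg_trans H; apply: near_eq_cvg; rewrite near_withinE.
near=> y => Oy; have [df _ _ _ _] := rf; have [dg _ _ _ _] := rg.
by rewrite partial_lin //; [exact: df | exact: dg].
Unshelve. all: by end_near. Qed.

Lemma regular_lin f g a : regular f -> regular g -> regular (fun y => f y + a * g y).
Proof.
move=> rf rg; have [df d2f cf tf pf] := rf; have [dg d2g cg tg pg] := rg; split.
- move=> x Ox i; have := is_deriveD (derivableP (df x Ox i)) (is_deriveZ a (derivableP (dg x Ox i))).
  by case.
- move=> x Ox i j; apply: near_eq_derivable (near_partial_lin a j rf rg Ox) _.
  by have [] := is_deriveD (derivableP (d2f x Ox i j)) (is_deriveZ a (derivableP (d2g x Ox i j))).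
- move=> x; apply: cvgD; first exact: cf.
  by apply: cvgM; [exact: cvg_cst | exact: cg].
- by move=> x cx i; apply/cvg_ex; eexists; exact: cvg_trace_lin.
- move=> x Ox i.
  have H := continuousD (pf x Ox i) (continuousM (@cst_continuous _ _ a x) (pg x Ox i)).
  have N := near_partial_lin a i rf rg Ox.
  rewrite /prop_for /continuous_at -(nbhs_singleton N).
  by apply: cvg_trans H; apply: (@near_eq_cvg _ _ (nbhs x) (nbhs_filter x)); exact: N.
Qed.

Lemma regular_cst (c : R) : regular (fun=> c).
Proof.
have p0 i : partial i (fun=> c) = fun=> 0.
  by apply/funext => y; rewrite /partial derive_cst.
split.
- by move=> *; exact: derivable_cst.
- by move=> x Ox i j; rewrite p0; exact: derivable_cst.
- by apply: continuous_subspaceT; exact: cst_continuous.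
- by move=> x cx i; rewrite p0; exact: is_cvg_cst.
- by move=> x cx i; rewrite p0; exact: cst_continuous.
Qed.

Lemma is_derive_coord x v i : is_derive x v (fun y : 'rV[R]_n => y 0 i) (v 0 i).
Proof.
have E h : h != 0 -> h^-1 *: (((fun y : 'rV[R]_n => y 0 i) \o shift x) (h *: v) - x 0 i) = v 0 i.
  by move=> h0; rewrite /= !mxE addrK /GRing.scale /= mulKf.
have H : (fun h => h^-1 *: (((fun y : 'rV[R]_n => y 0 i) \o shift x) (h *: v) - x 0 i)) @ 0^'
   --> v 0 i.
  apply: cvg_near_cst; near=> h; apply: E; near: h; exact: nbhs_dnbhs_neq.
by apply: DeriveDef; [apply/cvg_ex; eexists; exact: H | exact: cvg_lim H].
Unshelve. all: by end_near. Qed.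

Lemma partial_coord i j : partial i (fun y : 'rV[R]_n => y 0 j) = fun=> (i == j)%:R.
Proof.
apply/funext => x; rewrite /partial (@derive_val _ _ _ _ _ _ _ (is_derive_coord x _ j)).
by rewrite mxE eqxx /= eq_sym.
Qed.

Lemma regular_coord i : regular (fun y => y 0 i).
Proof.
split.
- by move=> x _ j; case: (is_derive_coord x (evec R j) i).
- by move=> x Ox j k; rewrite partial_coord; exact: derivable_cst.
- by apply: continuous_subspaceT => x; exact: coord_continuous.
- by move=> x cx j; rewrite partial_coord; exact: is_cvg_cst.
- by move=> x cx j; rewrite partial_coord; exact: cst_continuous.
Qed.

Lemma regular_sum (J : Type) (r : seq J) (d : J -> R) (phi : J -> 'rV[R]_n -> R) :
  (forall k, regular (phi k)) -> regular (fun y => \sum_(k <- r) d k * phi k y).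
Proof.
move=> rp; elim: r => [|k r IH].
  by under eq_fun do rewrite big_nil; exact: regular_cst.
by under eq_fun do rewrite big_cons addrC; exact: regular_lin.
Qed.

(** By the second clause [L] sees only the values on the closure. Solutions are determined only
    there, and this clause allows them to be replaced by their expansions before [L] is applied. *)
Definition functional (L : ('rV[R]_n -> R) -> R) : Prop :=
  (forall f g a, regular f -> regular g -> L (fun y => f y + a * g y) = L f + a * L g) /\
  (forall f g, regular f -> regular g -> (forall y, cOm y -> f y = g y) -> L f = L g).

Lemma functional_eval x : cOm x -> functional (fun f => f x).
Proof. by move=> cx; split=> // f g _ _; apply. Qed.

Lemma functional_partial2 i j x : Om x -> functional (fun f => partial i (partial j f) x).
Proof.
move=> Ox; split=> [f g a rf rg|f g rf rg fg].
  have [_ d2f _ _ _] := rf; have [_ d2g _ _ _] := rg.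
  rewrite -(partial_lin _ _ (d2f _ Ox i j) (d2g _ Ox i j)) //.
  by apply/esym/near_eq_derive; exact: near_partial_lin.
apply: near_eq_derive; near=> y; apply: near_eq_derive; near=> z.
apply: fg; apply: subset_closure; near: z; apply: near_open; near: y; exact: near_open.
Unshelve. all: by end_near. Qed.

Lemma functional_trace i x : cOm x -> functional (fun f => trace i f x).
Proof.
move=> cx; split=> [f g a rf rg|f g rf rg fg].
  by apply: cvg_lim => //; exact: cvg_trace_lin.
apply: cvg_lim => //.
have H := cvg_trace (i := i) rg cx.
apply: cvg_trans H; apply: near_eq_cvg; rewrite near_withinE; near=> y => Oy.
apply: near_eq_derive; near=> z; apply/esym/fg; apply: subset_closure.
by near: z; exact: near_open.
Unshelve. all: by end_near. Qed.

Lemma trace_partial i f x : regular f -> Om x -> trace i f x = partial i f x.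
Proof.
move=> [_ _ _ _ pf] Ox; apply: cvg_lim => //.
  exact: within_nbhs_proper (subset_closure Ox).
by apply: cvg_within_filter; exact: pf.
Qed.

Lemma functional0 L : functional L -> L (fun=> 0) = 0.
Proof.
case=> [Ll _]; have := Ll _ _ 1 (regular_cst 0) (regular_cst 0).
have -> : (fun=> 0 + 1 * 0) = (fun=> 0) :> ('rV[R]_n -> R).
  by apply/funext => y; rewrite mulr0 addr0.
by rewrite mul1r => /eqP; rewrite -subr_eq0 opprD addrA subrr sub0r oppr_eq0 => /eqP.
Qed.

Lemma functional_sum L (J : Type) (r : seq J) (d : J -> R) (phi : J -> 'rV[R]_n -> R) :
  functional L -> (forall k, regular (phi k)) ->
  L (fun y => \sum_(k <- r) d k * phi k y) = \sum_(k <- r) d k * L (phi k).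
Proof.
move=> FL rp; elim: r => [|k r IH].
  by rewrite big_nil; under eq_fun do rewrite big_nil; exact: functional0.
rewrite big_cons -IH addrC -FL.1 //; last exact: regular_sum.
by congr L; apply/funext => y; rewrite big_cons addrC.
Qed.

End Regular.

(** * Differentiable curves of functions *)

Section HolderCurve.
Context {R : realType} {n : nat}.
Variables (alpha : R) (Om : set 'rV[R]_n).
Hypotheses (n_gt0 : (0 < n)%N) (Oo : open Om) (O0 : Om !=set0).
Implicit Types (f g : 'rV[R]_n -> R) (x : 'rV[R]_n) (i j : 'I_n).

Local Notation cOm := (closure Om).
Local Notation N := (holder2_norm alpha Om).

Lemma le_term (F : 'I_n -> \bar R) i :
  (forall j, 0 <= F j)%E -> (F i <= \sum_(j < n) F j)%E.
Proof. by move=> F0; rewrite (bigD1 i) //= leeDl // sume_ge0. Qed.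

Lemma le_sup_norm f x : Om x -> (`|f x|%:E <= sup_norm Om f)%E.
Proof. by move=> Ox; apply: ereal_sup_ubound; exists x. Qed.

Lemma sup_norm_ge0 f : (0 <= sup_norm Om f)%E.
Proof. by case: O0 => x Ox; apply: le_trans (le_sup_norm f Ox); rewrite lee_fin. Qed.

(** The supremum of an empty set would be -oo, so a pair of distinct points of [Om] must be
    produced; a small displacement along the first axis gives one. *)
Lemma holder_seminorm_ge0 f : (0 <= holder_seminorm alpha Om f)%E.
Proof.
have [x Ox] := O0; pose i0 : 'I_n := Ordinal n_gt0.
have H : \forall h \near 0^', Om (x + h *: evec R i0).
  have C : x + h *: evec R i0 @[h --> 0^'] --> x.
    rewrite -[X in _ --> X]addr0 -(scale0r (evec R i0)); apply: cvgD; first exact: cvg_cst.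
    by apply: cvgZr_tmp; apply: cvg_within_filter; exact: cvg_id.
  exact: C (near_open Oo Ox).
have [h [h0 Oh]] : exists h : R, h != 0 /\ Om (x + h *: evec R i0).
  near (0 : R)^' => h; exists h; split; near: h => //; exact: nbhs_dnbhs_neq.
have : (`|f (x + h *: evec R i0) - f x| / (enorm (x + h *: evec R i0 - x) `^ alpha))%:E
   \in [set (`|f p.1 - f p.2| / (enorm (p.1 - p.2) `^ alpha))%:E |
             p in [set p | [/\ Om p.1, Om p.2 & p.1 != p.2]]].
  rewrite inE; exists (x + h *: evec R i0, x) => //=; split=> //.
  rewrite -subr_eq0 addrAC subrr add0r scaler_eq0 negb_or h0 /=.
  apply/eqP => /rowP/(_ i0)/eqP; rewrite !mxE !eqxx /=.
  by rewrite (oner_eq0 R).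
rewrite inE => /ereal_sup_ubound; apply: le_trans.
by rewrite lee_fin divr_ge0 // powR_ge0.
Unshelve. all: by end_near. Qed.

Lemma sup_norm_le_holder2 f : (sup_norm Om f <= N f)%E.
Proof.
rewrite /holder2_norm -addeA leeDl // adde_ge0 //.
  by apply: sume_ge0 => i _; exact: sup_norm_ge0.
apply: sume_ge0 => i _; apply: sume_ge0 => j _; rewrite adde_ge0 ?sup_norm_ge0 //.
exact: holder_seminorm_ge0.
Qed.

Lemma sup_partial_le_holder2 f i : (sup_norm Om (partial i f) <= N f)%E.
Proof.
apply: (@le_trans _ _ (\sum_(i < n) sup_norm Om (partial i f))%E).
  by apply: (@le_term (fun i => sup_norm Om (partial i f))) => k; exact: sup_norm_ge0.
rewrite /holder2_norm addeAC leeDr // adde_ge0 ?sup_norm_ge0 //.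
apply: sume_ge0 => k _; apply: sume_ge0 => j _; rewrite adde_ge0 ?sup_norm_ge0 //.
exact: holder_seminorm_ge0.
Qed.

Lemma sup_partial2_le_holder2 f i j :
  (sup_norm Om (partial i (partial j f)) <= N f)%E.
Proof.
have ge0 k l : (0 <= sup_norm Om (partial k (partial l f)) +
   holder_seminorm alpha Om (partial k (partial l f)))%E.
  by rewrite adde_ge0 ?sup_norm_ge0 // holder_seminorm_ge0.
apply: (@le_trans _ _ (\sum_(i < n) \sum_(j < n)
       (sup_norm Om (partial i (partial j f))
        + holder_seminorm alpha Om (partial i (partial j f))))%E).
  pose G k l := (sup_norm Om (partial k (partial l f)) +
     holder_seminorm alpha Om (partial k (partial l f)))%E.
  apply: (@le_trans _ _ (\sum_(l < n) G i l)%E).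
    apply: (@le_trans _ _ (G i j)); first by rewrite leeDl // holder_seminorm_ge0.
    by apply: (@le_term (G i)) => l; exact: ge0.
  apply: (@le_term (fun k => \sum_(l < n) G k l)%E) => k.
  by apply: sume_ge0 => l _; exact: ge0.
rewrite /holder2_norm leeDr // adde_ge0 ?sup_norm_ge0 //.
by apply: sume_ge0 => k _; exact: sup_norm_ge0.
Qed.

(** Domination by the norm of C^{2+alpha} is what lets [L] commute with d/dtau along a curve in that
    space. Values, traces of the gradient and second derivatives are the instances to come. *)
Definition bounded_functional (L : ('rV[R]_n -> R) -> R) : Prop :=
  functional Om L /\ forall f, regular Om f -> (`|L f|%:E <= N f)%E.

Lemma closure_bound f x (F := within Om (nbhs x)) (l : R) : cOm x ->
  f @ F --> l -> (`|l|%:E <= sup_norm Om f)%E.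
Proof.
move=> cx fl; have PF : ProperFilter F by exact: within_nbhs_proper.
have := sup_norm_ge0 f; case E : (sup_norm Om f) => [M| |] //.
- move=> _; rewrite lee_fin.
  have H : (`|f y| : R) @[y --> F] --> `|l| by exact: cvg_norm.
  apply: (cvgr_to_le H); rewrite near_withinE; near=> y => Oy.
  by rewrite -lee_fin -E; exact: le_sup_norm.
- by move=> _; rewrite leey.
Unshelve. all: by end_near. Qed.

Lemma bounded_eval x : cOm x -> bounded_functional (fun f => f x).
Proof.
move=> cx; split; first exact: functional_eval.
move=> f [_ _ cf _ _]; apply: le_trans (sup_norm_le_holder2 f).
apply: (@closure_bound f x (f x) cx).
have /subspace_continuousP/(_ x cx) H := cf.
apply: cvg_trans H => P; apply: (@filterS _ _ (nbhs_filter x)) => y HP Oy.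
exact: HP (subset_closure Oy).
Qed.

Lemma bounded_trace i x : cOm x -> bounded_functional (fun f => trace Om i f x).
Proof.
move=> cx; split; first exact: functional_trace.
move=> f rf; apply: le_trans (sup_partial_le_holder2 f i).
by apply: (@closure_bound _ x (trace Om i f x) cx); exact: cvg_trace.
Qed.

Lemma bounded_partial2 i j x : Om x ->
  bounded_functional (fun f => partial i (partial j f) x).
Proof.
move=> Ox; split; first exact: functional_partial2.
move=> f rf; apply: le_trans (sup_partial2_le_holder2 f i j).
exact: le_sup_norm.
Qed.

(** The error of the difference quotient of L(w s) is [L] applied to the error of the difference
    quotient of [w], hence bounded by the norm of the latter. *)
Lemma is_derive_functional L (w : R -> 'rV[R]_n -> R) (w' : 'rV[R]_n -> R) (t : R) :
  bounded_functional L -> (\forall s \near t, regular Om (w s)) -> regular Om w' ->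
  N (fun x => h^-1 * (w (t + h) x - w t x) - w' x) @[h --> 0^'] --> 0%E ->
  is_derive t (1 : R) (fun s => L (w s)) (L w').
Proof.
move=> [FL BL] rw rw' Nw; have rt := nbhs_singleton rw.
have rth : \forall h \near 0^', regular Om (w (t + h)).
  have C : t + h @[h --> 0^'] --> t.
    rewrite -[X in _ --> X]addr0; apply: cvgD; first exact: cvg_cst.
    by apply: cvg_within_filter; exact: cvg_id.
  exact: C rw.
have H : h^-1 * (L (w (t + h)) - L (w t)) @[h --> 0^'] --> L w'.
  apply/cvgrPdist_le => e e0.
  have Ne : \forall h \near 0^', (N (fun x => (h^-1 * (w (t + h) x - w t x) - w' x)%R) < e%:E)%E.
    have /fine_cvgP[Nf N0] := Nw.
    have A := cvgr_lt _ N0 _ e0; near=> h.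
    have Nh : N (fun x => h^-1 * (w (t + h) x - w t x) - w' x) \is a fin_num by near: h.
    by rewrite -(fineK Nh) lte_fin; near: h; exact: A.
  near=> h.
  have rh : regular Om (w (t + h)) by near: h.
  (* The error is assembled by three operations of the shape f + a * g, the shape for which
     regularity and linearity of [L] are stated. *)
  set f1 := fun x => w (t + h) x + (- 1) * w t x.
  have rf1 : regular Om f1 by exact: regular_lin.
  have r0 := regular_cst Om (0 : R).
  set f2 := fun x => 0 + h^-1 * f1 x.
  have rf2 : regular Om f2 by exact: (regular_lin Oo _ r0 rf1).
  set f3 := fun x => f2 x + (- 1) * w' x.
  have rf3 : regular Om f3 by exact: (regular_lin Oo _ rf2 rw').
  have E3 : f3 = (fun x => h^-1 * (w (t + h) x - w t x) - w' x).
    by apply/funext => x; rewrite /f3 /f2 /f1; ring.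
  have L3 : L f3 = h^-1 * (L (w (t + h)) - L (w t)) - L w'.
    rewrite /f3 FL.1 // /f2 FL.1 // /f1 FL.1 // (functional0 FL); ring.
  rewrite distrC -L3 -lee_fin; apply: le_trans (BL _ rf3) _.
  by rewrite E3 ltW //; near: h.
have E : (fun h => h^-1 * (L (w (t + h)) - L (w t))) =
   (fun h => h^-1 *: (((fun s => L (w s)) \o shift t) (h *: (1 : R)) - L (w t))).
  by apply/funext => h; rewrite /= [h *: 1]mulr1 [h + t]addrC.
rewrite E in H.
by apply: DeriveDef; [apply/cvg_ex; eexists; exact: H | exact: cvg_lim H].
Unshelve. all: by end_near. Qed.

(** [Ck_curve] yields its derivatives one existential at a time. They are collected in a single
    sequence [W], common to all bounded functionals. *)
Lemma curve_tower e m (w : R -> 'rV[R]_n -> R) : Ck_curve alpha Om e m w ->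
  exists W : nat -> R -> 'rV[R]_n -> R, [/\ W 0 = w,
    forall k t, (k <= m)%N -> `|t| < e -> regular Om (W k t)
  & forall L, bounded_functional L -> tower e m (fun k t => L (W k t))].
Proof.
elim: m w => [|m IH] w /=.
  case=> hw _ _; exists (fun _ => w); split=> // k t _ te.
  exact: holder2_regular (hw t te).
case=> hw _ [w' [dw Cw']]; have [W [W0 rW tW]] := IH _ Cw'.
exists (fun k => if k is k'.+1 then W k' else w); split=> //.
  by move=> [|k] t km te; [exact: holder2_regular (hw t te) | exact: rW].
move=> L BL [|k] t km te; last exact: tW.
apply: is_derive_functional => //.
- by near=> s; apply: holder2_regular (hw s _); near: s; exact: near_norm_lt.
- exact: rW.
- by rewrite W0; exact: dw.
Unshelve. all: by end_near. Qed.

End HolderCurve.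

(** * The Dirichlet problem for the Laplacian *)

(** At the maximum [dg 0] is 0. If [m] were positive, [dg] would be positive just to the right of 0
    and [g] would exceed [g 0] there. *)
Lemma second_derivative_at_max {R : realType} (g dg : R -> R) (m d : R) :
  0 < d -> (forall s, `|s| < d -> is_derive s (1 : R) g (dg s)) ->
  is_derive (0 : R) (1 : R) dg m -> (forall s, `|s| < d -> g s <= g 0) -> m <= 0.
Proof.
move=> d0 gd [dgd dgm] gmax; rewrite leNgt; apply/negP => m0.
have i0 (s : R) : s \in `](- d), d[ -> `|s| < d by rewrite in_itv /= ltr_norml.
have dg0 : dg 0 = 0.
  have H : is_derive (0 : R) (1 : R) g 0.
    apply: (@derive1_at_max _ g (- d) d 0).
    - by rewrite ge0_cp ?ltW.
    - by move=> t /i0 /gd [].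
    - by rewrite in_itv /= oppr_lt0 d0.
    - by move=> t /i0; exact: gmax.
  have [_ <-] := gd 0 ltac:(by rewrite normr0).
  by case: H.
have H : h^-1 * dg h @[h --> 0^'] --> m.
  have -> : (fun h => h^-1 * dg h) =
      (fun h => h^-1 *: ((dg \o shift 0) (h *: (1 : R)) - dg 0)).
    by apply/funext => h; rewrite /= dg0 subr0 addr0 [h *: 1]mulr1.
  by rewrite -dgm.
have P : \forall h \near 0^', 0 < h^-1 * dg h := cvgr_gt _ H _ m0.
have [e /= e0 He] := P.
pose b := Num.min (e / 2) (d / 2).
have b0 : 0 < b by rewrite lt_min !divr_gt0.
have bd : b < d by rewrite gt_min; apply/orP; right; rewrite ltr_pdivrMr // ltr_pMr // ltr1n.
have be : b < e by rewrite gt_min; apply/orP; left; rewrite ltr_pdivrMr // ltr_pMr // ltr1n.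
have gd' x : 0 <= x <= b -> is_derive x (1 : R) g (dg x).
  by move=> /andP[x0 xb]; apply: gd; rewrite ger0_norm // (le_lt_trans xb).
have [||c] := @MVT R g dg 0 b b0.
- by move=> x; rewrite in_itv /= => /andP[x0 xb]; apply: gd'; rewrite !ltW.
- apply: derivable_within_continuous => x; rewrite in_itv /= => xb.
  by case: (gd' _ xb).
rewrite in_itv /= => /andP[c0 cb]; rewrite subr0 => E.
have : g b <= g 0 by apply: gmax; rewrite gtr0_norm.
rewrite -subr_le0 E pmulr_lle0 // leNgt => /negP; apply.
have : 0 < c^-1 * dg c.
  by apply: He; [rewrite /= sub0r normrN gtr0_norm // (lt_trans cb) | rewrite gt_eqF].
by rewrite pmulr_rgt0 // invr_gt0.
Qed.

Section Dirichlet.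
Context {R : realType} {n : nat}.
Variables (Om : set 'rV[R]_n).
Hypotheses (n_gt0 : (0 < n)%N) (Oo : open Om) (Ob : bounded_set Om).
Implicit Types (f g : 'rV[R]_n -> R) (x : 'rV[R]_n) (i j : 'I_n).

Local Notation cOm := (closure Om).

Lemma laplace_lin f g a x : regular Om f -> regular Om g -> Om x ->
  laplace (fun y => f y + a * g y) x = laplace f x + a * laplace g x.
Proof.
move=> rf rg Ox; rewrite /laplace mulr_sumr -big_split /=; apply: eq_bigr => i _.
exact: (functional_partial2 Oo i i Ox).1.
Qed.

Lemma laplace_sum (J : Type) (r : seq J) (d : J -> R) (phi : J -> 'rV[R]_n -> R) x :
  (forall k, regular Om (phi k)) -> Om x ->
  laplace (fun y => \sum_(k <- r) d k * phi k y) x = \sum_(k <- r) d k * laplace (phi k) x.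
Proof.
move=> rp Ox; rewrite /laplace.
under [RHS]eq_bigr do rewrite mulr_sumr.
rewrite exchange_big /=; apply: eq_bigr => i _.
exact: (functional_sum Oo r d (functional_partial2 Oo i i Ox)).
Qed.

Lemma laplace_cst (c : R) x : laplace (fun=> c) x = 0.
Proof.
rewrite /laplace big1 // => i _.
have p0 (d : R) : partial i (fun=> d) = fun=> 0.
  by apply/funext => y; rewrite /partial derive_cst.
by rewrite !p0.
Qed.

Let x0sq (y : 'rV[R]_n) := y 0 (Ordinal n_gt0) ^+ 2.

Lemma is_derive_sq x v :
  is_derive x v x0sq (2 * x 0 (Ordinal n_gt0) * v 0 (Ordinal n_gt0)).
Proof.
have H := is_derive_coord x v (Ordinal n_gt0).
apply: is_derive_eq (is_deriveM H H) _.
by rewrite /GRing.scale /=; ring.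
Qed.

Lemma partial_sq i : partial i x0sq = fun x => 2 * (evec R i) 0 (Ordinal n_gt0) * x 0 (Ordinal n_gt0).
Proof.
apply/funext => x; rewrite /partial (@derive_val _ _ _ _ _ _ _ (is_derive_sq x _)).
by ring.
Qed.

Lemma partial2_sq i x : is_derive x (evec R i) (partial i x0sq) (2 * (evec R i) 0 (Ordinal n_gt0) ^+ 2).
Proof.
rewrite partial_sq.
apply: is_derive_eq (is_deriveZ (2 * (evec R i) 0 (Ordinal n_gt0)) (is_derive_coord x (evec R i) _)) _.
by rewrite /GRing.scale /=; ring.
Qed.

Lemma compact_closure : compact cOm.
Proof.
apply: bounded_closed_compact; last exact: closed_closure.
have [M [Mr HM]] := Ob; exists M; split=> // e Me x cx.
have PF : ProperFilter (within Om (nbhs x)) by exact: within_nbhs_proper.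
have H : (`|y| : R) @[y --> within Om (nbhs x)] --> `|x|.
  by apply: cvg_norm; apply: cvg_within_filter; exact: cvg_id.
apply: (cvgr_to_le H); rewrite near_withinE; near=> y => Oy.
exact: HM.
Unshelve. all: by end_near. Qed.

(** If [f z] is positive, add e x_1^2, whose Laplacian 2 e is positive: the sum has no interior
    maximum. With e = f z / B and B greater than x_1^2 on the closure, the sum stays below [f z] on
    the boundary, so its maximum is not there either. *)
Lemma maximum_principle f : regular Om f -> (forall x, Om x -> laplace f x = 0) ->
  (forall x, boundary Om x -> f x = 0) -> forall x, cOm x -> f x <= 0.
Proof.
move=> rf lf bf z cz; rewrite leNgt; apply/negP => fz.
have [df d2f cf _ _] := rf.
have cx0 : continuous x0sq.
  move=> x; apply: (@continuousM _ _ (fun y : 'rV[R]_n => y 0 (Ordinal n_gt0))); exact: coord_continuous.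
have cne : cOm !=set0 by exists z.
have [|m _ mP] := compact_EVT_max cne compact_closure (f := x0sq).
  exact: continuous_subspaceT.
pose B := x0sq m + 1.
have B0 : 0 < B by rewrite ltr_wpDl // /x0sq sqr_ge0.
have qB x : cOm x -> x0sq x < B.
  by move=> cx; rewrite ltr_pwDr // mP // inE.
pose e := f z / B; have e0 : 0 < e by rewrite divr_gt0.
pose v x := f x + e * x0sq x.
have cv : {within cOm, continuous v}.
  move=> x; apply: cvgD; first exact: cf.
  apply: cvgM; first exact: cvg_cst.
  by apply: continuous_subspaceT.
have [y cy yP] := compact_EVT_max cne compact_closure cv.
rewrite inE in cy.
have vz : f z <= v y.
  apply: le_trans (yP z _); last by rewrite inE.
  by rewrite /v lerDl mulr_ge0 ?sqr_ge0 // ltW.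
have Oy : Om y.
  apply: contrapT => nOy.
  have fy : f y = 0.
    by apply: bf; split => //; move/interior_subset.
  move: vz; rewrite /v fy add0r leNgt => /negP; apply.
  by rewrite /e mulrAC ltr_pdivrMr // ltr_pM2l // qB.
have nO i : \forall s \near (0 : R), Om (y + s *: evec R i).
  have C : y + s *: evec R i @[s --> (0 : R)] --> y.
    rewrite -[X in _ --> X]addr0 -(scale0r (evec R i)); apply: cvgD; first exact: cvg_cst.
    by apply: cvgZr_tmp; exact: cvg_id.
  exact: C (near_open Oo Oy).
have [d /= d0 dO] := filter_forall _ nO.
have Oys s i : `|s| < d -> Om (y + s *: evec R i).
  by move=> sd; apply: dO; rewrite /= sub0r normrN.
have key i : partial i (partial i f) y + e * (2 * (evec R i) 0 (Ordinal n_gt0) ^+ 2) <= 0.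
  apply: (@second_derivative_at_max _ (fun s => v (y + s *: evec R i))
    (fun s => partial i f (y + s *: evec R i) + e * partial i x0sq (y + s *: evec R i)) _ d) => //.
  - move=> s sd; have A := derivableP (df _ (Oys s i sd) i).
    apply: (@is_derive_line _ _ _ v).
    apply: is_derive_eq (is_deriveD A (is_deriveZ e (is_derive_sq _ (evec R i)))) _.
    by rewrite partial_sq /GRing.scale /=; congr (_ + _); ring.
  - have A := derivableP (d2f _ Oy i i).
    have B' := is_deriveD A (is_deriveZ e (partial2_sq i y)).
    apply: (@is_derive_line _ _ _ (fun z => partial i f z + e * partial i x0sq z)).
    by rewrite scale0r addr0.
  - move=> s sd; rewrite scale0r addr0; apply: yP; rewrite inE.
    exact: subset_closure (Oys s i sd).
have : \sum_i (partial i (partial i f) y + e * (2 * (evec R i) 0 (Ordinal n_gt0) ^+ 2)) <= 0.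
  by apply: sumr_le0 => i _; exact: key.
rewrite big_split /= -/(laplace f y) lf // add0r leNgt => /negP; apply.
rewrite (bigD1 (Ordinal n_gt0)) //= ltr_pwDl //.
  by rewrite mxE !eqxx expr1n mulr1 mulr_gt0.
by apply: sumr_ge0 => i _; rewrite mulr_ge0 ?(ltW e0) // mulr_ge0 // sqr_ge0.
Qed.

Lemma dirichlet_unique f : regular Om f -> (forall x, Om x -> laplace f x = 0) ->
  (forall x, boundary Om x -> f x = 0) -> forall x, cOm x -> f x = 0.
Proof.
move=> rf lf bf x cx; apply/eqP; rewrite eq_le maximum_principle //=.
pose g y := 0 + (- 1) * f y.
have r0 := regular_cst Om (0 : R).
have rg : regular Om g by exact: regular_lin.
have lg y : Om y -> laplace g y = 0.
  by move=> Oy; rewrite (laplace_lin _ r0 rf) // lf // mulr0 addr0 laplace_cst.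
have bg y : boundary Om y -> g y = 0 by move=> By; rewrite /g bf // mulr0 addr0.
have := maximum_principle rg lg bg cx.
by rewrite /g add0r mulN1r oppr_le0.
Qed.

(** Greedy choice: an element of [S] outside the row space of [B] is appended and raises the rank,
    and [m] bounds the number of extensions left. [S] is an arbitrary predicate, and the rows of [B]
    belong to it, so each row of solvable data comes with a solution. *)
Lemma maximal_family (M : nat) (S : 'rV[R]_M -> Prop) :
  exists k (B : 'M[R]_(k, M)), (forall l, S (row l B)) /\ (forall c, S c -> (c <= B)%MS).
Proof.
suff H m k (B : 'M[R]_(k, M)) : (M <= \rank B + m)%N -> (forall l, S (row l B)) ->
    exists k (B : 'M[R]_(k, M)), (forall l, S (row l B)) /\ (forall c, S c -> (c <= B)%MS).
  by apply: (H M 0%N (0 : 'M[R]_(0%N, M))); [rewrite leq_addl | case].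
elim: m k B => [|m IH] k B rB SB.
  exists k, B; split=> // c _; rewrite addn0 in rB.
  by apply: submx_full; rewrite /row_full eqn_leq rB rank_leq_col.
have [H|/existsNP[c /not_implyP[Sc cB]]] := pselect (forall c, S c -> (c <= B)%MS).
  by exists k, B.
apply: (IH (1 + k)%N (col_mx c B)).
  apply: leq_trans rB _; rewrite addnS -addSn leq_add2r.
  apply: rank_ltmx; rewrite /ltmx; apply/andP; split.
    by apply/submxP; exists (row_mx 0 1%:M); rewrite mul_row_col mul0mx mul1mx add0r.
  by apply/negP => H; apply: cB; apply: submx_trans H; apply/submxP; exists (row_mx 1%:M 0);
    rewrite mul_row_col mul0mx mul1mx addr0.
move=> i; case: (split_ordP i) => j ->.
  by rewrite rowKu row_id.
by rewrite rowKd.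
Qed.

(* The data for which the Dirichlet problem is solvable form a subspace of a
   finite dimensional space, on which the solution operator is linear, hence
   bounded: no a priori estimate is needed. *)
Lemma dirichlet_basis (I : finType) (f : I -> 'rV[R]_n -> R) :
  exists k (phi : 'I_k -> 'rV[R]_n -> R) (P : I -> 'I_k -> R),
    (forall l, regular Om (phi l)) /\
    forall (c : I -> R) w, regular Om w -> (forall x, boundary Om x -> w x = 0) ->
      (forall x, Om x -> laplace w x = \sum_i c i * f i x) ->
      forall x, cOm x -> w x = \sum_l (\sum_i c i * P i l) * phi l x.
Proof.
pose F (j : 'I_#|I|) := f (enum_val j).
pose solves (c : 'rV[R]_#|I|) w := [/\ regular Om w, forall x, boundary Om x -> w x = 0
   & forall x, Om x -> laplace w x = \sum_j c 0 j * F j x].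
have [k [B [SB maxB]]] := maximal_family (fun c => exists w, solves c w).
have /choice[phi hphi] := SB.
(* [c *m pinvmx B] gives coordinates of the data [c] in the rows of [B]. They are linear in [c] and
   do not depend on the solution [w]. *)
exists k, phi, (fun (i : I) l => pinvmx B (enum_rank i) l); split.
  by move=> l; case: (hphi l).
move=> c w rw bw lw x cx.
pose cv : 'rV[R]_#|I| := \row_j c (enum_val j).
have scv : solves cv w.
  split=> // y Oy; rewrite lw // (reindex_onto enum_val enum_rank) /=; last by move=> i _; rewrite enum_rankK.
  by apply: eq_big => j; [rewrite enum_valK eqxx | rewrite mxE].
have cB : (cv <= B)%MS by apply: maxB; exists w.
pose d := cv *m pinvmx B.
have dE l : d 0 l = \sum_(i : I) c i * pinvmx B (enum_rank i) l.
  rewrite mxE (reindex_onto enum_rank enum_val) /=; last by move=> i _; rewrite enum_valK.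
  by apply: eq_big => [j|j _]; [rewrite enum_rankK eqxx | rewrite mxE enum_rankK].
pose s y := \sum_l d 0 l * phi l y.
have rphi l : regular Om (phi l) by case: (hphi l).
have rs : regular Om s by exact: regular_sum.
(* [w] and the combination [s] have the same Laplacian and both vanish on the boundary; uniqueness
   makes them equal. *)
have E0 : w x + (- 1) * s x = 0.
  apply: (@dirichlet_unique (fun x => w x + (- 1) * s x)) => //; first exact: regular_lin.
    move=> y Oy; rewrite laplace_lin // laplace_sum //.
    have [_ _ ->] := scv => //.
    have -> : \sum_l d 0 l * laplace (phi l) y = \sum_j (d *m B) 0 j * F j y.
      under eq_bigr => l _ do rewrite (let: And3 _ _ h := hphi l in h) // mulr_sumr.
      rewrite exchange_big /=; apply: eq_bigr => j _; rewrite mxE mulr_suml.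
      by apply: eq_bigr => l _; rewrite !mxE mulrA.
    by rewrite mulmxKpV // mulN1r subrr.
  move=> y by_; rewrite bw // add0r /s big1 ?mulr0 // => l _.
  by have [_ -> //] := hphi l; rewrite mulr0.
move/eqP: E0; rewrite mulN1r subr_eq0 => /eqP ->.
by apply: eq_bigr => l _; rewrite dE.
Qed.

End Dirichlet.

(** * Successive linearizations of the boundary value problem *)

(** Orders of vanishing at 0 add up under multiplication. *)
Lemma derive1nM_eq0 {R : realType} (e : R) (a b m : nat) (f g : R -> R) :
  0 < e -> smooth e m f -> smooth e m g ->
  (forall i, (i < a)%N -> f^[i] 0 = 0) -> (forall i, (i < b)%N -> g^[i] 0 = 0) ->
  (m < a + b)%N -> (fun t => f t * g t)^[m] 0 = 0.
Proof.
move=> e0 fs gs f0 g0 mab.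
rewrite (derive1nM fs gs) ?normr0 // big1 // => -[i /= im] _.
have [ia|ai] := ltnP i a; first by rewrite f0 // mul0r mulr0.
by rewrite g0 ?mulr0 //; lia.
Qed.

Section Family.
Context {R : realType} {n : nat}.
Variables (alpha : R) (Om : set 'rV[R]_n) (ell : nat) (K k0 : R).
Hypotheses (n_gt0 : (0 < n)%N) (Oo : open Om) (O0 : Om !=set0) (Ob : bounded_set Om).
Hypotheses (K_ge0 : 0 <= K) (k0_gt0 : 0 < k0).
Implicit Types (x : 'rV[R]_n) (i j : 'I_n) (d : option 'I_n) (w : seq (option 'I_n)).

Local Notation cOm := (closure Om).
Local Notation V := (R * 'rV[R]_n)%type.

(* [pw k t] is the k-th derivative in tau, at tau = t, of the solution with
   coefficient [pg] and boundary data [pla + tau * dot x pom]. *)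
Record param := Param { pg : V -> R; pla : R; pom : 'rV[R]_n; pe : R;
                        pw : nat -> R -> 'rV[R]_n -> R }.
Implicit Types th : param.

Definition ujet x d (f : 'rV[R]_n -> R) : R :=
  if d is Some i then trace Om i f x else f x.

Definition upoint th x t : V := \sum_d ujet x d (pw th 0 t) *: dvec d.

Definition gcomp w th x t : R := dword w (pg th) (upoint th x t).

(** The class over which constants are uniform: [K] bounds the jets and [k0] the ellipticity from
    below. [v_pde] is the equation with the divergence expanded; it is written with traces, equal to
    partial derivatives inside [Om], so that one [gcomp] serves both in [Om] and at the boundary. *)
Record valid th : Prop := Valid {
  v_smooth : Ck (3 + ell) setT (pg th);
  v_bound : forall w, (size w <= 3 + ell)%N -> `|dword w (pg th) (pla th, 0)| <= K;
  v_ell : k0 <= pg th (pla th, 0);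
  v_om : dot (pom th) (pom th) = 1;
  v_eps : 0 < pe th;
  v_reg : forall k t, (k <= ell)%N -> `|t| < pe th -> regular Om (pw th k t);
  v_tower : forall L, bounded_functional alpha Om L ->
    tower (pe th) ell (fun k t => L (pw th k t));
  v_pde : forall t, `|t| < pe th -> forall x, Om x ->
    gcomp [::] th x t * laplace (pw th 0 t) x
    + (\sum_i gcomp [:: None] th x t
         * (trace Om i (pw th 0 t) x * trace Om i (pw th 0 t) x)
    + \sum_i \sum_j gcomp [:: Some j] th x t
         * (partial i (partial j (pw th 0 t)) x * trace Om i (pw th 0 t) x)) = 0;
  v_init : forall x, cOm x -> pw th 0 0 x = pla th;
  v_bdry : forall t, `|t| < pe th -> forall x, boundary Om x ->
    pw th 0 t x = pla th + t * dot x (pom th) }.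

(* The jets met in the derivative of order N+1 in tau besides the leading term
   D_eta^N gamma, which is excluded. *)
Definition good (N : nat) w := ((size w < N) || ((size w <= N) && (None \in w)))%N.

(** No word is good at level 0, so that [close 0] only asks for the same lambda and omega, whatever
    [rho]. *)
Definition close (N : nat) (rho : R) th1 th2 : Prop :=
  [/\ pla th1 = pla th2, pom th1 = pom th2 &
      forall w, good N w ->
        `|dword w (pg th1) (pla th1, 0) - dword w (pg th2) (pla th1, 0)| <= rho].

Local Notation lipN N := (lip valid (close N)).
Local Notation tameN N := (tame valid (close N)).

Lemma close_le N N' rho th1 th2 : (N <= N')%N -> close N' rho th1 th2 -> close N rho th1 th2.
Proof.
move=> NN [la om H]; split=> // w /orP[sw|/andP[sw wN]]; apply: H; apply/orP; [left|right].
  exact: leq_trans NN.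
by rewrite wN (leq_trans sw).
Qed.

Lemma lip_word N w : good N w -> (size w <= 3 + ell)%N ->
  lipN N (fun th => dword w (pg th) (pla th, 0)).
Proof.
move=> gw sw; exists (K + 1); first by rewrite addr_ge0.
split=> [th vt|rho th1 th2 r0 v1 v2 [la _ H]].
  by rewrite (le_trans (v_bound vt sw)) // lerDl.
rewrite -la; apply: le_trans (H _ gw) _.
by rewrite mulrDl mul1r lerDr mulr_ge0.
Qed.

Lemma lip_om N i : lipN N (fun th => pom th 0 i).
Proof.
exists 1 => //; split=> [th vt|rho th1 th2 r0 v1 v2 [_ om _]].
  have := v_om vt; rewrite /dot (bigD1 i) //= => E.
  rewrite -sqrtr_sqr -[X in _ <= X]sqrtr1; apply: ler_wsqrtr.
  rewrite expr2 -[X in _ <= X]E lerDl sumr_ge0 // => j _.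
  by rewrite -expr2 sqr_ge0.
by rewrite om subrr normr0 mulr_ge0.
Qed.

Lemma bounded_ujet x d : cOm x -> bounded_functional alpha Om (ujet x d).
Proof. by move=> cx; case: d => [i|]; [exact: bounded_trace | exact: bounded_eval]. Qed.

Lemma smooth_functional L th : bounded_functional alpha Om L -> valid th ->
  smooth (pe th) ell (fun t => L (pw th 0 t)).
Proof. by move=> BL vt; exact: (tower_smooth (v_tower vt BL)). Qed.

Lemma derive1n_functional L th k : bounded_functional alpha Om L -> valid th ->
  (k <= ell)%N -> (fun t => L (pw th 0 t))^[k] 0 = L (pw th k 0).
Proof.
move=> BL vt kl; rewrite (tower_derive1n (v_tower vt BL)) // normr0.
exact: v_eps.
Qed.

Lemma valid_eps th : valid th -> `|0 : R| < pe th.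
Proof. by move=> vt; rewrite normr0; exact: v_eps. Qed.

Lemma regular_pw th k : valid th -> (k <= ell)%N -> regular Om (pw th k 0).
Proof. by move=> vt kl; apply: v_reg => //; exact: valid_eps. Qed.

Lemma ujet_cst (c : R) x d : cOm x -> ujet x d (fun=> c) = if d is Some _ then 0 else c.
Proof.
case: d => [i|] cx //=; apply: cvg_lim => //.
have -> : (partial i (fun=> c)) = fun=> 0.
  by apply/funext => y; rewrite /partial derive_cst.
exact: cvg_cst.
Qed.

Lemma ujet_init th x d : valid th -> cOm x ->
  ujet x d (pw th 0 0) = if d is Some _ then 0 else pla th.
Proof.
move=> vt cx; rewrite -(ujet_cst (pla th) d cx).
have [_ Lloc] := (bounded_ujet d cx).1; apply: Lloc => //.
- exact: regular_pw.
- exact: regular_cst.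
- by move=> y cy; exact: v_init.
Qed.

Lemma partial2_init th x i j : valid th -> Om x -> partial i (partial j (pw th 0 0)) x = 0.
Proof.
move=> vt Ox; have [_ Lloc] := functional_partial2 Oo i j Ox.
rewrite (Lloc _ (fun=> pla th)).
- have p0 (k : 'I_n) (c : R) : partial k (fun=> c) = fun=> 0.
    by apply/funext => y; rewrite /partial derive_cst.
  by rewrite !p0.
- exact: regular_pw.
- exact: regular_cst.
- by move=> y cy; exact: v_init.
Qed.

Lemma upoint_init th x : valid th -> cOm x -> upoint th x 0 = (pla th, 0).
Proof.
move=> vt cx; rewrite /upoint dvec_sum; congr pair; first by rewrite ujet_init.
by apply/rowP => i; rewrite !mxE ujet_init.
Qed.

Lemma smooth_gcomp w th x : valid th -> cOm x -> (size w <= 3)%N ->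
  smooth (pe th) ell (gcomp w th x).
Proof.
move=> vt cx sw; apply: smooth_dword.
  by apply: Ck_le (v_smooth vt); rewrite leq_add2r.
by move=> d; apply: smooth_functional => //; exact: bounded_ujet.
Qed.

(* The functions [phi] depend on the domain only, not on the coefficient. *)
Definition etame N (W : param -> 'rV[R]_n -> R) : Prop :=
  exists (I : finType) (phi : I -> 'rV[R]_n -> R) (c : I -> param -> R),
  [/\ forall l, regular Om (phi l), forall l, lipN N (c l) &
      forall th x, valid th -> cOm x -> W th x = \sum_l c l th * phi l x].

Local Notation W k := (fun th => pw th k 0).

Lemma etame_le N N' k : (N <= N')%N -> etame N (W k) -> etame N' (W k).
Proof.
move=> NN [I [phi [c [rp lc E]]]]; exists I, phi, c; split=> // l.
by apply: sub_lip (lc l) => rho th1 th2; exact: close_le.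
Qed.

(** [L x] acts on the fixed functions [phi] only and leaves the coefficients in the parameter
    untouched. *)
Lemma etame_functional N k (D : set 'rV[R]_n) (L : 'rV[R]_n -> ('rV[R]_n -> R) -> R) :
  (k <= ell)%N -> etame N (W k) -> (forall x, D x -> functional Om (L x)) ->
  tameN N D (fun th x => L x (pw th k 0)).
Proof.
move=> kl [I [phi [c [rp lc E]]]] FL.
exists I, (fun l x => L x (phi l)), c; split=> // th x vt Dx.
rewrite -(functional_sum Oo (index_enum I) (fun l => c l th) (FL x Dx) rp).
apply: (FL x Dx).2; first exact: regular_pw.
  exact: regular_sum.
by move=> y cy; exact: E.
Qed.

Lemma tame_ujet N k d : (k <= ell)%N -> etame N (W k) ->
  tameN N cOm (fun th x => ujet x d (pw th k 0)).
Proof.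
move=> kl eW.
exact: (@etame_functional N k cOm (fun x => ujet x d) kl eW (fun x cx => (bounded_ujet d cx).1)).
Qed.

Lemma derive1nS_gcomp w th x m : valid th -> cOm x -> (m < ell)%N ->
  (size w + m < 3 + ell)%N ->
  (gcomp w th x)^[m.+1] 0 =
  \sum_d \sum_(i < m.+1) 'C(m, i)%:R *
    ((gcomp (d :: w) th x)^[i] 0 * ujet x d (pw th (m - i).+1 0)).
Proof.
move=> vt cx ml sw.
rewrite (@derive1nS_dword _ _ (pe th) (pg th) (fun d t => ujet x d (pw th 0 t)) m.+1) //.
- apply: eq_bigr => d _; apply: eq_bigr => i _; congr (_ * (_ * _)).
  apply: derive1n_functional => //; first exact: bounded_ujet.
  by rewrite (leq_ltn_trans (leq_subr _ _)).
- by apply: Ck_le (v_smooth vt); rewrite addnS.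
- move=> d; exact: (smooth_le ml (smooth_functional (bounded_ujet d cx) vt)).
- exact: valid_eps.
Qed.

(** In the recursion [derive1nS_gcomp] each differentiation adds a letter in front of the word and a
    factor built from some w_k with 0 < k <= m. The last two hypotheses say that all these factors
    and words are admissible. *)
Lemma tame_gcomp N m w : (m <= ell)%N -> (size w + m <= 3 + ell)%N ->
  (forall k, (0 < k <= m)%N -> etame N (W k)) ->
  (forall w', (size w' <= m)%N -> good N (w' ++ w)) ->
  tameN N cOm (fun th x => (gcomp w th x)^[m] 0).
Proof.
elim/ltn_ind: m w => -[_ w _ sw _ gw|m IH w ml sw eW gw].
  have gw0 := gw [::] isT; rewrite addn0 in sw.
  apply: eq_tame (tame_cst cOm (lip_word gw0 sw)) => th x vt cx.
  by rewrite derive1n0 /gcomp upoint_init.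
have H d : tameN N cOm (fun th x => \sum_(i < m.+1) 'C(m, i)%:R *
    ((gcomp (d :: w) th x)^[i] 0 * ujet x d (pw th (m - i).+1 0))).
  apply: tame_sum => -[i im] _ /=; apply: tameZ; first exact: lip_cst.
  apply: tameM.
    apply: IH => //.
    - by lia.
    - by rewrite /=; lia.
    - by move=> k /andP[k1 k2]; apply: eW; rewrite k1 /=; lia.
    - move=> w' sw'; rewrite -cat_rcons; apply: gw.
      by rewrite size_rcons; lia.
  apply: tame_ujet; first by lia.
  by apply: eW; lia.
apply: eq_tame (tame_sum (r := index_enum (option 'I_n)) (fun d _ => H d)) => th x vt cx.
by rewrite derive1nS_gcomp //; lia.
Qed.


Lemma tame_eq0 N (D : set 'rV[R]_n) (q : param -> 'rV[R]_n -> R) :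
  (forall th x, valid th -> D x -> q th x = 0) -> tameN N D q.
Proof. by move=> q0; apply: (eq_tame q0); exact: tame0. Qed.

(** Tameness is asked of the products of derivatives, not of each factor: a factor that is out of
    control is harmless when the other one vanishes at 0. *)
Lemma tame_prod N (D : set 'rV[R]_n) k (F G : param -> 'rV[R]_n -> R -> R) :
  (forall th x, valid th -> D x -> smooth (pe th) k (F th x)) ->
  (forall th x, valid th -> D x -> smooth (pe th) k (G th x)) ->
  (forall i : nat, (i <= k)%N ->
     tameN N D (fun th x => (F th x)^[i] 0 * (G th x)^[k - i] 0)) ->
  tameN N D (fun th x => (fun t => F th x t * G th x t)^[k] 0).
Proof.
move=> Fs Gs FG.
have H : tameN N D (fun th x => \sum_(i < k.+1) 'C(k, i)%:R *
    ((F th x)^[i] 0 * (G th x)^[k - i] 0)).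
  apply: tame_sum => -[i ik] _ /=; apply: tameZ; first exact: lip_cst.
  by apply: FG; rewrite -ltnS.
apply: eq_tame H => th x vt Dx.
by rewrite (derive1nM (Fs th x vt Dx) (Gs th x vt Dx)) //; exact: valid_eps.
Qed.

Definition ugrad i th x t : R := trace Om i (pw th 0 t) x.
Definition uhess i j th x t : R := partial i (partial j (pw th 0 t)) x.

Let Pb i x : cOm x -> bounded_functional alpha Om (fun f => trace Om i f x).
Proof. exact: bounded_trace. Qed.

Let P2b i j x : Om x -> bounded_functional alpha Om (fun f => partial i (partial j f) x).
Proof. exact: bounded_partial2. Qed.

Lemma smooth_P i th x : valid th -> cOm x -> smooth (pe th) ell (ugrad i th x).
Proof. by move=> vt cx; exact: smooth_functional (Pb i cx) vt. Qed.

Lemma smooth_P2 i j th x : valid th -> Om x -> smooth (pe th) ell (uhess i j th x).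
Proof. by move=> vt Ox; exact: smooth_functional (P2b i j Ox) vt. Qed.

Lemma derive1n_P i th x k : valid th -> cOm x -> (k <= ell)%N ->
  (ugrad i th x)^[k] 0 = trace Om i (pw th k 0) x.
Proof. by move=> vt cx kl; exact: derive1n_functional (Pb i cx) vt kl. Qed.

Lemma derive1n_P2 i j th x k : valid th -> Om x -> (k <= ell)%N ->
  (uhess i j th x)^[k] 0 = partial i (partial j (pw th k 0)) x.
Proof. by move=> vt Ox kl; exact: derive1n_functional (P2b i j Ox) vt kl. Qed.

Lemma P_init i th x : valid th -> cOm x -> ugrad i th x 0 = 0.
Proof. by move=> vt cx; exact: (@ujet_init th x (Some i) vt cx). Qed.

Let OmcOm : Om `<=` cOm. Proof. exact: subset_closure. Qed.

Definition pde_lhs th x t : R :=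
  \sum_i gcomp [::] th x t * uhess i i th x t
  + (\sum_i gcomp [:: None] th x t * (ugrad i th x t * ugrad i th x t)
  + \sum_i \sum_j gcomp [:: Some j] th x t * (uhess i j th x t * ugrad i th x t)).

Lemma derive1n_pde_lhs th x k : valid th -> Om x -> (0 < k <= ell)%N ->
  (pde_lhs th x)^[k] 0 = 0.
Proof.
move=> vt Ox /andP[]; case: k => // k _ kl.
rewrite (@eq_derive1n _ (pe th) _ (fun=> 0)); last exact: valid_eps.
  exact: derive1n_cst.
by move=> t te; have := v_pde vt te Ox; rewrite /laplace mulr_sumr.
Qed.

Lemma derive1n_pde_lhsE th x k : valid th -> Om x -> (k <= ell)%N ->
  (pde_lhs th x)^[k] 0 =
  \sum_i (fun t => gcomp [::] th x t * uhess i i th x t)^[k] 0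
  + (\sum_i (fun t => gcomp [:: None] th x t * (ugrad i th x t * ugrad i th x t))^[k] 0
  + \sum_i \sum_j
      (fun t => gcomp [:: Some j] th x t * (uhess i j th x t * ugrad i th x t))^[k] 0).
Proof.
move=> vt Ox kl; have cx := OmcOm Ox.
have sG w : (size w <= 3)%N -> smooth (pe th) k (gcomp w th x).
  by move=> sw; exact: smooth_le kl (smooth_gcomp vt cx sw).
have sP i : smooth (pe th) k (ugrad i th x) := smooth_le kl (@smooth_P i th x vt cx).
have sP2 i j : smooth (pe th) k (uhess i j th x) := smooth_le kl (@smooth_P2 i j th x vt Ox).
have s1 i : smooth (pe th) k (fun t => gcomp [::] th x t * uhess i i th x t).
  exact: smoothM (sG _ _) (sP2 i i).
have s2 i : smooth (pe th) k (fun t => gcomp [:: None] th x t * (ugrad i th x t * ugrad i th x t)).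
  exact: smoothM (sG _ _) (smoothM (sP i) (sP i)).
have s3 i j : smooth (pe th) k
    (fun t => gcomp [:: Some j] th x t * (uhess i j th x t * ugrad i th x t)).
  exact: smoothM (sG _ _) (smoothM (sP2 i j) (sP i)).
have s3' i := smooth_sum (r := index_enum 'I_n) (fun j => s3 i j).
have e0 := valid_eps vt.
rewrite /pde_lhs (derive1nD (smooth_sum s1) (smoothD (smooth_sum s2) (smooth_sum s3')) (leqnn k) e0).
rewrite (derive1nD (smooth_sum s2) (smooth_sum s3') (leqnn k) e0).
rewrite (derive1n_sum _ s1 (leqnn k) e0) (derive1n_sum _ s2 (leqnn k) e0).
rewrite (derive1n_sum _ s3' (leqnn k) e0); congr (_ + (_ + _)).
by apply: eq_bigr => i _; rewrite (derive1n_sum _ (s3 i) (leqnn k) e0).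
Qed.

Lemma derive1n_pw th x k : valid th -> boundary Om x -> (k <= ell)%N ->
  pw th k 0 x = if k is k'.+1 then if k' is 0 then dot x (pom th) else 0 else pla th.
Proof.
move=> vt bx kl; have cx : cOm x := bx.1.
rewrite -(derive1n_functional (@bounded_eval _ _ alpha _ n_gt0 Oo O0 x cx) vt kl).
pose T (i : nat) t := if i is i'.+1 then if i' is 0 then dot x (pom th) else 0
  else pla th + t * dot x (pom th).
have TT : tower (pe th) ell T.
  move=> [|[|i]] t _ _ /=; [|exact: is_derive_cst|exact: is_derive_cst].
  have := is_deriveD (is_derive_cst (pla th) t (1 : R))
    (is_deriveM (is_derive_id t (1 : R)) (is_derive_cst (dot x (pom th)) t (1 : R))).
  by move/is_derive_eq; apply; rewrite /GRing.scale /=; ring.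
rewrite (tower_derive1n TT _ kl (valid_eps vt)).
  by case: k kl => [|[|k]] _ //=; rewrite mul0r addr0.
by move=> t te; exact: v_bdry.
Qed.

(** Gradient and Hessian vanish at tau = 0, so the quadratic terms of the equation vanish to order
    2. One derivative in tau leaves gamma(lambda,0) times the Laplacian of w_1, and gamma(lambda,0)
    >= k0 > 0. *)
Lemma laplace_first th x : (0 < ell)%N -> valid th -> Om x -> laplace (pw th 1 0) x = 0.
Proof.
move=> l0 vt Ox; have cx := OmcOm Ox; have e0 := v_eps vt.
have kl : (0 < 1 <= ell)%N by rewrite l0.
have := derive1n_pde_lhs vt Ox kl; rewrite derive1n_pde_lhsE //.
have sG w : (size w <= 3)%N -> smooth (pe th) 1 (gcomp w th x).
  by move=> sw; exact: smooth_le l0 (smooth_gcomp vt cx sw).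
have sP i : smooth (pe th) 1 (ugrad i th x) := smooth_le l0 (@smooth_P i th x vt cx).
have sP2 i j : smooth (pe th) 1 (uhess i j th x) := smooth_le l0 (@smooth_P2 i j th x vt Ox).
have zP2 i j k : (k < 1)%N -> (uhess i j th x)^[k] 0 = 0.
  by case: k => // _; exact: partial2_init.
have zP i k : (k < 1)%N -> (ugrad i th x)^[k] 0 = 0 by case: k => // _; exact: P_init.
have z2 (F : R -> R) i k : smooth (pe th) 1 F -> (forall c : nat, (c < 1)%N -> F^[c] 0 = 0) ->
    (k < 2)%N -> (fun t => F t * ugrad i th x t)^[k] 0 = 0.
  move=> sF zF k2; apply: (@derive1nM_eq0 _ (pe th) 1 1) => //.
    - exact: smooth_le sF.
    - exact: smooth_le (sP i).
    - exact: zP.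
have z3 (F G : R -> R) : smooth (pe th) 1 F -> smooth (pe th) 1 G ->
    (forall c : nat, (c < 2)%N -> G^[c] 0 = 0) -> (fun t => F t * G t)^[1] 0 = 0.
  by move=> sF sG' zG; apply: (@derive1nM_eq0 _ (pe th) 0 2 1).
rewrite [X in X + _ = _ -> _](_ : _ = pg th (pla th, 0) * laplace (pw th 1 0) x); last first.
  rewrite /laplace mulr_sumr; apply: eq_bigr => i _.
  rewrite (derive1nM (sG [::] isT) (sP2 i i) (leqnn 1) (valid_eps vt)).
  rewrite big_ord_recl big_ord1 /= (_ : uhess i i th x 0 = 0); last exact: partial2_init.
  by rewrite !mulr0 addr0 bin0 mul1r -derive1n1 derive1n_P2 // /gcomp /= upoint_init.
have S2 : \sum_i (fun t => gcomp [:: None] th x t * (ugrad i th x t * ugrad i th x t))^[1] 0 = 0.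
  apply: big1 => i _.
  apply: (z3 (gcomp [:: None] th x) (fun t => ugrad i th x t * ugrad i th x t)).
  - exact: sG.
  - exact: smoothM (sP i) (sP i).
  - by move=> c; exact: (z2 (ugrad i th x) i c (sP i) (zP i)).
have S3 : \sum_i \sum_j
      (fun t => gcomp [:: Some j] th x t * (uhess i j th x t * ugrad i th x t))^[1] 0 = 0.
  apply: big1 => i _; apply: big1 => j _.
  apply: (z3 (gcomp [:: Some j] th x) (fun t => uhess i j th x t * ugrad i th x t)).
  - exact: sG.
  - exact: smoothM (sP2 i j) (sP i).
  - by move=> c; exact: (z2 (uhess i j th x) i c (sP2 i j) (zP2 i j)).
rewrite [X in _ + (X + _) = _]S2 [X in _ + (_ + X) = _]S3.
rewrite !addr0 => /eqP; rewrite mulf_eq0 => /orP[/eqP g0|/eqP //].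
by have := v_ell vt; rewrite g0 leNgt k0_gt0.
Qed.


Lemma partial2_coord i j k x : partial i (partial j (fun y : 'rV[R]_n => y 0 k)) x = 0.
Proof. by rewrite partial_coord /partial derive_cst. Qed.

Lemma trace_coord i j x : cOm x -> trace Om i (fun y => y 0 j) x = (i == j)%:R.
Proof.
move=> cx; rewrite /trace partial_coord; apply: cvg_lim => //.
exact: cvg_cst.
Qed.

(** The linear function x.omega is harmonic with the boundary values of w_1, so uniqueness
    identifies the two, whatever the coefficient. *)
Lemma pw_first th x : (0 < ell)%N -> valid th -> cOm x ->
  pw th 1 0 x = \sum_i pom th 0 i * x 0 i.
Proof.
move=> l0 vt cx; pose g (y : 'rV[R]_n) := \sum_i pom th 0 i * y 0 i.
have rc i := regular_coord Om i.
have rg : regular Om g by exact: regular_sum.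
have rw : regular Om (pw th 1 0) by exact: regular_pw.
have E : pw th 1 0 x + (- 1) * g x = 0.
  apply: (@dirichlet_unique _ _ Om n_gt0 Oo Ob (fun y => pw th 1 0 y + (- 1) * g y)) cx.
  - exact: regular_lin.
  - move=> y Oy; rewrite (laplace_lin Oo _ rw rg Oy) laplace_first // add0r (laplace_sum Oo _ _ rc Oy).
    rewrite big1 ?mulr0 // => i _; rewrite /laplace big1 ?mulr0 // => j _.
    exact: partial2_coord.
  - move=> y By; rewrite (derive1n_pw vt By l0) mulN1r.
    by apply/eqP; rewrite subr_eq0; apply/eqP/eq_bigr => i _; rewrite mulrC.
by move/eqP: E; rewrite mulN1r subr_eq0 => /eqP.
Qed.

Lemma functional_first L th : (0 < ell)%N -> valid th -> functional Om L ->
  L (pw th 1 0) = \sum_i pom th 0 i * L (fun y => y 0 i).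
Proof.
move=> l0 vt FL; rewrite -(functional_sum Oo) //; last by move=> i; exact: regular_coord.
apply: FL.2; first exact: regular_pw.
  by apply: regular_sum => // i; exact: regular_coord.
by move=> y cy; exact: pw_first.
Qed.

Lemma trace_first i th x : (0 < ell)%N -> valid th -> cOm x ->
  trace Om i (pw th 1 0) x = pom th 0 i.
Proof.
move=> l0 vt cx; rewrite (functional_first l0 vt (Pb i cx).1) (bigD1 i) //=.
rewrite trace_coord // eqxx mulr1 big1 ?addr0 // => j ji.
by rewrite trace_coord // eq_sym (negbTE ji) mulr0.
Qed.

Lemma partial2_first i j th x : (0 < ell)%N -> valid th -> Om x ->
  partial i (partial j (pw th 1 0)) x = 0.
Proof.
move=> l0 vt Ox; rewrite (functional_first l0 vt (P2b i j Ox).1) big1 // => k _.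
by rewrite partial2_coord mulr0.
Qed.

Lemma etame_first : (0 < ell)%N -> etame 0 (W 1).
Proof.
move=> l0; exists 'I_n, (fun i y => y 0 i), (fun i th => pom th 0 i); split.
- by move=> i; exact: regular_coord.
- by move=> i; exact: lip_om.
- by move=> th x vt cx; exact: pw_first.
Qed.

(** * Induction step: w_k from the derivatives of lower order *)

Section Step.
Variable k : nat.
Hypotheses (k_gt1 : (1 < k)%N) (k_le : (k <= ell)%N).
Hypothesis IH : forall c : nat, (0 < c < k)%N -> etame k.-1 (W c).

Local Notation tm := (tameN k.-1 Om).

Let l0 : (0 < ell)%N. Proof. exact: leq_trans (ltnW k_gt1) k_le. Qed.

Let tP i (c : nat) : (c < k)%N -> tm (fun th x => (ugrad i th x)^[c] 0).
Proof.
case: c => [_|c ck].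
  by apply: tame_eq0 => th x vt Ox; rewrite derive1n0; exact: P_init (OmcOm Ox).
have cl : (c.+1 <= ell)%N := leq_trans (ltnW ck) k_le.
have H := @tame_ujet k.-1 c.+1 (Some i) cl (IH (c := c.+1) ck).
apply: (eq_tame _ (tame_sub OmcOm H)) => th x vt Ox.
by rewrite derive1n_P //; exact: OmcOm.
Qed.

Let tP2 i j (c : nat) : (c < k)%N -> tm (fun th x => (uhess i j th x)^[c] 0).
Proof.
case: c => [_|c ck].
  by apply: tame_eq0 => th x vt Ox; rewrite derive1n0; exact: partial2_init.
have cl : (c.+1 <= ell)%N := leq_trans (ltnW ck) k_le.
have H := @etame_functional k.-1 c.+1 Om (fun x f => partial i (partial j f) x) cl
  (IH (c := c.+1) ck) (fun x Ox => functional_partial2 Oo i j Ox).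
by apply: (eq_tame _ H) => th x vt Ox; rewrite derive1n_P2.
Qed.

Let zP i th x (c : nat) : valid th -> Om x -> (c < 1)%N -> (ugrad i th x)^[c] 0 = 0.
Proof. by move=> vt Ox; case: c => // _; exact: P_init (OmcOm Ox). Qed.

(** w_0 is constant and w_1 affine. This additional order of vanishing is what keeps the pure eta
    derivatives of gamma of order k - 1 out of w_k. *)
Let zP2 i j th x (c : nat) : valid th -> Om x -> (c < 2)%N -> (uhess i j th x)^[c] 0 = 0.
Proof.
move=> vt Ox; case: c => [|[|//]] _; first exact: partial2_init.
by rewrite derive1n_P2 //; exact: partial2_first.
Qed.

Let sP i th x (c : nat) : (c <= k)%N -> valid th -> Om x -> smooth (pe th) c (ugrad i th x).
Proof.
move=> ck vt Ox; apply: smooth_le (@smooth_P i th x vt (OmcOm Ox)).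
exact: leq_trans k_le.
Qed.

Let sP2 i j th x (c : nat) : (c <= k)%N -> valid th -> Om x -> smooth (pe th) c (uhess i j th x).
Proof.
move=> ck vt Ox; apply: smooth_le (@smooth_P2 i j th x vt Ox).
exact: leq_trans k_le.
Qed.

Let sG w th x (c : nat) : (size w <= 3)%N -> (c <= k)%N -> valid th -> Om x ->
  smooth (pe th) c (gcomp w th x).
Proof.
move=> sw ck vt Ox; apply: smooth_le (smooth_gcomp vt (OmcOm Ox) sw).
exact: leq_trans k_le.
Qed.

Let tG w (c : nat) : (size w <= 1)%N -> (c < k)%N ->
  (forall w', (size w' <= c)%N -> good k.-1 (w' ++ w)) ->
  tm (fun th x => (gcomp w th x)^[c] 0).
Proof.
move=> sw ck gw; apply: tame_sub OmcOm _; apply: tame_gcomp => //.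
- by lia.
- by lia.
- by move=> c' /andP[c0 cc]; apply: IH; rewrite c0 /=; lia.
Qed.

(** Both factors vanish at 0, so in the derivative of order b <= k neither of them takes all b
    derivatives, and w_k does not occur. *)
Let tame_PQ (Q : param -> 'rV[R]_n -> R -> R) i b : (b <= k)%N ->
  (forall c : nat, (c < k)%N -> tm (fun th x => (Q th x)^[c] 0)) ->
  (forall th x, valid th -> Om x -> smooth (pe th) b (Q th x)) ->
  (forall th x, valid th -> Om x -> Q th x 0 = 0) ->
  tm (fun th x => (fun t => Q th x t * ugrad i th x t)^[b] 0).
Proof.
move=> bk tQ sQ zQ; apply: tame_prod => //.
  by move=> th x vt Ox; exact: sP.
move=> c cb; have [->|c0] := eqVneq c 0%N.
  by apply: tame_eq0 => th x vt Ox; rewrite derive1n0 zQ // mul0r.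
have [->|cb'] := eqVneq c b.
  apply: tame_eq0 => th x vt Ox.
  by rewrite subnn derive1n0 (P_init i vt (OmcOm Ox)) mulr0.
by apply: tameM; [apply: tQ; lia | apply: tP; lia].
Qed.

(** If [Q] vanishes to order [a], then [G] receives at most k - a of the k derivatives. This limits
    the length of the words of gamma that come up. *)
Let tame_high (G Q : param -> 'rV[R]_n -> R -> R) (a : nat) :
  (forall c : nat, (c + a <= k)%N -> tm (fun th x => (G th x)^[c] 0)) ->
  (forall c : nat, (c <= k)%N -> tm (fun th x => (Q th x)^[c] 0)) ->
  (forall th x, valid th -> Om x -> smooth (pe th) k (G th x)) ->
  (forall th x, valid th -> Om x -> smooth (pe th) k (Q th x)) ->
  (forall th x (c : nat), valid th -> Om x -> (c < a)%N -> (Q th x)^[c] 0 = 0) ->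
  tm (fun th x => (fun t => G th x t * Q th x t)^[k] 0).
Proof.
move=> tG' tQ sG' sQ zQ; apply: tame_prod => // c ck.
have [ca|ca] := leqP (c + a) k.
  by apply: tameM; [exact: tG' | apply: tQ; rewrite leq_subr].
by apply: tame_eq0 => th x vt Ox; rewrite zQ ?mulr0 //; lia.
Qed.

Let tame_T2 i : tm (fun th x =>
  (fun t => gcomp [:: None] th x t * (ugrad i th x t * ugrad i th x t))^[k] 0).
Proof.
(* Two gradients vanish to order 2: the words have size at most (k - 2) + 1 and contain [None],
   hence are good at level k - 1. *)
apply: (@tame_high (gcomp [:: None]) (fun th x t => ugrad i th x t * ugrad i th x t) 2).
- move=> c ck; apply: tG => //; first by lia.
  move=> w' sw; rewrite /good size_cat mem_cat inE eqxx orbT andbT /=; apply/orP; right.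
  by lia.
- move=> c ck; apply: (@tame_PQ (ugrad i)) => // [c' ck'|th x vt Ox|th x vt Ox].
  + exact: tP.
  + exact: sP.
  + exact: P_init (OmcOm Ox).
- by move=> th x vt Ox; exact: sG.
- by move=> th x vt Ox; apply: smoothM; exact: sP.
- move=> th x c vt Ox c2; apply: (@derive1nM_eq0 _ (pe th) 1 1) => //.
  + exact: v_eps.
  + by apply: sP => //; lia.
  + by apply: sP => //; lia.
  + by move=> c' c1; exact: zP.
  + by move=> c' c1; exact: zP.
Qed.

Let tame_T3 i j : tm (fun th x =>
  (fun t => gcomp [:: Some j] th x t * (uhess i j th x t * ugrad i th x t))^[k] 0).
Proof.
(* Hessian times gradient vanishes to order 3: the words have size at most (k - 3) + 1, hence are
   good even without [None]. *)
apply: (@tame_high (gcomp [:: Some j]) (fun th x t => uhess i j th x t * ugrad i th x t) 3).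
- move=> c ck; apply: tG => //; first by lia.
  by move=> w' sw; rewrite /good size_cat /=; apply/orP; left; lia.
- move=> c ck; apply: (@tame_PQ (uhess i j)) => // [c' ck'|th x vt Ox|th x vt Ox].
  + exact: tP2.
  + exact: sP2.
  + exact: partial2_init.
- by move=> th x vt Ox; exact: sG.
- by move=> th x vt Ox; apply: smoothM; [exact: sP2 | exact: sP].
- move=> th x c vt Ox c2; apply: (@derive1nM_eq0 _ (pe th) 2 1) => //.
  + exact: v_eps.
  + by apply: sP2 => //; lia.
  + by apply: sP => //; lia.
  + by move=> c' c1; exact: zP2.
  + by move=> c' c1; exact: zP.
Qed.

(** The term in which gamma is not differentiated carries the unknown w_k and is subtracted. In the
    others the Hessian needs at least two derivatives, which leaves at most k - 2 for gamma. *)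
Let tame_T1 i : tm (fun th x => (fun t => gcomp [::] th x t * uhess i i th x t)^[k] 0
  - pg th (pla th, 0) * (uhess i i th x)^[k] 0).
Proof.
have H : tm (fun th x => \sum_(c < k) 'C(k, c.+1)%:R *
    ((gcomp [::] th x)^[c.+1] 0 * (uhess i i th x)^[k - c.+1] 0)).
  apply: tame_sum => c _; have ck := ltn_ord c.
  apply: tameZ; first exact: lip_cst.
  have [c2|c2] := leqP (c.+1 + 2) k.
    apply: tameM; last by apply: tP2; lia.
    apply: tG => //; first by lia.
    by move=> w' sw; rewrite cats0 /good; apply/orP; left; lia.
  by apply: tame_eq0 => th x vt Ox; rewrite zP2 ?mulr0 //; lia.
apply: (eq_tame _ H) => th x vt Ox.
have s1 := sG (w := [::]) isT (leqnn k) vt Ox.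
have s2 := @sP2 i i th x k (leqnn k) vt Ox.
rewrite (derive1nM s1 s2 (leqnn k) (valid_eps vt)) big_ord_recl /=.
rewrite bin0 mul1r subn0 {1}/gcomp /= (upoint_init vt (OmcOm Ox)) addrAC subrr add0r.
by apply: eq_bigr => c _; rewrite /bump /= add1n.
Qed.

Lemma etame_step : etame k.-1 (W k).
Proof.
pose q th x := \sum_i ((fun t => gcomp [::] th x t * uhess i i th x t)^[k] 0
    - pg th (pla th, 0) * (uhess i i th x)^[k] 0)
  + (\sum_i (fun t => gcomp [:: None] th x t * (ugrad i th x t * ugrad i th x t))^[k] 0
  + \sum_i \sum_j
      (fun t => gcomp [:: Some j] th x t * (uhess i j th x t * ugrad i th x t))^[k] 0).
have tq : tm q.
  apply: tameD; first by apply: tame_sum => i _; exact: tame_T1.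
  apply: tameD; first by apply: tame_sum => i _; exact: tame_T2.
  by apply: tame_sum => i _; apply: tame_sum => j _; exact: tame_T3.
(* gamma(lambda,0) is the empty word, good at level k - 1 because k > 1. *)
have lg : lipN k.-1 (fun th => - 1 * (pg th (pla th, 0))^-1).
  apply: lipM; first exact: lip_cst.
  apply: (lipV k0_gt0); first by move=> th vt; exact: v_ell.
  by apply: (@lip_word _ [::]) => //; rewrite /good /=; apply/orP; left; lia.
have [I [f [c [lc E]]]] := tameZ lg tq.
have Eq th x : valid th -> Om x ->
    laplace (pw th k 0) x = \sum_l c l th * f l x.
  move=> vt Ox; rewrite -E //.
  have g0 : pg th (pla th, 0) != 0.
    by rewrite gt_eqF // (lt_le_trans k0_gt0) // (v_ell vt).
  have kl : (0 < k <= ell)%N by rewrite k_le andbT; lia.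
  have := derive1n_pde_lhs vt Ox kl; rewrite derive1n_pde_lhsE // => Z.
  have -> : q th x = - (pg th (pla th, 0) * laplace (pw th k 0) x).
    apply/eqP; rewrite -subr_eq0 opprK; apply/eqP; apply: etrans Z; rewrite /q sumrB.
    have -> : \sum_i pg th (pla th, 0) * (uhess i i th x)^[k] 0 =
        pg th (pla th, 0) * laplace (pw th k 0) x.
      by rewrite /laplace mulr_sumr; apply: eq_bigr => i _; rewrite derive1n_P2.
    by rewrite addrAC subrK.
  by rewrite mulNr mul1r mulrNN mulKf.
have [m [phi [Q [rphi HQ]]]] := dirichlet_basis n_gt0 Oo Ob f.
exists 'I_m, phi, (fun l th => \sum_i c i th * Q i l); split=> //.
  by move=> l; apply: lip_sum => i; exact: lipM (lip_cst _ _ _).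
move=> th x vt cx; apply: HQ => //.
- exact: regular_pw.
- move=> y By; rewrite derive1n_pw //.
  by case: (k) k_gt1 => [|[|]].
- by move=> y Oy; exact: Eq.
Qed.

End Step.

Lemma etame_all k : (0 < k <= ell)%N -> etame k.-1 (W k).
Proof.
elim/ltn_ind: k => k IH /andP[k_gt0 kl].
have [k1|k1] := leqP k 1%N.
  have -> : k = 1%N by lia.
  by apply: etame_first; lia.
apply: etame_step => // c /andP[c0 ck].
by apply: (@etame_le c.-1); [lia | apply: IH => //; lia].
Qed.


Lemma etame_ge N k : (0 < k)%N -> (k <= N.+1)%N -> (k <= ell)%N -> etame N (W k).
Proof.
move=> k_gt0 kN kl; apply: (@etame_le k.-1); first by lia.
by apply: etame_all; rewrite k_gt0.
Qed.

(* [lead g p om m w] is the m-th derivative at 0 of the word-derivative [w] of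
   [g] along the line p + t (0, om). *)
Fixpoint lead (g : V -> R) (p : V) (om : 'rV[R]_n) (m : nat) w : R :=
  if m is m'.+1 then \sum_i lead g p om m' (Some i :: w) * om 0 i
  else dword w g p.

(** A word of size N fails to be good only if every derivative is taken in eta. This needs all m
    derivatives of the composite to fall on gamma each time, so that only first derivatives w_1, of
    gradient omega, appear: these contributions are exactly [lead]. *)
Lemma tame_lead N m w : (N <= ell)%N -> (size w + m)%N = N ->
  tameN N cOm (fun th x =>
    (gcomp w th x)^[m] 0 - lead (pg th) (pla th, 0) (pom th) m w).
Proof.
move=> Nl; elim: m w => [|m IHm] w sw.
  apply: tame_eq0 => th x vt cx; rewrite derive1n0 /= /gcomp upoint_init //.
  by rewrite subrr.
have tS d (i : nat) : (i <= m)%N -> tameN N cOm (fun th x => ujet x d (pw th (m - i).+1 0)).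
  by move=> im; apply: tame_ujet; [lia | apply: etame_ge; lia].
have tN : tameN N cOm (fun th x => \sum_(i < m.+1) 'C(m, i)%:R *
    ((gcomp (None :: w) th x)^[i] 0 * ujet x None (pw th (m - i).+1 0))).
  apply: tame_sum => i _; have im := ltn_ord i; apply: tameZ; first exact: lip_cst.
  apply: tameM; last by apply: tS; lia.
  apply: tame_gcomp => //; [lia|rewrite /=; lia| |].
    by move=> c /andP[c1 c2]; apply: etame_ge; lia.
  move=> w' sw'; rewrite /good size_cat mem_cat inE eqxx orbT andbT /=; apply/orP; right.
  by lia.
have tJ j : tameN N cOm (fun th x => \sum_(i < m) 'C(m, i)%:R *
    ((gcomp (Some j :: w) th x)^[i] 0 * ujet x (Some j) (pw th (m - i).+1 0))).
  apply: tame_sum => i _; have im := ltn_ord i; apply: tameZ; first exact: lip_cst.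
  apply: tameM; last by apply: tS; lia.
  apply: tame_gcomp => //; [lia|rewrite /=; lia| |].
    by move=> c /andP[c1 c2]; apply: etame_ge; lia.
  by move=> w' sw'; rewrite /good size_cat /=; apply/orP; left; lia.
have tL j : tameN N cOm (fun th x => pom th 0 j *
    ((gcomp (Some j :: w) th x)^[m] 0 - lead (pg th) (pla th, 0) (pom th) m (Some j :: w))).
  by apply: tameZ; [exact: lip_om | apply: IHm; rewrite /=; lia].
have tA : tameN N cOm (fun th x => \sum_j ((\sum_(i < m) 'C(m, i)%:R *
    ((gcomp (Some j :: w) th x)^[i] 0 * ujet x (Some j) (pw th (m - i).+1 0))) +
    pom th 0 j * ((gcomp (Some j :: w) th x)^[m] 0 -
      lead (pg th) (pla th, 0) (pom th) m (Some j :: w)))).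
  by apply: tame_sum => j _; apply: tameD; [exact: tJ | exact: tL].
apply: (eq_tame _ (tameD tN tA)) => th x vt cx.
rewrite derive1nS_gcomp //; [|lia|lia].
rewrite big_option -addrA; congr (_ + _).
rewrite [lead _ _ _ _ _]/= -sumrB; apply: eq_bigr => j _.
rewrite big_ord_recr /= binn mul1r subnn trace_first //; last by lia.
by ring.
Qed.

Definition fluxp (nu : 'rV[R]_n) th x t : R :=
  \sum_i nu 0 i * (gcomp [::] th x t * ugrad i th x t).

Lemma smooth_flux_term i th x : valid th -> cOm x ->
  smooth (pe th) ell (fun t => gcomp [::] th x t * ugrad i th x t).
Proof.
by move=> vt cx; apply: smoothM; [exact: smooth_gcomp | exact: smooth_P].
Qed.

Lemma smooth_fluxp nu th x : valid th -> cOm x -> smooth (pe th) ell (fluxp nu th x).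
Proof.
by move=> vt cx; apply: smooth_sum => i; apply: smoothZ; exact: smooth_flux_term.
Qed.

(** In the Leibniz formula for gamma times the gradient, the term with N+1 derivatives on gamma
    vanishes with the gradient. The term with N of them gives the binomial factor N+1, omega and the
    leading form. In all others gamma has words of size below N, and w_{N+1} itself is expressed at
    level N. *)
Lemma flux_expansion N nu x : (N < ell)%N -> cOm x ->
  lipN N (fun th => (fluxp nu th x)^[N.+1] 0
    - N.+1%:R * (lead (pg th) (pla th, 0) (pom th) N [::] * dot (pom th) nu)).
Proof.
move=> Nl cx0.
have tA i : tameN N cOm (fun th x => \sum_(a < N) 'C(N.+1, a)%:R *
    ((gcomp [::] th x)^[a] 0 * ujet x (Some i) (pw th (N.+1 - a) 0))).
  apply: tame_sum => a _; have aN := ltn_ord a; apply: tameZ; first exact: lip_cst.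
  apply: tameM; last by apply: tame_ujet; [lia | apply: etame_ge; lia].
  apply: tame_gcomp => //; [lia|rewrite /=; lia| |].
    by move=> c /andP[c1 c2]; apply: etame_ge; lia.
  by move=> w' sw'; rewrite cats0 /good; apply/orP; left; lia.
have tB i : tameN N cOm (fun th x => pom th 0 i *
   ((gcomp [::] th x)^[N] 0 - lead (pg th) (pla th, 0) (pom th) N [::])).
  by apply: tameZ; [exact: lip_om | apply: tame_lead; [exact: ltnW | rewrite add0n]].
have tC : tameN N cOm (fun th x => \sum_i nu 0 i *
   ((\sum_(a < N) 'C(N.+1, a)%:R *
    ((gcomp [::] th x)^[a] 0 * ujet x (Some i) (pw th (N.+1 - a) 0))) +
    N.+1%:R * (pom th 0 i *
   ((gcomp [::] th x)^[N] 0 - lead (pg th) (pla th, 0) (pom th) N [::])))).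
  apply: tame_sum => i _; apply: tameZ; first exact: lip_cst.
  by apply: tameD => //; apply: tameZ => //; exact: lip_cst.
apply: (eq_lip _ (lip_tame cx0 tC)) => th vt.
have sT i : smooth (pe th) N.+1 (fun t => gcomp [::] th x t * ugrad i th x t).
  exact: smooth_le Nl (@smooth_flux_term i th x vt cx0).
rewrite (derive1n_sum _ (fun i => smoothZ (sT i)) (leqnn _) (valid_eps vt)).
rewrite /dot !mulr_sumr -sumrB; apply: eq_bigr => i _.
rewrite (derive1nZ _ (sT i) (leqnn _) (valid_eps vt)).
rewrite (derive1nM (smooth_le Nl (smooth_gcomp vt cx0 (w := [::]) isT))
  (smooth_le Nl (@smooth_P i th x vt cx0)) (leqnn _) (valid_eps vt)).
rewrite big_ord_recr /= subnn derive1n0 P_init // !mulr0 addr0.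
have l0 : (0 < ell)%N by lia.
rewrite big_ord_recr /= subSnn (@derive1n_P i th x 1) // trace_first // binSn.
rewrite (eq_bigr (fun a : 'I_N => 'C(N.+1, a)%:R *
    ((gcomp [::] th x)^[a] 0 * ujet x (Some i) (pw th (N.+1 - a) 0)))).
  by ring.
by move=> a _; rewrite derive1n_P //; lia.
Qed.

End Family.

(** * Polarization *)

Section Polarization.
Context {R : realType} {n N : nat}.
Variable c : N.-tuple 'I_n -> R.
Hypothesis c_sym : forall s t : N.-tuple 'I_n, perm_eq s t -> c s = c t.

Definition form (v : 'rV[R]_n) : R :=
  \sum_(t : N.-tuple 'I_n) c t * \prod_(i < N) v 0 (tnth t i).

Variables (v0 : 'rV[R]_n) (h : R) (t0 : N.-tuple 'I_n).

(** The centre [v0] will be nu(x0): for small [h] all these vectors keep a positive scalar product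
    with it, so that the flux determines the form at each of them. *)
Definition shifted (S : {set 'I_N}) : 'rV[R]_n :=
  v0 + \sum_(j in S) h *: evec R (tnth t0 j).

Let b (o : option 'I_N) (k : 'I_n) : R :=
  if o is Some j then h * (tnth t0 j == k)%:R else v0 0 k.

Let inS (S : {set 'I_N}) (o : option 'I_N) : bool := if o is Some j then j \in S else true.

Let shiftedE S k : shifted S 0 k = \sum_(o : option 'I_N) (inS S o)%:R * b o k.
Proof.
rewrite big_option /= mul1r mxE; congr (_ + _).
rewrite summxE big_mkcond /=; apply: eq_bigr => j _.
by case: (j \in S); rewrite ?mul1r ?mul0r // !mxE eqxx eq_sym.
Qed.

Let covered (f : {ffun 'I_N -> option 'I_N}) (j : 'I_N) := [exists i, f i == Some j].

(** The sum over S factors as a product over j. An index j that [f] misses may be put in S or left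
    out, with opposite signs; if none is missed, only the full set contributes. *)
Let sign_sum (f : {ffun 'I_N -> option 'I_N}) :
  \sum_(S : {set 'I_N}) (- 1) ^+ #|S| * \prod_(i < N) (inS S (f i))%:R =
  if [forall j, covered f j] then (- 1) ^+ N else 0 :> R.
Proof.
pose F (j : 'I_N) : R := - 1.
pose G (j : 'I_N) : R := (~~ covered f j)%:R.
transitivity (\prod_j (F j + G j)).
  rewrite bigA_distr; apply: eq_bigr => S _.
  have -> : \prod_i (if i \in S then F i else G i) =
     \prod_(i in S) F i * \prod_(i | i \notin S) G i.
    rewrite (bigID (mem S)) /=; congr (_ * _); apply: eq_bigr => i.
      by move=> ->.
    by move=> /negbTE ->.
  rewrite prodr_const; congr (_ * _).
  have [/forallP H|/forallPn[i iS]] := boolP [forall i, inS S (f i)].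
    rewrite !big1 // => i.
      move=> iS; have nc : ~~ covered f i.
        by apply/existsPn => k; apply/eqP => fk; have := H k; rewrite fk /= (negbTE iS).
      by rewrite /G nc.
    by move=> _; rewrite H.
  rewrite (bigD1 i) //= (negbTE iS) mul0r.
  case fi : (f i) iS => [j|] //= jS.
  rewrite (bigD1 j) //= /G.
  have -> : covered f j by apply/existsP; exists i; rewrite fi.
  by rewrite mul0r.
have [/forallP H|/forallPn[j jf]] := boolP [forall j, covered f j].
  rewrite (eq_bigr (fun _ => - 1)) => [|j _]; first by rewrite prodr_const card_ord.
  by rewrite /F /G H addr0.
by rewrite (bigD1 j) //= /F /G jf addNr mul0r.
Qed.

(** N arguments cover N values, so nothing is left over for [None] or for a repetition. *)
Let covered_perm (f : {ffun 'I_N -> option 'I_N}) : [forall j, covered f j] ->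
  exists s : 'S_N, forall i, f i = Some (s i).
Proof.
move=> /forallP cf.
pose r j := odflt j [pick i | f i == Some j].
have rP j : f (r j) = Some j.
  rewrite /r; case: pickP => [i /eqP //|H].
  by have /existsP[i] := cf j; rewrite H.
have ri : injective r by move=> j j' e; apply: Some_inj; rewrite -!rP e.
exists (perm ri)^-1%g => i; rewrite -rP; congr (f _).
by rewrite -(permE ri) permKV.
Qed.

(** Only the tuple [t0] rearranged by the permutation survives the Kronecker symbols, and symmetry
    of [c] brings it back to [t0]. *)
Let covered_sum (f : {ffun 'I_N -> option 'I_N}) : [forall j, covered f j] ->
  \sum_(t : N.-tuple 'I_n) c t * \prod_(i < N) b (f i) (tnth t i) = h ^+ N * c t0.
Proof.
move=> /covered_perm[s fs].
pose t1 := [tuple tnth t0 (s i) | i < N].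
have -> : c t0 = c t1.
  by apply: c_sym; rewrite perm_sym; apply/tuple_permP; exists s.
rewrite (bigD1 t1) //= [X in _ + X]big1 ?addr0.
  rewrite mulrC; congr (_ * _); rewrite -[N in RHS]card_ord -prodr_const.
  by apply: eq_bigr => i _; rewrite fs /b tnth_mktuple eqxx mulr1.
move=> t tt1; have [i ti] : exists i, tnth t i != tnth t1 i.
  apply/existsP; apply: contraNT tt1 => /existsPn H; apply/eqP/eq_from_tnth => i.
  by apply/eqP; have := H i; rewrite negbK.
rewrite (bigD1 i) //= fs /b; move: ti; rewrite tnth_mktuple eq_sym => /negbTE ->.
by rewrite mulr0 mul0r mulr0.
Qed.

(* Polarization: summing over the subsets with signs kills every term in which
   some of the shifts is not used. *)
Lemma polarization : exists2 Q : nat, (0 < Q)%N &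
  \sum_(S : {set 'I_N}) (- 1) ^+ #|S| * form (shifted S) =
    (- 1) ^+ N * (Q%:R * (h ^+ N * c t0)).
Proof.
(* The number of covering maps, that is N!. For the bound only Q >= 1 matters. *)
exists #|[pred f : {ffun 'I_N -> option 'I_N} | [forall j, covered f j]]|.
  apply/card_gt0P; exists [ffun i => Some i]; rewrite inE; apply/forallP => j.
  by apply/existsP; exists j; rewrite ffunE.
have E S : form (shifted S) = \sum_(f : {ffun 'I_N -> option 'I_N})
   (\prod_(i < N) (inS S (f i))%:R) *
     \sum_(t : N.-tuple 'I_n) c t * \prod_(i < N) b (f i) (tnth t i).
  rewrite /form; under [RHS]eq_bigr do rewrite mulr_sumr.
  rewrite exchange_big /=; apply: eq_bigr => t _.
  under [in LHS]eq_bigr do rewrite shiftedE.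
  rewrite bigA_distr_bigA /= mulr_sumr; apply: eq_bigr => f _.
  by rewrite big_split /= mulrCA.
under eq_bigr do rewrite E mulr_sumr.
rewrite exchange_big /=.
transitivity (\sum_(f : {ffun 'I_N -> option 'I_N} | [forall j, covered f j])
   (- 1) ^+ N * (h ^+ N * c t0)).
  rewrite [RHS]big_mkcond /=; apply: eq_bigr => f _.
  under eq_bigr do rewrite mulrA.
  rewrite -mulr_suml sign_sum; case: ifP => cf; last by rewrite mul0r.
  by rewrite covered_sum.
by rewrite (sumr_const [pred f | [forall j, covered f j]]) -mulrnAr mulr_natl.
Qed.

Lemma polarization_bound : h != 0 ->
  `|c t0| <= `|h ^+ N|^-1 * \sum_(S : {set 'I_N}) `|form (shifted S)|.
Proof.
move=> h0; have [Q Q0 E] := polarization.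
have hN : 0 < `|h ^+ N| by rewrite normr_gt0 expf_neq0.
rewrite ler_pdivlMl // -normrM.
apply: (@le_trans _ _ `|Q%:R * (h ^+ N * c t0)|).
  by rewrite [X in _ <= X]normrM ler_peMl // ger0_norm ?ler1n.
have -> : `|Q%:R * (h ^+ N * c t0)| = `|(- 1) ^+ N * (Q%:R * (h ^+ N * c t0))|.
  by rewrite [RHS]normrM normrX normrN1 expr1n mul1r.
rewrite -E; apply: le_trans (ler_norm_sum _ _ _) _.
by apply: ler_sum => S _; rewrite normrM normrX normrN1 expr1n mul1r.
Qed.

End Polarization.

Lemma big_tuple_cons {R : realType} {n m : nat} (F : m.+1.-tuple 'I_n -> R) :
  \sum_(t : m.+1.-tuple 'I_n) F t =
  \sum_i \sum_(t : m.-tuple 'I_n) F [tuple of i :: t].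
Proof.
rewrite pair_big /= (reindex (fun p : 'I_n * m.-tuple 'I_n => [tuple of p.1 :: p.2])) //=.
exists (fun t => (thead t, [tuple of behead t])) => [[i t] _|t _] /=.
  by congr pair; apply: val_inj.
by rewrite -tuple_eta.
Qed.

(** [lead] puts each new letter in front of the word, so the tuple comes out reversed; [lead_form]
    restores the order by symmetry of the derivatives. *)
Lemma lead_sum {R : realType} {n : nat} (g : (R * 'rV[R]_n)%type -> R) p om m w :
  lead g p om m w = \sum_(t : m.-tuple 'I_n)
    dword (catrev (map Some t) w) g p * \prod_(i < m) om 0 (tnth t i).
Proof.
elim: m w => [|m IH] w /=.
  rewrite (big_pred1 [tuple]) => [|t] /=; first by rewrite big_ord0 mulr1.
  by rewrite tuple0; apply/esym/eqP.
rewrite big_tuple_cons; apply: eq_bigr => i _; rewrite IH mulr_suml.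
apply: eq_bigr => t _ /=; rewrite big_ord_recl -mulrA; congr (_ * _).
rewrite mulrC tnth0; congr (_ * _); apply: eq_bigr => j _.
by rewrite tnthS.
Qed.

Lemma lead_form {R : realType} {n : nat} (g : (R * 'rV[R]_n)%type -> R) p om m :
  Ck m setT g ->
  lead g p om m [::] = form (fun t : m.-tuple 'I_n => dword (map Some t) g p) om.
Proof.
move=> Cg; rewrite lead_sum; apply: eq_bigr => t _; congr (_ * _).
rewrite catrevE cats0 (@dword_perm _ _ _ (map Some t)) //.
  by rewrite size_rev size_map size_tuple.
by rewrite perm_rev.
Qed.

(** * Normals, expansion of the equation and bounds on the jets *)

Section Euclid.
Context {R : realType} {n : nat}.
Implicit Types (x y e : 'rV[R]_n).

Lemma is_derive_of_line (V W : normedModType R) (f : V -> W) (x v : V) (df : W) :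
  is_derive (0 : R) (1 : R) (fun s : R => f (x + s *: v)) df -> is_derive x v f df.
Proof.
have E : (fun h : R => h^-1 *: (((fun s : R => f (x + s *: v)) \o shift 0) (h *: 1)
              - f (x + 0 *: v))) =
         (fun h : R => h^-1 *: ((f \o shift x) (h *: v) - f x)).
  apply/funext => h /=; rewrite scale0r addr0 [h *: 1]mulr1 addr0.
  by rewrite [h *: v + x]addrC.
by case=> d1 d2; apply: DeriveDef; move: d1 d2; rewrite /derivable /derive E.
Qed.

Lemma dotZl (a : R) x y : dot (a *: x) y = a * dot x y.
Proof. by rewrite /dot mulr_sumr; apply: eq_bigr => i _; rewrite mxE mulrA. Qed.

Lemma dotZr (a : R) x y : dot x (a *: y) = a * dot x y.
Proof. by rewrite /dot mulr_sumr; apply: eq_bigr => i _; rewrite mxE mulrCA. Qed.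

Lemma dotDl x y e : dot (x + y) e = dot x e + dot y e.
Proof. by rewrite /dot -big_split; apply: eq_bigr => i _; rewrite mxE mulrDl. Qed.

Lemma dot_ge0 x : 0 <= dot x x.
Proof. by apply: sumr_ge0 => i _; rewrite -expr2 sqr_ge0. Qed.

Lemma dot_gt0 x y : dot x y != 0 -> 0 < dot x x.
Proof.
move=> xy; rewrite lt_def dot_ge0 andbT; apply: contra_neq xy => x0.
rewrite /dot big1 // => i _.
have : \sum_(i < n) x 0 i * x 0 i == 0 by apply/eqP.
rewrite psumr_eq0 => [/allP /(_ i (mem_index_enum _))|j _]; last by rewrite -expr2 sqr_ge0.
by rewrite mulf_eq0 orbb => /eqP ->; rewrite mul0r.
Qed.

Lemma dot_evec i x : dot (evec R i) x = x 0 i.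
Proof.
rewrite /dot (bigD1 i) //= mxE !eqxx mul1r big1 ?addr0 // => j ji.
by rewrite mxE eqxx /= (negbTE ji) mul0r.
Qed.

Lemma enorm_eq1 x : enorm x = 1 -> dot x x = 1.
Proof.
by move=> e1; rewrite -(sqr_sqrtr (dot_ge0 x)) -/(enorm x) e1 expr1n.
Qed.

Lemma dot_normalized x y : dot x y != 0 ->
  dot ((enorm x)^-1 *: x) ((enorm x)^-1 *: x) = 1.
Proof.
move=> /dot_gt0 x0; rewrite dotZl dotZr mulrA -invfM -expr2.
by rewrite sqr_sqrtr ?ltW // mulVf // gt_eqF.
Qed.

(** Normalization gives a unit vector only if the gradient is nonzero. Its component along [e] is 1:
    y.e has slope 1 in that direction, while the projection at which [phi] is evaluated does not
    move. *)
Lemma dot_normal (Om : set 'rV[R]_n) x nu : outward_unit_normal Om x nu -> dot nu nu = 1.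
Proof.
move=> [r [e [phi [[_ e1 _] Cphi ->]]]].
have ee := enorm_eq1 e1.
set F := fun y => _.
pose q := x - dot x e *: e.
pose a j := 'D_(evec R j) phi q.
have dF i : is_derive x (evec R i) F (e 0 i - \sum_j a j * ((i == j)%:R - e 0 i * e 0 j)).
  apply: is_derive_of_line.
  have Fs s : F (x + s *: evec R i) = (dot x e + s * e 0 i) -
     phi (q + \sum_j (s * ((i == j)%:R - e 0 i * e 0 j)) *: evec R j).
    rewrite /F dotDl dotZl dot_evec; congr (_ - phi _).
    apply/rowP => k; rewrite !mxE summxE (bigD1 k) //= big1 ?addr0 => [|j jk].
      by rewrite !mxE !eqxx mulr1 /= [k == i]eq_sym; ring.
    by rewrite !mxE eqxx /= [k == j]eq_sym (negbTE jk) mulr0.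
  have := @chain_rule R _ phi q _ (index_enum 'I_n) (fun j => evec R j)
    (fun j s => s * ((i == j)%:R - e 0 i * e 0 j)) (fun j => (i == j)%:R - e 0 i * e 0 j) 0.
  have q0 : q + \sum_j (0 * ((i == j)%:R - e 0 i * e 0 j)) *: evec R j = q.
    by rewrite big1 ?addr0 // => j _; rewrite mul0r scale0r.
  have lin (k : R) : is_derive (0 : R) (1 : R) (fun s => s * k) k.
    apply: is_derive_eq (is_deriveM (is_derive_id (0 : R) 1) (is_derive_cst k (0 : R) 1)) _.
    by rewrite /GRing.scale /=; ring.
  rewrite q0 => H.
  have {}H := H (fun j y => (Cphi.2 (evec R j)).1 y I)
    (fun j y => (Cphi.2 (evec R j)).2.1 y I) (fun j => lin _).
  have D := is_deriveB (is_deriveD (is_derive_cst (dot x e) (0 : R) 1) (lin (e 0 i))) H.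
  rewrite add0r in D.
  have -> : (fun s : R => F (x + s *: evec R i)) = (fun s => (dot x e + s * e 0 i) -
     phi (q + \sum_j (s * ((i == j)%:R - e 0 i * e 0 j)) *: evec R j)).
    by apply/funext => s; rewrite Fs.
  exact: D.
apply: (@dot_normalized _ e).
suff -> : dot (grad F x) e = 1 by rewrite oner_neq0.
have gE i : grad F x 0 i = e 0 i - \sum_j a j * ((i == j)%:R - e 0 i * e 0 j).
  by rewrite mxE /partial; case: (dF i).
rewrite /dot; under eq_bigr do rewrite gE mulrBl mulr_suml.
rewrite sumrB exchange_big /= -/(dot e e) ee big1 ?subr0 // => j _.
under eq_bigr do rewrite -mulrA; rewrite -mulr_sumr.
have -> : \sum_i ((i == j)%:R - e 0 i * e 0 j) * e 0 i = 0; last by rewrite mulr0.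
under eq_bigr do rewrite mulrBl; rewrite sumrB (bigD1 j) //= eqxx mul1r.
rewrite big1 ?addr0 => [|i ij]; last by rewrite (negbTE ij) mul0r.
under eq_bigr do rewrite mulrAC; rewrite -mulr_suml -/(dot e e) ee.
by rewrite mul1r subrr.
Qed.

End Euclid.

Section Expansion.
Context {R : realType} {n : nat}.
Local Notation V := (R * 'rV[R]_n)%type.
Variables (Om : set 'rV[R]_n) (g : V -> R) (u : 'rV[R]_n -> R).
Hypotheses (Cg : Ck 1 setT g) (ru : regular Om u) (Oo : open Om).

Let jet y d : R := if d is Some j then partial j u y else u y.

Let jetE y : \sum_d jet y d *: dvec d = (u y, grad u y) :> V.
Proof. by rewrite dvec_sum; congr pair; apply/rowP => i; rewrite !mxE. Qed.

Lemma is_derive_gradient_flow x i : Om x ->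
  is_derive x (evec R i) (fun y => g (u y, grad u y) * partial i u y)
    (g (u x, grad u x) * partial i (partial i u) x +
     (dword [:: None] g (u x, grad u x) * partial i u x +
      \sum_j dword [:: Some j] g (u x, grad u x) * partial i (partial j u) x) * partial i u x).
Proof.
move=> Ox; have [du d2u _ _ _] := ru.
have dg : is_derive x (evec R i) (fun y => g (u y, grad u y))
    (dword [:: None] g (u x, grad u x) * partial i u x +
      \sum_j dword [:: Some j] g (u x, grad u x) * partial i (partial j u) x).
  apply: is_derive_of_line.
  pose U d (s : R) := jet (x + s *: evec R i) d.
  pose U' d : R := if d is Some j then partial i (partial j u) x else partial i u x.
  have dU d : is_derive (0 : R) (1 : R) (U d) (U' d).
    case: d => [j|].
      apply: (is_derive_line (f := partial j u)); rewrite scale0r addr0.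
      by apply: derivableP; exact: d2u.
    apply: (is_derive_line (f := u)); rewrite scale0r addr0.
    by apply: derivableP; exact: du.
  have H := @chain_rule R V g 0 _ (index_enum (option 'I_n)) dvec U U' 0
    (fun d y => (Cg.2 (dvec d)).1 y I) (fun d y => (Cg.2 (dvec d)).2.1 y I) dU.
  rewrite add0r in H.
  have E0 : \sum_d U d 0 *: dvec d = (u x, grad u x).
    by rewrite -jetE; apply: eq_bigr => d _; rewrite /U scale0r addr0.
  rewrite E0 big_option in H.
  have -> : (fun s : R => g (u (x + s *: evec R i), grad u (x + s *: evec R i))) =
    (fun s => g (0 + \sum_d U d s *: dvec d)).
    by apply/funext => s; rewrite add0r -jetE.
  exact: H.
have := is_deriveM dg (derivableP (d2u x Ox i i)).
by move/is_derive_eq; apply; rewrite /GRing.scale /=; congr (_ + _); rewrite mulrC.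
Qed.

Lemma divergence_expanded (a : coef R n) x : (forall p, a p = (g p)%:M) -> Om x ->
  \sum_(i < n) partial i (fun y => \sum_(k < n) a (u y, grad u y) i k * partial k u y) x =
  g (u x, grad u x) * laplace u x +
  (\sum_i dword [:: None] g (u x, grad u x) * (partial i u x * partial i u x) +
   \sum_i \sum_j dword [:: Some j] g (u x, grad u x) *
     (partial i (partial j u) x * partial i u x)).
Proof.
move=> ag Ox; rewrite /laplace mulr_sumr -!big_split /=; apply: eq_bigr => i _.
have -> : (fun y => \sum_(k < n) a (u y, grad u y) i k * partial k u y) =
    (fun y => g (u y, grad u y) * partial i u y).
  apply/funext => y; rewrite (bigD1 i) //= ag mxE eqxx mulr1n big1 ?addr0 // => k ki.
  by rewrite mxE eq_sym (negbTE ki) mulr0n mul0r.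
rewrite [LHS](@derive_val _ _ _ _ _ _ _ (is_derive_gradient_flow i Ox)).
congr (_ + _); rewrite mulrDl mulr_suml; congr (_ + _); first by rewrite mulrA.
by apply: eq_bigr => j _; rewrite mulrA.
Qed.

End Expansion.

Section WordBound.
Context {R : realType} {n : nat}.
Local Notation V := (R * 'rV[R]_n)%type.
Implicit Types w : seq (option 'I_n).

Lemma derive_scalar_mx (g : V -> R) (v p : V) : derivable g p v ->
  'D_v (fun q => (g q)%:M : 'M[R]_n) p = ('D_v g p)%:M.
Proof.
move=> dg.
have dij (i j : 'I_n) : is_derive p v (fun q => ((g q)%:M : 'M[R]_n) i j) ('D_v g p *+ (i == j)).
  under eq_fun do rewrite mxE.
  have [ij|ij] := eqVneq i j; last exact: is_derive_cst.
  by under eq_fun do rewrite mulr1n; exact: derivableP.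
rewrite derive_mx; last by apply/derivable_mxP => i j; case: (dij i j).
by apply/matrixP => i j; rewrite !mxE; case: (dij i j).
Qed.

Lemma dword_scalar_mx w (g : V -> R) : Ck (size w) setT g ->
  dword w (fun q => (g q)%:M : 'M[R]_n) = fun q => (dword w g q)%:M.
Proof.
elim: w => [//|d w IH] Cg; apply/funext => p.
rewrite [LHS]/= IH; last exact: (Ck_prev Cg).
apply: derive_scalar_mx; have := Cg; rewrite -[size (d :: w)]/(size w).+1 -[(size w).+1]addn1.
by move=> /Ck_dword [_ H]; exact: (H _).1.
Qed.

Definition mixed_word (k : nat) (beta : 'I_n -> nat) : seq (option 'I_n) :=
  nseq k None ++ flatten [seq nseq (beta i) (Some i) | i <- enum 'I_n].

Lemma iter_dword (W : normedModType R) k d w (g : V -> W) :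
  iter k (fun f => 'D_(dvec d) f) (dword w g) = dword (nseq k d ++ w) g.
Proof. by elim: k => //= k ->. Qed.

Lemma d_mu_eta_dword (W : normedModType R) k beta (g : V -> W) :
  d_mu_eta k beta g = dword (mixed_word k beta) g.
Proof.
rewrite /d_mu_eta /mixed_word.
have -> : foldr (fun i f => iter (beta i) (@d_eta R n W i) f) g (enum 'I_n) =
    dword (flatten [seq nseq (beta i) (Some i) | i <- enum 'I_n]) g.
  elim: (enum 'I_n) => //= i s ->.
  exact: (iter_dword (beta i) (Some i)).
exact: (iter_dword k None).
Qed.

Lemma size_mixed_word k beta : size (mixed_word k beta) = (k + \sum_i beta i)%N.
Proof.
rewrite /mixed_word size_cat size_nseq size_flatten /shape -map_comp.
congr (_ + _)%N; rewrite sumnE big_map big_enum /=.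
by apply: eq_bigr => i _; rewrite size_nseq.
Qed.

Lemma perm_mixed_word w :
  perm_eq w (mixed_word (count_mem None w) (fun i => count_mem (Some i) w)).
Proof.
apply/allP => d _ /=; apply/eqP; rewrite /mixed_word count_cat count_flatten -map_comp.
rewrite sumnE big_map big_enum /= count_nseq.
case: d => [i|] /=.
  rewrite mul0n add0n (bigD1 i) //= count_nseq /= eqxx mul1n big1 ?addn0 // => j ji.
  by rewrite count_nseq /= (_ : (Some j == Some i) = false) ?mul0n //; apply/negbTE.
by rewrite mul1n big1 ?addn0 // => j _; rewrite count_nseq.
Qed.

Lemma is_norm_ge0 (V0 : lmodType R) (p : V0 -> R) : is_norm p -> forall x, 0 <= p x.
Proof.
move=> [pD pZ _] x; have := pD x (- 1 *: x).
rewrite scaleN1r subrr -(scale0r x) pZ normr0 mul0r -scaleN1r pZ normrN1 mul1r => H.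
by rewrite -(pmulrn_lge0 _ (isT : (0 < 2)%N)) mulr2n.
Qed.

(** The word is reordered into the normal form of [d_mu_eta]. The derivative of the matrix
    coefficient is then a scalar multiple of the identity, whose norm is divided out. *)
Lemma word_bound (m : nat) (mnorm : 'M[R]_n -> R) (B : R) (g : V -> R) (a : coef R n) mu :
  (0 < n)%N -> is_norm mnorm -> Ck m setT g -> (forall p, a p = (g p)%:M) ->
  (forall k beta, (k + \sum_i beta i <= m)%N ->
     mnorm (d_mu_eta k beta a (mu, 0)) <= B) ->
  forall w, (size w <= m)%N -> `|dword w g (mu, 0)| <= B / mnorm 1%:M.
Proof.
move=> n0 nm Cg ag ab w sw; have [_ pZ p0] := nm.
have m1 : 0 < mnorm 1%:M.
  rewrite lt_def (is_norm_ge0 nm) andbT; apply/eqP => /p0/matrixP.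
  move/(_ (Ordinal n0) (Ordinal n0)); rewrite !mxE eqxx /= => /eqP.
  by rewrite (oner_eq0 R).
rewrite ler_pdivlMr //.
have aE : a = (fun q => (g q)%:M) by apply/funext.
rewrite aE in ab.
have pw := perm_mixed_word w.
have sz := size_mixed_word (count_mem None w) (fun i => count_mem (Some i) w).
rewrite -(perm_size pw) in sz.
have := ab (count_mem None w) (fun i => count_mem (Some i) w); rewrite -sz => /(_ sw).
have Cw : Ck (size w) setT g by exact: Ck_le Cg.
rewrite d_mu_eta_dword dword_scalar_mx; last by rewrite -(perm_size pw).
by rewrite -(dword_perm Cw pw) -[X in mnorm X <= _ -> _]scalemx1 pZ.
Qed.

End WordBound.

(** * From the fluxes to the jets *)

(** On an interval of length [h] around [x], some point [c] has f'(c) equal to a difference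
    quotient, at most 2 F / h in size; between [c] and [x] the derivative changes by at most K h. *)
Lemma interpolation {R : realType} (f f' f'' : R -> R) (r K F h x : R) :
  0 < h -> h <= r -> (forall t, is_derive t (1 : R) f (f' t)) ->
  (forall t, is_derive t (1 : R) f' (f'' t)) ->
  (forall t, `|t| <= r -> `|f t| <= F) -> (forall t, `|t| <= r -> `|f'' t| <= K) ->
  `|x| <= r -> `|f' x| <= 2 * F / h + K * h.
Proof.
move=> h0 hr df df' fF fK xr.
have mv (g dg : R -> R) a b : (forall t, is_derive t (1 : R) g (dg t)) -> a <= b ->
    exists2 c, a <= c <= b & g b - g a = dg c * (b - a).
  move=> gd ab.
  have gc : continuous g.
    by move=> t; apply: differentiable_continuous; apply/derivable1_diffP; case: (gd t).
  have [c] := MVT_segment ab (fun x _ => gd x) (continuous_subspaceT gc).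
  by rewrite in_itv /=; exists c.
(* The interval extends from [x] towards 0's side: to the right if x <= 0, to the left otherwise. As
   h <= r, it stays in [-r, r]. *)
have [a [ax xh ar arh]] : exists a, [/\ a <= x, x <= a + h, - r <= a & a + h <= r].
  move: xr; rewrite ler_norml => /andP[x1 x2].
  by case: (leP x 0) => x0; [exists x | exists (x - h)]; split; lra.
have inr t : a <= t <= a + h -> `|t| <= r.
  by move=> /andP[t1 t2]; rewrite ler_norml; apply/andP; split; lra.
have aah : a <= a + h by rewrite lerDl ltW.
have [c cab E] := mv f f' a (a + h) df aah.
have Kh : `|f' c - f' x| <= K * h.
  move: cab => /andP[c1 c2]; have [xc|cx] := leP x c.
    have [d /andP[d1 d2] ->] := mv f' f'' x c df' xc.
    rewrite normrM; apply: ler_pM => //.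
      by apply: fK; apply: inr; apply/andP; split; lra.
    by rewrite ger0_norm; lra.
  have [d /andP[d1 d2]] := mv f' f'' c x df' (ltW cx).
  rewrite distrC => ->.
  rewrite normrM; apply: ler_pM => //.
    by apply: fK; apply: inr; apply/andP; split; lra.
  by rewrite ger0_norm; lra.
have Fc : `|f' c| <= 2 * F / h.
  rewrite ler_pdivlMr // -[X in _ * X](gtr0_norm h0) -normrM.
  have -> : f' c * h = f (a + h) - f a by rewrite E addrAC subrr add0r.
  apply: le_trans (ler_normB _ _) _; rewrite mulr2n mulrDl mul1r.
  by apply: lerD; apply: fF; apply: inr; apply/andP; split; lra.
have -> : f' x = f' c - (f' c - f' x) by rewrite opprB addrC subrK.
by apply: le_trans (ler_normB _ _) _; exact: lerD.
Qed.

Section Rates.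
Context {R : realType}.
Variable dd : nat -> R.
Hypothesis dd_ge0 : forall k, 0 <= dd k.

(** The sum on the right of the second estimate. Passing from N to N+1 divides the exponent of each
    old term by 3. *)
Definition rates N : R := \sum_(1 <= k < N.+2) dd k `^ (3 ^+ k / 3 ^+ N.+1).

Lemma rates_ge0 N : 0 <= rates N.
Proof. by apply: sumr_ge0 => k _; exact: powR_ge0. Qed.

Lemma cube_sum (r : seq nat) (a : nat -> R) : (forall k, 0 <= a k) ->
  \sum_(k <- r) a k ^+ 3 <= (\sum_(k <- r) a k) ^+ 3.
Proof.
move=> a0; elim: r => [|k r IH]; first by rewrite !big_nil expr0n.
rewrite !big_cons; set s := \sum_(j <- r) a j in IH *.
have s0 : 0 <= s by apply: sumr_ge0.
have -> : (a k + s) ^+ 3 = a k ^+ 3 + (s ^+ 3 + 3 * (a k * s * (a k + s))) by ring.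
rewrite lerD2l; apply: le_trans IH _; rewrite lerDl.
by rewrite !mulr_ge0 // addr_ge0.
Qed.

(** Each term of order N is the cube of its counterpart of order N+1, and a sum of cubes is at most
    the cube of the sum. This matches the cube root lost in one interpolation. *)
Lemma rates_cube N : rates N <= rates N.+1 ^+ 3.
Proof.
have E : rates N = \sum_(1 <= k < N.+2) (dd k `^ (3 ^+ k / 3 ^+ N.+2)) ^+ 3.
  apply: eq_bigr => k _; rewrite -powR_mulrn ?powR_ge0 // -powRrM.
  by congr (_ `^ _); rewrite [3 ^+ N.+2]exprS; field.
rewrite E; apply: le_trans (cube_sum _ _) _ => [k|]; first exact: powR_ge0.
rewrite lerXn2r ?nnegrE ?rates_ge0 //.
  by apply: sumr_ge0 => k _; exact: powR_ge0.
by rewrite /rates [X in _ <= X]big_nat_recr //= lerDl powR_ge0.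
Qed.

Lemma rates_last N : dd N.+1 <= rates N.
Proof.
rewrite /rates big_nat_recr //= divff ?expf_neq0 // powRr1 //.
by rewrite lerDr; apply: sumr_ge0 => k _; exact: powR_ge0.
Qed.

End Rates.

Section Recovery.
Context {R : realType} {n : nat}.
Local Notation V := (R * 'rV[R]_n)%type.
Variables (ell : nat) (K r : R) (nu : 'rV[R]_n) (CF : nat -> R).
Hypotheses (r_gt0 : 0 < r) (K_ge0 : 0 <= K) (nu1 : dot nu nu = 1).
Hypothesis CF_ge0 : forall N, 0 <= CF N.
Implicit Types (w : seq (option 'I_n)) (g : V -> R) (dd : nat -> R).

Definition wdiff g1 g2 w (la : R) : R := dword w g1 (la, 0) - dword w g2 (la, 0).

(** What the recovery of the jets retains of the boundary value problem. [Phi la om k] stands for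
    the size of the k-th tau-derivative of the difference of fluxes, and [a_main] is the difference
    of two flux expansions. *)
Record admissible g1 g2 (Phi : R -> 'rV[R]_n -> nat -> R) : Prop := Admissible {
  a_smooth1 : Ck (3 + ell) setT g1;
  a_smooth2 : Ck (3 + ell) setT g2;
  a_bound : forall w la, (size w <= 3 + ell)%N -> `|la| <= r -> `|wdiff g1 g2 w la| <= K;
  a_main : forall N, (N < ell)%N -> forall rho la om, 0 <= rho -> `|la| <= r ->
    dot om om = 1 -> (forall w, good N w -> `|wdiff g1 g2 w la| <= rho) ->
    N.+1%:R * `|lead g1 (la, 0) om N [::] - lead g2 (la, 0) om N [::]| * `|dot om nu|
      <= Phi la om N.+1 + CF N * rho }.

(** [C] precedes the coefficients, the fluxes and the bounds [dd], as the order of quantifiers in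
    the theorem demands. *)
Definition controlled N (P : pred (seq (option 'I_n))) : Prop := exists2 C, 0 <= C &
  forall g1 g2 Phi dd, admissible g1 g2 Phi -> (forall k, 0 <= dd k) ->
    (forall k la om, (1 <= k <= N.+1)%N -> `|la| <= r -> dot om om = 1 ->
       Phi la om k <= dd k) ->
    forall w la, P w -> `|la| <= r -> `|wdiff g1 g2 w la| <= C * rates dd N.

Lemma controlled0 : controlled 0 (good 0).
Proof.
exists 0 => // g1 g2 Phi dd _ _ _ w la.
by rewrite /good ltn0 leqn0 size_eq0 /= => /andP[/eqP ->].
Qed.

Section Pure.
Variable N : nat.
Hypothesis N_lt : (N < ell)%N.

Let h : R := N.+1%:R^-1.

Let h_gt0 : 0 < h. Proof. by rewrite invr_gt0 ltr0n. Qed.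

(** Each of the at most N shifts lowers the scalar product with [nu] by at most h = 1/(N+1),
    starting from nu.nu = 1. *)
Lemma shifted_dot (t : N.-tuple 'I_n) S : 0 < dot (shifted nu h t S) nu.
Proof.
have nui i : - 1 <= nu 0 i.
  have : nu 0 i ^+ 2 <= 1.
    rewrite -nu1 /dot (bigD1 i) //= -expr2 lerDl sumr_ge0 // => j _.
    by rewrite -expr2 sqr_ge0.
  by move=> H2; rewrite leNgt; apply/negP => H; nra.
rewrite /shifted dotDl nu1.
have -> : dot (\sum_(j in S) h *: evec R (tnth t j)) nu = \sum_(j in S) h * nu 0 (tnth t j).
  elim/big_ind2 : _ => [|x1 x2 y1 y2 <- <-|j _].
  - by rewrite /dot big1 // => i _; rewrite mxE mul0r.
  - by rewrite dotDl.
  - by rewrite dotZl dot_evec.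
have H : - (h * N%:R) <= \sum_(j in S) h * nu 0 (tnth t j).
  apply: (@le_trans _ _ (\sum_(j in S) (- h))).
    rewrite sumr_const mulNrn -[h *+ _]mulr_natr lerN2 ler_wpM2l ?(ltW h_gt0) // ler_nat.
    by rewrite -[X in (_ <= X)%N]card_ord max_card.
  by apply: ler_sum => j _; rewrite -mulrN1 ler_pM2l.
have : h * N%:R < 1.
  by rewrite /h mulrC ltr_pdivrMr ?ltr0n // mul1r ltr_nat.
lra.
Qed.

Lemma form_homogeneous (c : N.-tuple 'I_n -> R) (a : R) v :
  form c (a *: v) = a ^+ N * form c v.
Proof.
rewrite /form mulr_sumr; apply: eq_bigr => t _; rewrite mulrCA; congr (_ * _).
under eq_bigr do rewrite mxE.
by rewrite big_split /= prodr_const card_ord.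
Qed.

(** Cost of replacing v by the unit vector omega = v / |v|: the factor |v|^N from homogeneity,
    divided by omega.nu. *)
Let A (t : N.-tuple 'I_n) (S : {set 'I_N}) : R :=
  enorm (shifted nu h t S) ^+ N.+1 / dot (shifted nu h t S) nu.

Let A_ge0 t S : 0 <= A t S.
Proof. by rewrite divr_ge0 ?exprn_ge0 ?sqrtr_ge0 // ltW // shifted_dot. Qed.

(** The words of size at most N that are not good are the components of D_eta^N. The good ones being
    controlled, [a_main] bounds the form at the normalized shifted vectors, and polarization returns
    to the components. *)
Lemma controlled_pure : controlled N (good N) -> controlled N (fun w => size w <= N)%N.
Proof.
case=> C1 C10 H1.
pose C2 := (h ^+ N)^-1 * (\sum_t \sum_S A t S) * (1 + CF N * C1).
have C20 : 0 <= C2.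
  rewrite !mulr_ge0 ?invr_ge0 ?exprn_ge0 ?(ltW h_gt0) //.
    by apply: sumr_ge0 => t _; apply: sumr_ge0.
  by rewrite addr_ge0 // mulr_ge0.
exists (C1 + C2); first exact: addr_ge0.
move=> g1 g2 Phi dd adm dd0 Pd w la sw lar.
have s0 := rates_ge0 dd N.
have [gw|gw] := boolP (good N w).
  apply: le_trans (H1 _ _ _ _ adm dd0 Pd w la gw lar) _.
  by rewrite ler_wpM2r // lerDl.
apply: (@le_trans _ _ (C2 * rates dd N)); last by rewrite ler_wpM2r // lerDr.
have [sN wN] : size w = N /\ None \notin w.
  move: gw; rewrite /good negb_or negb_and -leqNgt => /andP[Nw].
  by rewrite sw /= => ->; split => //; apply/eqP; rewrite eqn_leq sw Nw.
have [t wt] : exists t : N.-tuple 'I_n, w = map Some t.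
  have ws : w = map Some (pmap id w).
    elim: w wN {sw gw sN} => //= -[i|] w IH; last by rewrite inE eqxx.
    by rewrite inE /= => /IH {1}->.
  have st : size (pmap id w) == N by rewrite -sN {2}ws size_map.
  by exists (Tuple st).
pose c (s : N.-tuple 'I_n) := wdiff g1 g2 (map Some s) la.
have NCk g : Ck (3 + ell) setT g -> Ck N setT g.
  by apply: Ck_le; rewrite (leq_trans (ltnW N_lt)) // leq_addl.
have csym (s s' : N.-tuple 'I_n) : perm_eq s s' -> c s = c s'.
  move=> ss; have pm := perm_map Some ss.
  have sz : size (map Some s) = N by rewrite size_map size_tuple.
  have G1 := Ck_le (eq_leq sz) (NCk _ (a_smooth1 adm)).
  have G2 := Ck_le (eq_leq sz) (NCk _ (a_smooth2 adm)).
  by rewrite /c /wdiff (dword_perm G1 pm) (dword_perm G2 pm).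
have formE v : form c v = lead g1 (la, 0) v N [::] - lead g2 (la, 0) v N [::].
  rewrite !lead_form; [|apply: NCk; exact: a_smooth2 adm|apply: NCk; exact: a_smooth1 adm].
  by rewrite /form -sumrB; apply: eq_bigr => s _; rewrite -mulrBl.
have formB S : `|form c (shifted nu h t S)| <= A t S * ((1 + CF N * C1) * rates dd N).
  set v := shifted nu h t S; have vn : 0 < dot v nu by exact: shifted_dot.
  have v0 : 0 < enorm v by rewrite sqrtr_gt0; apply: (@dot_gt0 _ _ v nu); rewrite gt_eqF.
  pose om := (enorm v)^-1 *: v.
  have om1 : dot om om = 1 by apply: (@dot_normalized _ _ _ nu); rewrite gt_eqF.
  have vE : v = enorm v *: om by rewrite scalerA mulfV ?scale1r // gt_eqF.
  have := a_main adm N_lt (mulr_ge0 C10 s0) lar om1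
    (fun w gw => H1 _ _ _ _ adm dd0 Pd w la gw lar).
  rewrite -formE => M.
  have omn : 0 < dot om nu by rewrite dotZl mulr_gt0 ?invr_gt0.
  (* The factor N+1 >= 1 is discarded; the bound on [Phi] of order N+1 is a term of [rates] with
     exponent 1. *)
  have M2 : `|form c om| * dot om nu <= (1 + CF N * C1) * rates dd N.
    apply: (@le_trans _ _ (N.+1%:R * `|form c om| * `|dot om nu|)).
      rewrite (gtr0_norm omn) -mulrA ler_peMl // ?mulr_ge0 ?(ltW omn) //.
      by rewrite ler1n.
    apply: le_trans M _; rewrite mulrDl mul1r mulrA lerD2r.
    by apply: le_trans (rates_last dd0 N); apply: Pd => //; rewrite leqnn.
  have fE : `|form c v| = enorm v ^+ N * `|form c om|.
    by rewrite vE form_homogeneous normrM ger0_norm -?vE // exprn_ge0 // ltW.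
  have AE : A t S = enorm v ^+ N / dot om nu.
    by rewrite /A -/v dotZl exprSr; field; rewrite !gt_eqF.
  rewrite fE AE -mulrA; apply: ler_wpM2l; first by rewrite exprn_ge0 // ltW.
  by rewrite mulrC ler_pdivlMr.
have hN : h != 0 by rewrite gt_eqF.
rewrite wt -/(c t); apply: le_trans (polarization_bound csym nu t hN) _.
rewrite /C2 ger0_norm ?exprn_ge0 ?(ltW h_gt0) // -!mulrA ler_wpM2l ?invr_ge0 ?exprn_ge0 ?(ltW h_gt0) //.
apply: (@le_trans _ _ (\sum_S A t S * ((1 + CF N * C1) * rates dd N))).
  by apply: ler_sum => S _; exact: formB.
rewrite -mulr_suml ler_wpM2r //.
  by rewrite mulr_ge0 // addr_ge0 // mulr_ge0.
rewrite (bigD1 t) //= lerDl; apply: sumr_ge0 => s _; exact: sumr_ge0.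
Qed.

End Pure.

(** The interpolation step must be positive, whereas [rates] may be 0: the estimate is proved for s
    + e and e is sent to 0. *)
Lemma le_of_perturbed (a C s : R) : 0 <= C -> (forall e, 0 < e -> a <= C * (s + e)) -> a <= C * s.
Proof.
move=> C0 H; apply/ler_addgt0Pr => e e0.
have C1 : 0 < C + 1 by lra.
apply: le_trans (H (e / (C + 1)) _) _; first exact: divr_gt0.
rewrite mulrDr lerD2l mulrA ler_pdivrMr // mulrC ler_wpM2l ?(ltW e0) //.
by rewrite lerDl.
Qed.

Lemma good_size N w : good N w -> (size w <= N)%N.
Proof. by rewrite /good => /orP[/ltnW|/andP[]]. Qed.

Lemma good_top N w : good N.+1 w -> (N < size w)%N -> size w = N.+1 /\ None \in w.
Proof.
rewrite /good => /orP[s1 s2|/andP[s1 ->] s2]; first by rewrite ltnS leqNgt s2 in s1.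
by split=> //; apply/eqP; rewrite eqn_leq s1.
Qed.

(** A word of size N+1 containing mu is, after reordering, the lambda-derivative of a word of size
    N, which is O(s^3) for s the rate of order N+1. The second lambda-derivative is bounded by [K],
    so interpolation applies. *)
Lemma controlled_good N : (N.+1 < ell)%N ->
  controlled N (fun w => size w <= N)%N -> controlled N.+1 (good N.+1).
Proof.
move=> N_lt [C C0 H].
have le3 m : (m <= N.+3)%N -> (m <= 3 + ell)%N by lia.
(* One summand for each case: short words, s >= 1, and interpolation. *)
pose C' := C + K + (2 * C / r + K * r).
have Cr0 : 0 <= 2 * C / r + K * r.
  by rewrite addr_ge0 ?divr_ge0 ?mulr_ge0 // ltW.
have HC' : [/\ 0 <= C', K <= C', C <= C' & 2 * C / r + K * r <= C'].
  have := K_ge0; have := C0; rewrite /C'; move: (2 * C / r + K * r) Cr0 => X X0 c0 kk0.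
  by split; lra.
exists C'; first by case: HC'.
move=> g1 g2 Phi dd adm dd0 Pd w la gw lar.
set s := rates dd N.+1; have s0 : 0 <= s := rates_ge0 dd _.
have Pd' k la' om : (1 <= k <= N.+1)%N -> `|la'| <= r -> dot om om = 1 -> Phi la' om k <= dd k.
  by move=> /andP[k1 k2]; apply: Pd; rewrite k1 ltnW.
have small w' la' : (size w' <= N)%N -> `|la'| <= r -> `|wdiff g1 g2 w' la'| <= C * s ^+ 3.
  move=> sw' lar'; apply: le_trans (H _ _ _ _ adm dd0 Pd' w' la' sw' lar') _.
  by rewrite ler_wpM2l // rates_cube.
have big w' la' : (size w' <= N.+3)%N -> `|la'| <= r -> `|wdiff g1 g2 w' la'| <= K.
  by move=> sw' lar'; apply: (a_bound adm) => //; exact: le3.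
have big1 w' : (size w' <= N.+3)%N -> 1 <= s -> `|wdiff g1 g2 w' la| <= K * s.
  by move=> sw' s1; apply: le_trans (big w' la sw' lar) _; rewrite ler_peMr.
(* For s >= 1 the a priori bound [K] on the jets is enough; afterwards s < 1. *)
have [s1|s1] := leP 1 s.
  apply: le_trans (big1 w _ s1) _.
    by rewrite (leq_trans (good_size gw)) // ltnW.
  by rewrite ler_wpM2r //; case: HC'.
have [wN|wN] := leqP (size w) N.
  apply: le_trans (small w la wN lar) _; apply: (@le_trans _ _ (C * s)).
    rewrite ler_wpM2l // -[X in _ <= X]expr1.
    by apply: ler_wiXn2l => //; exact: ltW.
  by rewrite ler_wpM2r //; case: HC'.
have [sw Nw] := good_top gw wN.
have [w' pw] : exists w', perm_eq w (None :: w').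
  by exists (rem None w); exact: perm_to_rem.
have sw' : size w' = N by have := perm_size pw; rewrite sw /= => -[].
have wE l : wdiff g1 g2 w l = wdiff g1 g2 (None :: w') l.
  have NCk g : Ck (3 + ell) setT g -> Ck (size w) setT g.
    by apply: Ck_le; apply: le3; rewrite sw; exact: (leqW (leqnSn _)).
  rewrite /wdiff (dword_perm (NCk _ (a_smooth1 adm)) pw).
  by rewrite (dword_perm (NCk _ (a_smooth2 adm)) pw).
have dW (g : V -> R) u t : Ck (size u).+1 setT g ->
    is_derive t (1 : R) (fun l => dword u g (l, 0)) (dword (None :: u) g (t, 0)).
  move=> Cg.
  have := Cg; rewrite -[(size u).+1]addn1 => /Ck_dword [_ gd].
  have Hd := derivableP ((gd (dvec (None : option 'I_n))).1 (t, 0) I).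
  have lE l : ((0 : R), (0 : 'rV[R]_n)) + l *: dvec None = (l, 0).
    by congr pair; rewrite /= ?add0r ?scaler0 // [l *: 1]mulr1.
  have -> : (fun l => dword u g (l, 0)) = (fun l => dword u g ((0, 0) + l *: dvec None)).
    by apply/funext => l; rewrite lE.
  by apply: is_derive_line; rewrite lE.
have dD u t : (size u <= N.+1)%N ->
    is_derive t (1 : R) (wdiff g1 g2 u) (wdiff g1 g2 (None :: u) t).
  move=> su.
  have NCk g : Ck (3 + ell) setT g -> Ck (size u).+1 setT g.
    by apply: Ck_le; apply: le3; exact: (leqW su).
  exact: (is_deriveB (dW g1 u t (NCk _ (a_smooth1 adm))) (dW g2 u t (NCk _ (a_smooth2 adm)))).
rewrite wE; apply: (@le_trans _ _ ((2 * C / r + K * r) * s)); last first.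
  by rewrite ler_wpM2r //; case: HC'.
apply: le_of_perturbed => // e e0.
(* The cap 1 - s keeps S = s + e' at most 1, so that the step r S does not exceed r. *)
pose e' := Num.min e (1 - s).
have e'0 : 0 < e' by rewrite lt_min e0 subr_gt0.
have se1 : s + e' <= 1 by rewrite -lerBrDl ge_min lexx orbT.
have se0 : 0 < s + e' by lra.
apply: (@le_trans _ _ ((2 * C / r + K * r) * (s + e'))); last first.
  by rewrite ler_wpM2l // lerD2l ge_min lexx.
set S := s + e' in se1 se0 *.
have hS : 0 < r * S by rewrite mulr_gt0.
have hr : r * S <= r by rewrite ler_piMr // ltW.
have dw' t : is_derive t (1 : R) (wdiff g1 g2 w') (wdiff g1 g2 (None :: w') t).
  by apply: dD; rewrite sw'.
have ddw' t : is_derive t (1 : R) (wdiff g1 g2 (None :: w')) (wdiff g1 g2 (None :: None :: w') t).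
  by apply: dD; rewrite /= sw'.
have B1 t : `|t| <= r -> `|wdiff g1 g2 w' t| <= C * S ^+ 3.
  move=> tr; apply: le_trans (small w' t _ tr) _; first by rewrite sw'.
  rewrite ler_wpM2l // lerXn2r ?nnegrE ?(ltW se0) // /S lerDl ltW //.
have B2 t : `|t| <= r -> `|wdiff g1 g2 (None :: None :: w') t| <= K.
  by move=> tr; apply: big => //=; rewrite sw'.
apply: le_trans (interpolation hS hr dw' ddw' B1 B2 lar) _.
(* With F = C S^3 and h = r S the two terms are of size S^2 and S, and S^2 <= S. *)
have -> : 2 * (C * S ^+ 3) / (r * S) = 2 * C / r * S ^+ 2.
  by field; rewrite !gt_eqF.
rewrite [X in _ <= X]mulrDl; apply: lerD; last by rewrite mulrA.
apply: ler_wpM2l; first by rewrite divr_ge0 ?mulr_ge0 // ltW.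
by rewrite -[X in _ <= X]expr1; apply: ler_wiXn2l => //; exact: ltW.
Qed.

Lemma controlled_all N : (N < ell)%N -> controlled N (fun w => size w <= N)%N.
Proof.
elim: N => [|N IH] Nl; first exact: controlled_pure controlled0.
by apply: controlled_pure => //; apply: controlled_good => //; apply: IH; exact: ltnW.
Qed.

End Recovery.

(** * Solutions of the boundary value problems *)

Section Solutions.
Context {R : realType} {n : nat}.
Local Notation V := (R * 'rV[R]_n)%type.
Variables (alpha : R) (Om : set 'rV[R]_n).
Hypotheses (n_gt0 : (0 < n)%N) (Oo : open Om) (O0 : Om !=set0).

Lemma partial_cst (i : 'I_n) (c : R) : partial i (fun=> c) = fun=> 0.
Proof. by apply/funext => y; rewrite /partial derive_cst. Qed.

Lemma Ck_cst (V1 W : normedModType R) m (U : set V1) (c : W) : Ck m U (fun=> c).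
Proof.
elim: m c => [|m IH] c; split=> //; try by move=> x _; exact: cst_continuous.
move=> v; split; first by move=> x _; exact: derivable_cst.
rewrite (_ : 'D_v (fun=> c) = fun=> 0) //.
by apply/funext => y; rewrite derive_cst.
Qed.

Lemma sup_norm_cst (c : R) : (sup_norm Om (fun=> c) <= `|c|%:E)%E.
Proof. by apply: ge_ereal_sup => _ [x _ <-]. Qed.

Lemma holder2_cst (c : R) : holder2 alpha Om (fun=> c).
Proof.
split.
- exact: Ck_cst.
- by apply: continuous_subspaceT; exact: cst_continuous.
- by move=> x cx i; rewrite partial_cst; exact: is_cvg_cst.
- by move=> x cx i j; rewrite !partial_cst; exact: is_cvg_cst.
- rewrite /holder2_norm; have lt_sup (d : R) : (sup_norm Om (fun=> d) < +oo)%E.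
    by apply: le_lt_trans (sup_norm_cst d) _; exact: ltry.
  apply: lte_add_pinfty; first apply: lte_add_pinfty => //.
    by apply: lte_sum_pinfty => i _; rewrite partial_cst.
  apply: lte_sum_pinfty => i _; apply: lte_sum_pinfty => j _; rewrite !partial_cst.
  apply: lte_add_pinfty => //; apply: le_lt_trans (ltry 0).
  by apply: ge_ereal_sup => _ [p _ <-]; rewrite subrr normr0 mul0r.
Qed.

Lemma elliptic_scalar (kappa : V -> R) (a : coef R n) (g : V -> R) p :
  coef_elliptic kappa a -> (forall q, a q = (g q)%:M) -> kappa p <= g p.
Proof.
move=> ea ag; have := ea p (evec R (Ordinal n_gt0)).
have E : enorm (evec R (Ordinal n_gt0)) ^+ 2 = 1.
  by rewrite /enorm dot_evec mxE !eqxx sqrtr1 expr1n.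
rewrite E mulr1; move/le_trans; apply.
rewrite (bigD1 (Ordinal n_gt0)) //= [X in _ + X]big1 ?addr0 => [|i ii].
  rewrite (bigD1 (Ordinal n_gt0)) //= [X in _ + X]big1 ?addr0 => [|i ii].
    by rewrite ag !mxE !eqxx !mulr1 mulr1n.
  by rewrite ag !mxE !eqxx (negbTE ii) mulr0.
by rewrite big1 // => j _; rewrite !mxE !eqxx (negbTE ii) mulr0 mul0r.
Qed.

Lemma bvp_initial (a : coef R n) la om (u : 'rV[R]_n -> R) :
  unique_solution alpha Om a (fun x => la + 0 * dot x om) u ->
  forall x, closure Om x -> u x = la.
Proof.
case=> _ uniq x cx; apply/esym; apply: (uniq (fun=> la)) cx; split.
- exact: holder2_cst.
- move=> y Oy; rewrite big1 ?oppr0 // => i _.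
  rewrite (_ : (fun z => _) = fun=> 0); first by rewrite partial_cst.
  by apply/funext => z; rewrite big1 // => k _; rewrite partial_cst mulr0.
- by move=> y _; rewrite mul0r addr0.
Qed.

(** Passage from a family of solutions, for one lambda and omega, to a valid parameter: [K] and [k0]
    are given independently of the coefficient. *)
Lemma solution_param ell (K k0 e la : R) om (a : coef R n) (g : V -> R)
    (u : R -> 'rV[R]_n -> R) :
  Ck (3 + ell) setT g -> (forall p, a p = (g p)%:M) ->
  (forall w, (size w <= 3 + ell)%N -> `|dword w g (la, 0)| <= K) ->
  k0 <= g (la, 0) -> dot om om = 1 -> 0 < e ->
  (forall t, `|t| < e -> unique_solution alpha Om a (fun x => la + t * dot x om) (u t)) ->
  Ck_curve alpha Om e ell u ->
  exists W, W 0 = u /\ valid alpha Om ell K k0 (Param g la om e W).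
Proof.
move=> Cg ag gK gk om1 e0 sol curve.
have [W [W0 rW tW]] := curve_tower Oo curve.
exists W; split=> //; split=> //.
- move=> t te x Ox /=; have [[_ pde _] _] := sol t te.
  have ru : regular Om (u t) by rewrite -W0; exact: rW.
  have := pde x Ox; rewrite (divergence_expanded _ ru ag Ox); last exact: Ck_le Cg.
  move/eqP; rewrite oppr_eq0 => /eqP Z; apply: etrans Z.
  have tE i : trace Om i (u t) x = partial i (u t) x by exact: trace_partial.
  have pE : upoint Om (Param g la om e W) x t = (u t x, grad (u t) x).
    rewrite /upoint /= W0 dvec_sum; congr pair.
    by apply/rowP => i; rewrite !mxE /= tE.
  rewrite /gcomp pE /= W0; congr (_ + (_ + _)).
    by apply: eq_bigr => i _; rewrite tE.
  by apply: eq_bigr => i _; apply: eq_bigr => j _; rewrite tE.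
- move=> x cx /=; rewrite W0; apply: (@bvp_initial a la om) cx.
  by apply: sol; rewrite normr0.
- by move=> t te x bx /=; rewrite W0; have [[_ _ ->]] := sol t te.
Qed.

Lemma flux_scalar (nu : 'rV[R]_n -> 'rV[R]_n) (a : coef R n) (g : V -> R) la om e W x t :
  (forall p, a p = (g p)%:M) ->
  flux Om nu a (W 0 t) x = fluxp Om (nu x) (Param g la om e W) x t.
Proof.
move=> ag; rewrite /flux /fluxp; apply: eq_bigr => i _.
rewrite (bigD1 i) //= [X in _ + X]big1 ?addr0 => [|k ki].
  rewrite /gcomp /upoint dvec_sum /= ag mxE eqxx mulr1n mxE mulrC.
  congr (_ * (g (_, _) * _)).
by rewrite ag mxE eq_sym (negbTE ki) mulr0n !mul0r.
Qed.

(** Expansion in the basis tensors: [C] is the sum of their norms and depends on nothing else than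
    [p]. *)
Lemma norm_le_basis (N : nat) (p : tensor R n N -> R) : is_norm p ->
  exists2 C, 0 <= C & forall (T : tensor R n N) B,
    (forall t, `|T t| <= B) -> p T <= C * B.
Proof.
move=> np; have [pD pZ _] := np; have p0 := is_norm_ge0 np.
pose E (t : N.-tuple 'I_n) : tensor R n N := [ffun s => (s == t)%:R].
exists (\sum_t p (E t)); first by apply: sumr_ge0.
move=> T B TB.
have -> : T = \sum_t (T t : R) *: E t.
  apply/ffunP => s; rewrite sum_ffunE (bigD1 s) //= big1 ?addr0 => [|t ts].
    by rewrite !ffunE eqxx [_ *: _]mulr1.
  by rewrite !ffunE eq_sym (negbTE ts) scaler0.
have H : p (\sum_t (T t : R) *: E t) <= \sum_t p ((T t : R) *: E t).
  elim/big_ind2 : _ => [|x1 x2 y1 y2 h1 h2|//].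
    by rewrite -(scale0r (0 : tensor R n N)) pZ normr0 mul0r.
  by apply: le_trans (pD _ _) _; exact: lerD.
apply: le_trans H _; rewrite mulr_suml; apply: ler_sum => t _.
by rewrite pZ mulrC ler_wpM2l.
Qed.

End Solutions.

(** * Uniform constants and conclusion *)

Lemma subtract_remainder (R : realDomainType) (F1 F2 l1 l2 d B : R) (m : nat) :
  `|(F1 - m%:R * (l1 * d)) - (F2 - m%:R * (l2 * d))| <= B ->
  m%:R * `|l1 - l2| * `|d| <= `|F1 - F2| + B.
Proof.
move=> H; have -> : m%:R * `|l1 - l2| * `|d| = `|m%:R * ((l1 - l2) * d)|.
  by rewrite !normrM [`|m%:R|]ger0_norm ?ler0n // mulrA.
have -> : m%:R * ((l1 - l2) * d) =
    (F1 - F2) - ((F1 - m%:R * (l1 * d)) - (F2 - m%:R * (l2 * d))) by ring.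
by apply: le_trans (ler_normB _ _) _; rewrite lerD2l.
Qed.

(** The Lipschitz constants of the remainders are selected for all N at once, before any
    coefficient. Equal radii [pe] let the difference of the two fluxes be differentiated on one
    common interval. *)
Lemma flux_constants (R : realType) (n : nat) (alpha : R) (Om : set 'rV[R]_n)
    (ell : nat) (K k0 : R) (nu x : 'rV[R]_n) :
  (0 < n)%N -> open Om -> Om !=set0 -> bounded_set Om -> 0 <= K -> 0 < k0 ->
  closure Om x ->
  exists CF : nat -> R, (forall N, 0 <= CF N) /\
    forall N, (N < ell)%N -> forall rho th1 th2, 0 <= rho ->
      valid alpha Om ell K k0 th1 -> valid alpha Om ell K k0 th2 -> close N rho th1 th2 ->
      pe th1 = pe th2 ->
      N.+1%:R * `|lead (pg th1) (pla th1, 0) (pom th1) N [::]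
                  - lead (pg th2) (pla th1, 0) (pom th1) N [::]| * `|dot (pom th1) nu|
      <= `|derive1n N.+1 (fun t => fluxp Om nu th1 x t - fluxp Om nu th2 x t) 0|
         + CF N * rho.
Proof.
move=> n0 Oo O0 Ob K0 k00 cx.
have /choice[CF HCF] : forall N, exists C : R, 0 <= C /\ ((N < ell)%N ->
    forall rho th1 th2, 0 <= rho ->
      valid alpha Om ell K k0 th1 -> valid alpha Om ell K k0 th2 -> close N rho th1 th2 ->
      `|(derive1n N.+1 (fluxp Om nu th1 x) 0 -
           N.+1%:R * (lead (pg th1) (pla th1, 0) (pom th1) N [::] * dot (pom th1) nu)) -
        (derive1n N.+1 (fluxp Om nu th2 x) 0 -
           N.+1%:R * (lead (pg th2) (pla th2, 0) (pom th2) N [::] * dot (pom th2) nu))|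
      <= C * rho).
  (* For N >= ell nothing is claimed and 0 is a dummy value. *)
  move=> N; have [Nl|Nl] := ltnP N ell; last by exists 0; split.
  have [C C0 [_ HC]] := flux_expansion alpha n0 Oo O0 Ob K0 k00 nu Nl cx.
  by exists C; split.
exists CF; split=> [N|N Nl rho th1 th2 rho0 v1 v2 cl pe12]; first by case: (HCF N).
have := (HCF N).2 Nl rho th1 th2 rho0 v1 v2 cl.
have [<- <- _] := cl.
have s1 := smooth_fluxp n0 Oo O0 (nu := nu) v1 cx.
have s2 := smooth_fluxp n0 Oo O0 (nu := nu) v2 cx.
rewrite -pe12 in s2.
move=> H.
have e0 : `|0 : R| < pe th1 by rewrite normr0; exact: v_eps v1.
have -> : derive1n N.+1 (fun t => fluxp Om nu th1 x t - fluxp Om nu th2 x t) 0 =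
    derive1n N.+1 (fluxp Om nu th1 x) 0 - derive1n N.+1 (fluxp Om nu th2 x) 0.
  have -> : (fun t => fluxp Om nu th1 x t - fluxp Om nu th2 x t) =
      (fun t => fluxp Om nu th1 x t + (- 1) * fluxp Om nu th2 x t).
    by apply/funext => t; rewrite mulN1r.
  rewrite (derive1nD s1 (smoothZ s2) Nl e0).
  by rewrite (derive1nZ _ s2 Nl e0) mulN1r.
exact: subtract_remainder.
Qed.

(** Compactness of [-r, r] turns the ellipticity function at eta = 0 into a single constant. *)
Lemma positive_lower_bound (R : realType) (n : nat) (kappa : (R * 'rV[R]_n)%type -> R)
    (r : R) : 0 < r -> continuous kappa -> (forall p, 0 < kappa p) ->
  exists2 k0, 0 < k0 & forall la, `|la| <= r -> k0 <= kappa (la, 0).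
Proof.
move=> r0 kc kp; pose f la := kappa (la, 0).
have fc : continuous f.
  move=> la; apply: (@continuous_comp _ _ _ (fun l : R => (l, 0 : 'rV[R]_n)) kappa).
    have -> : (fun l : R => (l, 0 : 'rV[R]_n)) = (fun l => l *: (1, 0)).
      by apply/funext => l; congr pair; rewrite /= ?scaler0 // [l *: 1]mulr1.
    exact: (cvgZr_tmp (@cvg_id _ (nbhs la))).
  exact: kc.
have rr : - r <= r by rewrite ge0_cp ?ltW.
have [c _ cP] := EVT_min rr (continuous_subspaceT fc).
exists (f c); first exact: kp.
by move=> la lar; apply: cP; rewrite in_itv /= -ler_norml.
Qed.

Unset Implicit Arguments.
Set Strict Implicit.
Set Printing Implicit Defensive.

Theorem corollary2p3 (R : realType) (n : nat) (hn : (2 <= n)%N) :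
  exists C1 : R, 0 < C1 /\
  forall (alpha : R) (halpha : 0 < alpha < 1)
    (Om : set 'rV[R]_n) (hOm : holder2_domain alpha Om)
    (nu : 'rV[R]_n -> 'rV[R]_n)
    (hnu : forall x, boundary Om x -> outward_unit_normal Om x (nu x))
    (ell : nat) (hell : (1 <= ell)%N)
    (mnorm : 'M[R]_n -> R) (hmnorm : is_norm mnorm)
    (tnorm : forall N : nat, tensor R n N -> R)
    (htnorm : forall N, is_norm (tnorm N))
    (kappa : (R * 'rV[R]_n)%type -> R)
    (hkappa_cont : continuous kappa) (hkappa_pos : forall p, 0 < kappa p)
    (psi : R -> R)
    (hpsi_cont : {within `[0, +oo[, continuous psi})
    (hpsi_ge0 : forall t, 0 <= t -> 0 <= psi t)
    (hpsi_incr : {in `[0, +oo[ &, {homo psi : s t / s <= t}})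
    (hbasis : exists (e' x : 'I_n -> 'rV[R]_n),
       [/\ forall i j, dot (e' i) (e' j) = (i == j)%:R,
           forall i, boundary Om (x i)
         & forall i, enorm (nu (x i) - e' i) < 1 / Num.sqrt n%:R])
    (x0 : 'rV[R]_n) (hx0 : boundary Om x0)
    (r : R) (hr : 0 < r),
  exists C2 : R, 0 < C2 /\
  forall (a1 a2 : coef R n) (gamma1 gamma2 : (R * 'rV[R]_n)%type -> R)
    (ha1_smooth : Ck (3 + ell) setT a1) (ha2_smooth : Ck (3 + ell) setT a2)
    (ha1_sym : coef_symmetric a1) (ha2_sym : coef_symmetric a2)
    (ha1_ell : coef_elliptic kappa a1) (ha2_ell : coef_elliptic kappa a2)
    (hg1_smooth : Ck (3 + ell) setT gamma1)
    (hg2_smooth : Ck (3 + ell) setT gamma2)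
    (hg1_pos : forall p, 0 < gamma1 p) (hg2_pos : forall p, 0 < gamma2 p)
    (ha1 : forall p, a1 p = (gamma1 p)%:M)
    (ha2 : forall p, a2 p = (gamma2 p)%:M)
    (ha1_psi : forall (mu : R) (k : nat) (beta : 'I_n -> nat),
       (k + \sum_i beta i <= 3 + ell)%N ->
       mnorm (d_mu_eta k beta a1 (mu, 0)) <= psi `|mu|)
    (ha2_psi : forall (mu : R) (k : nat) (beta : 'I_n -> nat),
       (k + \sum_i beta i <= 3 + ell)%N ->
       mnorm (d_mu_eta k beta a2 (mu, 0)) <= psi `|mu|)
    (eps : R -> R) (heps : forall la, 0 < eps la)
    (u1 u2 : R -> 'rV[R]_n -> R -> 'rV[R]_n -> R)
    (hu1 : solution_family alpha Om ell eps a1 u1)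
    (hu2 : solution_family alpha Om ell eps a2 u2),
  ((ereal_sup [set `|gamma1 (la, 0) - gamma2 (la, 0)|%:E
              | la in `[- r, r]%classic])%R
   <= C1%:E * delta Om nu x0 r a1 a2 u1 u2 1)%E
  /\
  forall N : nat, (1 <= N <= ell - 1)%N ->
  ((ereal_sup [set (tnorm N (D_eta N gamma1 (la, 0)
                             - D_eta N gamma2 (la, 0)))%:E
              | la in `[- r, r]%classic])%R
   <= C2%:E * \sum_(1 <= k < N.+2)
        poweR (delta Om nu x0 r a1 a2 u1 u2 k) (3 ^+ k / 3 ^+ N.+1)%R)%E.
Proof.
(* C1 = 1 because the first estimate uses omega = nu(x0), for which omega.nu = 1. *)
exists 1; split=> // alpha _ Om [Oo _ O0 Ob _] nu hnu ell hell mnorm hmnorm tnorm htnorm.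
move=> kappa kappa_cont kappa_pos psi _ psi_ge0 psi_incr _ x0 bx0 r r0.
have n0 : (0 < n)%N := ltnW hn.
have nu1 := dot_normal (hnu x0 bx0).
have cx0 : closure Om x0 := bx0.1.
have [k0 k00 k0P] := @positive_lower_bound R n kappa r r0 kappa_cont kappa_pos.
(* [psi r] bounds the matrices for all |lambda| <= r by monotonicity; division by the norm of the
   identity gives a bound on the derivatives of gamma. *)
pose K := psi r / mnorm 1%:M.
have K0 : 0 <= K by rewrite divr_ge0 ?psi_ge0 ?(is_norm_ge0 hmnorm) // ltW.
have [CF [CF0 HCF]] := @flux_constants R n alpha Om ell K k0 (nu x0) x0 n0 Oo O0 Ob K0 k00 cx0.
have KK0 : 0 <= K + K by exact: addr_ge0.
(* Constants for every N, chosen ahead of the coefficients. The bound [K + K] is that of a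
   difference of two jets. *)
have /choice[CN HCN] : forall N, exists C : R, 0 <= C /\ ((N < ell)%N ->
    forall g1 g2 Phi dd, admissible ell (K + K) r (nu x0) CF g1 g2 Phi ->
    (forall k, 0 <= dd k) ->
    (forall k la om, (1 <= k <= N.+1)%N -> `|la| <= r -> dot om om = 1 ->
       Phi la om k <= dd k) ->
    forall w la, (size w <= N)%N -> `|la| <= r ->
      `|wdiff g1 g2 w la| <= C * rates dd N).
  move=> N; have [Nl|Nl] := ltnP N ell; last by exists 0; split.
  by have [C C0 HC] := controlled_all r0 KK0 nu1 CF0 Nl; exists C; split.
have /choice[TC HTC] : forall N, exists C : R, 0 <= C /\
    forall (T : tensor R n N) B, (forall t, `|T t| <= B) -> tnorm N T <= C * B.
  by move=> N; have [C C0 HC] := norm_le_basis (htnorm N); exists C; split.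
have term_ge0 N : 0 <= TC N * CN N by rewrite mulr_ge0 ?(HTC N).1 ?(HCN N).1.
(* Summing over N < ell gives one constant for all orders; the 1 ensures positivity. *)
exists (1 + \sum_(N < ell) TC N * CN N); split.
  by rewrite ltr_pwDl // sumr_ge0.
move=> a1 a2 g1 g2 _ _ _ _ el1 el2 Cg1 Cg2 _ _ ag1 ag2 ps1 ps2 eps eps0 u1 u2 h1 h2.
have psr (la : R) : `|la| <= r -> psi `|la| <= psi r.
  by move=> lar; apply: psi_incr; rewrite ?in_itv /= ?andbT ?normr_ge0 ?(ltW r0).
have wb (a : coef R n) (g : (R * 'rV[R]_n)%type -> R) : Ck (3 + ell) setT g ->
    (forall p, a p = (g p)%:M) ->
    (forall (mu : R) (k : nat) (beta : 'I_n -> nat), (k + \sum_i beta i <= 3 + ell)%N ->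
       mnorm (d_mu_eta k beta a (mu, 0)) <= psi `|mu|) ->
    forall la w, `|la| <= r -> (size w <= 3 + ell)%N -> `|dword w g (la, 0)| <= K.
  move=> Cg ag ps la w lar sw.
  apply: (word_bound (mnorm := mnorm) n0 hmnorm Cg ag _ sw) => k beta kb.
  by apply: le_trans (ps la k beta kb) _; exact: psr.
pose D la om t := flux Om nu a1 (u1 la om t) x0 - flux Om nu a2 (u2 la om t) x0.
pose Phi la om k := `|derive1n k (D la om) 0|.
have gk (a : coef R n) g la : coef_elliptic kappa a -> (forall p, a p = (g p)%:M) ->
    `|la| <= r -> k0 <= g (la, 0).
  by move=> el ag lar; apply: le_trans (k0P la lar) _; exact: elliptic_scalar el ag.
have sphere (om : 'rV[R]_n) : dot om om = 1 -> unit_sphere om.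
  by move=> om1; rewrite /unit_sphere /= /enorm om1 sqrtr1.
have adm : admissible ell (K + K) r (nu x0) CF g1 g2 Phi.
  split=> // [w la sw lar|N Nl rho la om rho0 lar om1 cl].
    apply: le_trans (ler_normB _ _) _.
    by apply: lerD; [exact: (wb a1) | exact: (wb a2)].
  have [s1 c1] := h1 la om (sphere om om1); have [s2 c2] := h2 la om (sphere om om1).
  have [W1 [W10 v1]] := solution_param Oo Cg1 ag1
    (fun w sw => wb a1 g1 Cg1 ag1 ps1 la w lar sw) (gk a1 g1 la el1 ag1 lar) om1 (eps0 la) s1 c1.
  have [W2 [W20 v2]] := solution_param Oo Cg2 ag2
    (fun w sw => wb a2 g2 Cg2 ag2 ps2 la w lar sw) (gk a2 g2 la el2 ag2 lar) om1 (eps0 la) s2 c2.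
  have cl' : close N rho (Param g1 la om (eps la) W1) (Param g2 la om (eps la) W2) by split.
  have := HCF N Nl rho _ _ rho0 v1 v2 cl' erefl.
  have DE : D la om = (fun t => fluxp Om (nu x0) (Param g1 la om (eps la) W1) x0 t -
      fluxp Om (nu x0) (Param g2 la om (eps la) W2) x0 t).
    apply/funext => t; rewrite /D -W10 -W20.
    congr (_ - _); [exact: (flux_scalar Om nu _ _ _ _ _ _ ag1) | exact: (flux_scalar Om nu _ _ _ _ _ _ ag2)].
  by rewrite -DE.
pose dl k := delta Om nu x0 r a1 a2 u1 u2 k.
have itv (la : R) : (`[- r, r]%classic la) = (`|la| <= r) :> Prop.
  by rewrite /= in_itv /= ler_norml.
have Phi_le k la om : `|la| <= r -> dot om om = 1 -> ((Phi la om k)%:E <= dl k)%E.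
  move=> lar om1; apply: le_trans (ereal_sup_ubound _); last first.
    by exists om; [exact: sphere | reflexivity].
  by apply: ereal_sup_ubound; exists la => //; rewrite itv.
have dl0 k : (0 <= dl k)%E.
  apply: le_trans (Phi_le k 0 (nu x0) _ nu1); first by rewrite lee_fin normr_ge0.
  by rewrite normr0 ltW.
split.
  apply: ge_ereal_sup => y [la]; rewrite itv => lar <-; rewrite mul1e.
  apply: le_trans (Phi_le 1%N la (nu x0) lar nu1); rewrite lee_fin.
  (* For N = 0 closeness is vacuous, hence holds with rho = 0: no remainder. *)
  have := a_main adm hell (lexx 0) lar nu1.
  rewrite nu1 normr1 mulr1 mul1r mulr0 addr0 /=; apply => w.
  by rewrite /good ltn0 leqn0 size_eq0 /= => /andP[/eqP ->].
move=> N /andP[N1 Nell]; have Nl : (N < ell)%N by lia.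
set C2 := 1 + _; have C20 : 0 < C2 by rewrite ltr_pwDl // sumr_ge0.
have exp_gt0 k : 0 < 3 ^+ k / 3 ^+ N.+1 :> R by rewrite divr_gt0 ?exprn_gt0.
(* An infinite delta_k makes the right-hand side infinite; otherwise all of them are real and the
   estimate by [rates] applies. *)
have [[k kN dk]|fin] := pselect (exists2 k, (1 <= k < N.+2)%N & dl k = +oo%E).
  suff -> : (\sum_(1 <= k < N.+2) poweR (dl k) (3 ^+ k / 3 ^+ N.+1)%R = +oo)%E.
    by rewrite gt0_muley ?leey ?lte_fin.
  rewrite (bigD1_seq k) ?mem_index_iota ?iota_uniq //=.
  rewrite dk poweRyr ?gt_eqF // addye // gt_eqF // (@lt_le_trans _ _ 0%E) ?ltNy0 //.
  by apply: sume_ge0 => j _; exact: poweR_ge0.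
pose dd k := fine (dl k).
have ddE k : (1 <= k < N.+2)%N -> dl k = (dd k)%:E.
  move=> kN; rewrite /dd fineK // ge0_fin_numE // ltey.
  by apply/eqP => dk; apply: fin; exists k.
have dd0 k : 0 <= dd k by exact: fine_ge0.
have Phid k la om : (1 <= k <= N.+1)%N -> `|la| <= r -> dot om om = 1 ->
    Phi la om k <= dd k.
  by move=> kN lar om1; rewrite -lee_fin -ddE //; exact: Phi_le.
have -> : (\sum_(1 <= k < N.+2) poweR (dl k) (3 ^+ k / 3 ^+ N.+1)%R = (rates dd N)%:E)%E.
  rewrite /rates -sumEFin big_seq [RHS]big_seq; apply: eq_bigr => k.
  by rewrite mem_index_iota => kN; rewrite ddE // poweR_EFin.
apply: ge_ereal_sup => y [la]; rewrite itv => lar <-.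
rewrite -EFinM lee_fin.
apply: (@le_trans _ _ (TC N * (CN N * rates dd N))).
  apply: (HTC N).2 => t.
  have -> : (D_eta N g1 (la, 0) - D_eta N g2 (la, 0)) t = wdiff g1 g2 (map Some t) la.
    by rewrite !ffunE /wdiff /dword !foldr_map.
  by apply: ((HCN N).2 Nl g1 g2 Phi dd adm dd0 Phid) => //; rewrite size_map size_tuple.
rewrite mulrA ler_wpM2r ?rates_ge0 // /C2 (bigD1 (Ordinal Nl)) //= addrCA lerDl.
by rewrite addr_ge0 // sumr_ge0.
Qed.
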